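(* Let $a>0$, let $\mathcal{L}$ be a linear configuration and let $\mathcal{A}$ be a family of compact abelian groups such that $\mathcal{L}$ has true complexity at most $1$ in $\mathcal{A}$. Then the map $f\mapsto t(\mathcal{L},f)$ is continuous with respect to the metric $d$ on the set of (isomorphism classes of) measurable functions $f\in L^\infty(A)$ with $A\in\mathcal{A}$ and $|f|\le a$.
   Context: All compact abelian groups are second countable with normalized Haar measure. Metric $\hat d$: for a group $G$, $l^2(G)$ is the set of $f:G\to\mathbb{C}$ with $\sum_g|f(g)|^2<\infty$; ${\rm supp}_\epsilon(f)=\{g:|f(g)|>\epsilon\}$. A partial isomorphism of weight $n$ between groups $G_1,G_2$ is a bijection $\phi:S_1\to S_2$ ($S_j\subseteq G_j$) such that for all $g_1,\dots,g_n\in S_1$, $\alpha_i\in\{-1,0,1\}$: $g_1^{\alpha_1}\cdots g_n^{\alpha_n}=1$ iff $\phi(g_1)^{\alpha_1}\cdots\phi(g_n)^{\alpha_n}=1$. An $\epsilon$-isomorphism between $f_1\in l^2(G_1)$, $f_2\in l^2(G_2)$ is a partial isomorphism $\phi:S_1\to S_2$ of weight $\lceil1/\epsilon\rceil$ with ${\rm supp}_\epsilon(f_j)\subseteq S_j$ and $|f_1(g)-f_2(\phi(g))|\le\epsilon$ for $g\in S_1$; $\hat d(f_1,f_2)$ is the infimum of such $\epsilon$. For $f_j\in L^2(A_j)$ on compact abelian groups, $d(f_1,f_2)=\hat d(\hat f_1,\hat f_2)$, where $\hat f_j$ is the Fourier transform on the discrete dual group $\hat A_j$. Two functions $f_1\in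 L^2(A_1),f_2\in L^2(A_2)$ are isomorphic if there are $f_3\in L^2(A_3)$ and continuous epimorphisms $\alpha_j:A_j\to A_3$ with $f_3\circ\alpha_j=f_j$ a.e.; $d$ is a metric on isomorphism classes. Linear configurations and densities: a linear form is $L=\sum_i\lambda_ix_i$ with $\lambda_i\in\mathbb{Z}$; a linear configuration is a finite system $\mathcal{L}=\{L_1,\dots,L_k\}$ of forms in $x_1,\dots,x_n$; $t(\mathcal{L},(f_i)_i)=\mathbb{E}_{x_1,\dots,x_n\in A}\prod_{i}f_i(L_i(x_1,\dots,x_n))$ and $t(\mathcal{L},f)$ is the case $f_i=f$. $\|f\|_{U_2}=\big(\mathbb{E}_{x,a,b}f(x)\overline{f(x+a)}\,\overline{f(x+b)}f(x+a+b)\big)^{1/4}$. $\mathcal{L}$ has true complexity at most $1$ in $\mathcal{A}$ if for every $\epsilon>0$ there is $\delta>0$ such that for every $A\in\mathcal{A}$ and measurable $f_1,\dots,f_k$ on $A$ with $|f_i|\le1$ and $\|f_j\|_{U_2}\le\delta$ for some $j$, $|t(\mathcal{L},(f_i)_i)|\le\epsilon$. *)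

(* Defs.v *)
From HB Require Import structures.
From mathcomp Require Import all_boot all_order all_algebra.
From mathcomp Require Import complex.
From mathcomp Require Import all_classical all_reals all_analysis.

Set Implicit Arguments.
Unset Strict Implicit.
Unset Printing Implicit Defensive.

Import Order.TTheory GRing.Theory Num.Theory.
Import numFieldNormedType.Exports.

Local Open Scope classical_set_scope.
Local Open Scope complex_scope.
Local Open Scope ring_scope.

(* Measurable types are required to be pointed, topological groups are not:
   [pointed0 A] is A pointed at 0. *)
Definition pointed0 (A : topologicalZmodType) : Type := A.
HB.instance Definition _ (A : topologicalZmodType) := Choice.on (pointed0 A).
HB.instance Definition _ (A : topologicalZmodType) :=
  isPointed.Build (pointed0 A) (0 : A).

Notation borel A :=
  (g_sigma_algebraType (open : set (set (pointed0 A)))).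

(* The normalized Haar measure is part of the record because its existence is
   not in the library; the invariance axiom determines it uniquely. *)
Record compact_abelian_group (R : realType) := CompactAbelianGroup {
  cag_sort :> topologicalZmodType;
  cag_compact : compact [set: cag_sort];
  cag_hausdorff : hausdorff_space cag_sort;
  cag_second_countable : @second_countable cag_sort;
  haar : probability (borel cag_sort) R;
  haar_invariant : forall (x : cag_sort) (B : set (borel cag_sort)),
    measurable B -> haar ((fun y : cag_sort => x + y) @^-1` B) = haar B
}.

Section Integration.
Context (R : realType) (A : compact_abelian_group R).

Definition cmeasurable (f : A -> R[i]) : Prop :=
  measurable_fun [set: borel A] (fun x => complex.Re (f x)) /\
  measurable_fun [set: borel A] (fun x => complex.Im (f x)).

Definition haar_expectation (f : A -> R[i]) : R[i] :=
  (\int[haar A]_x complex.Re (f x)) +i* (\int[haar A]_x complex.Im (f x)).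

(* Expectation over independent x_1, ..., x_n, as an iterated integral. *)
Fixpoint haar_expectation_n (n : nat) : (n.-tuple A -> R[i]) -> R[i] :=
  if n is m.+1 then fun F =>
    haar_expectation (fun x => haar_expectation_n (fun t : m.-tuple A => F (cons_tuple x t)))
  else fun F => F [tuple].

Definition square_integrable (f : A -> R[i]) : Prop :=
  cmeasurable f /\
  (\int[haar A]_x ((complex.Re (f x)) ^+ 2 + (complex.Im (f x)) ^+ 2)%:E
     < +oo)%E.

Definition Linfty_ball (a : R) (f : A -> R[i]) : Prop :=
  cmeasurable f /\ {ae haar A, forall x, `|f x| <= a%:C}.

(* The fourth root is taken of the real part of an expectation which is always
   a nonnegative real number. *)
Definition U2norm (f : A -> R[i]) : R :=
  complex.Re (haar_expectation (fun x => haar_expectation (fun a => haar_expectation (fun b =>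
    f x * (f (x + a))^* * (f (x + b))^* * f (x + a + b))))) `^ (4%:R^-1).

End Integration.

Section Dual.
Context (R : realType) (A : topologicalZmodType).

Record dual := Character {
  char_fun :> A -> R[i];
  char_continuous : continuous (char_fun : A -> R[i]^o);
  char_norm : forall x, `|char_fun x| = 1;
  charD : forall x y, char_fun (x + y) = char_fun x * char_fun y
}.

Lemma dual_ext (u v : dual) : (forall x, u x = v x) -> u = v.
Proof.
case: u v => [u u1 u2 u3] [v v1 v2 v3] /= /funext uv; subst v.
by congr Character; exact: Prop_irrelevance.
Qed.

Lemma char0 (u : dual) : u 0 = 1.
Proof.
have u0 : u 0 != 0 by rewrite -normr_eq0 char_norm oner_eq0.
by apply: (mulfI u0); rewrite mulr1 -charD addr0.
Qed.

Lemma dual_one_continuous : continuous ((fun=> 1) : A -> R[i]^o).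
Proof. by move=> x; exact: cvg_cst. Qed.
Lemma dual_one_norm (x : A) : `|1 : R[i]| = 1.
Proof. exact: normr1. Qed.
Lemma dual_oneD (x y : A) : (1 : R[i]) = 1 * 1.
Proof. by rewrite mulr1. Qed.
Definition dual_one : dual :=
  Character dual_one_continuous dual_one_norm dual_oneD.

Section Operations.
Variables u v : dual.

Lemma dual_mul_continuous : continuous ((fun x => u x * v x) : A -> R[i]^o).
Proof.
move=> x; apply: (@continuousM R[i] A (u : A -> R[i]^o) (v : A -> R[i]^o)).
  exact: char_continuous.
exact: char_continuous.
Qed.
Lemma dual_mul_norm x : `|u x * v x| = 1.
Proof. by rewrite normrM !char_norm mulr1. Qed.
Lemma dual_mulD x y : u (x + y) * v (x + y) = u x * v x * (u y * v y).
Proof. by rewrite !charD mulrACA. Qed.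
Definition dual_mul : dual :=
  Character dual_mul_continuous dual_mul_norm dual_mulD.

Lemma dual_inv_continuous : continuous ((fun x => u (- x)) : A -> R[i]^o).
Proof.
move=> x; apply: (@continuous_comp _ _ _ (-%R : A -> A) (u : A -> R[i]^o)).
  exact: opp_continuous.
exact: char_continuous.
Qed.
Lemma dual_inv_norm x : `|u (- x)| = 1.
Proof. exact: char_norm. Qed.
Lemma dual_invD x y : u (- (x + y)) = u (- x) * u (- y).
Proof. by rewrite opprD charD. Qed.
Definition dual_inv : dual :=
  Character dual_inv_continuous dual_inv_norm dual_invD.

End Operations.

Lemma dual_mulA : associative dual_mul.
Proof. by move=> u v w; apply: dual_ext => x /=; rewrite mulrA. Qed.
Lemma dual_mul1 : left_id dual_one dual_mul.
Proof. by move=> u; apply: dual_ext => x /=; rewrite mul1r. Qed.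
Lemma dual_mulr1 : right_id dual_one dual_mul.
Proof. by move=> u; apply: dual_ext => x /=; rewrite mulr1. Qed.
Lemma dual_mulV : left_inverse dual_one dual_inv dual_mul.
Proof.
by move=> u; apply: dual_ext => x /=; rewrite -charD addNr char0.
Qed.
Lemma dual_mulrV : right_inverse dual_one dual_inv dual_mul.
Proof.
by move=> u; apply: dual_ext => x /=; rewrite -charD addrN char0.
Qed.

HB.instance Definition _ := gen_eqMixin dual.
HB.instance Definition _ := gen_choiceMixin dual.
HB.instance Definition _ := isGroup.Build dual
  dual_mulA dual_mul1 dual_mulr1 dual_mulV dual_mulrV.

End Dual.

Section MetricHat.
Context (R : realType) (G1 G2 : groupType).

Definition expgz (G : groupType) (g : G) (z : int) : G :=
  match z with Posz m => (g ^+ m)%g | Negz m => (g ^- m.+1)%g end.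

(* [phi] is a total function of which only the values on [S1] matter. *)
Definition partial_isomorphism (n : nat) (S1 : set G1) (S2 : set G2)
    (phi : G1 -> G2) : Prop :=
  set_bij S1 S2 phi /\
  forall (g : 'I_n -> G1) (alpha : 'I_n -> int),
    (forall i, S1 (g i)) ->
    (forall i, alpha i \in [:: -1; 0; 1]) ->
    (\prod_(i < n) expgz (g i) (alpha i) = 1)%g <->
    (\prod_(i < n) expgz (phi (g i)) (alpha i) = 1)%g.

Definition supp (G : Type) (eps : R) (f : G -> R[i]) : set G :=
  [set g | eps%:C < `|f g|].

Definition eps_isomorphism (eps : R) (f1 : G1 -> R[i]) (f2 : G2 -> R[i])
    (S1 : set G1) (S2 : set G2) (phi : G1 -> G2) : Prop :=
  [/\ partial_isomorphism `|Num.ceil eps^-1|%N S1 S2 phi,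
      supp eps f1 `<=` S1,
      supp eps f2 `<=` S2 &
      forall g, S1 g -> `|f1 g - f2 (phi g)| <= eps%:C].

(* Only used for square-summable [f1] and [f2]: these are bounded, so that the
   set below contains every large [eps] (take [S1] and [S2] empty). *)
Definition dist_hat (f1 : G1 -> R[i]) (f2 : G2 -> R[i]) : R :=
  inf [set eps | 0 < eps /\
    exists (S1 : set G1) (S2 : set G2) (phi : G1 -> G2),
      eps_isomorphism eps f1 f2 S1 S2 phi].

End MetricHat.

Definition fourier (R : realType) (A : compact_abelian_group R)
    (f : A -> R[i]) : dual R A -> R[i] :=
  fun chi => haar_expectation (fun x => f x * (chi x)^*).

Section TwoFunctions.
Context (R : realType) (A1 A2 : compact_abelian_group R).

Definition fun_dist (f1 : A1 -> R[i]) (f2 : A2 -> R[i]) : R :=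
  dist_hat (fourier f1) (fourier f2).

Definition isomorphic (f1 : A1 -> R[i]) (f2 : A2 -> R[i]) : Prop :=
  exists (A3 : compact_abelian_group R) (f3 : A3 -> R[i])
      (alpha1 : {additive A1 -> A3}) (alpha2 : {additive A2 -> A3}),
    [/\ square_integrable f3,
        continuous alpha1 /\ set_surj [set: A1] [set: A3] alpha1,
        continuous alpha2 /\ set_surj [set: A2] [set: A3] alpha2,
        {ae haar A1, forall x, f3 (alpha1 x) = f1 x} &
        {ae haar A2, forall x, f3 (alpha2 x) = f2 x}].

End TwoFunctions.

(* A linear configuration of k forms in n variables is the k x n matrix whose
   row i consists of the coefficients of the form L_i. *)
Definition linear_form_eval (A : zmodType) (k n : nat) (L : 'M[int]_(k, n))
    (i : 'I_k) (x : n.-tuple A) : A :=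
  \sum_(j < n) tnth x j *~ L i j.

Definition multi_density (R : realType) (A : compact_abelian_group R)
    (k n : nat) (L : 'M[int]_(k, n)) (f : 'I_k -> A -> R[i]) : R[i] :=
  haar_expectation_n (fun x : n.-tuple A =>
    \prod_(i < k) f i (linear_form_eval L i x)).

Definition density (R : realType) (A : compact_abelian_group R)
    (k n : nat) (L : 'M[int]_(k, n)) (f : A -> R[i]) : R[i] :=
  multi_density L (fun=> f).

Definition true_complexity_at_most_1 (R : realType) (k n : nat)
    (L : 'M[int]_(k, n)) (F : compact_abelian_group R -> Prop) : Prop :=
  forall eps : R, 0 < eps -> exists2 delta : R, 0 < delta &
    forall A : compact_abelian_group R, F A ->
    forall f : 'I_k -> A -> R[i],
      (forall i, cmeasurable (f i)) ->
      (forall i x, `|f i x| <= 1) ->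
      (exists j, U2norm (f j) <= delta) ->
      `|multi_density L f| <= eps%:C.

(* Main.v *)
(* If the U_2 norm of a bounded h is not small, then h correlates with a
   character.  Indeed the normalized convolution powers of the autocorrelation
   of h converge uniformly to an idempotent, every nonzero idempotent has norm at
   least 1, so a nearly minimal one cannot be split, and this forces it to be a
   multiple of a character (measurable characters are continuous by Steinhaus'
   argument).  Hence convolving f with a Fejer kernel built on the finitely many
   characters where its Fourier transform is large gives a bounded trigonometric
   polynomial which is close to f in U_2, and so has nearly the same density by
   complexity.  The density of this polynomial depends only on its coefficients
   and on the relations of bounded length between those characters.  A good
   enough eps-isomorphism preserves these relations, moves the coefficients by
   little, and carries the large spectrum of f onto a set containing the large
   spectrum of g, so that one kernel serves both functions.

   Null sets are harmless: their indicators have U_2 norm zero, so complexity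
   shows that the linear forms do not charge them. *)

(* Only Bessel's inequality is used, never Parseval's identity, but the latter explains the
   constructions. It would say that the numbers [m n] in [spectral_idempotent] are the sums over all
   characters of [|fourier g chi|^(2n+2)]. Their growth rate is then the largest
   [|fourier g chi|^2], the rescaled powers of the autocorrelation tend to the sum of the characters
   attaining it, and the squared norm of that limit counts them. Hence the lower bound 1, and hence
   a minimal idempotent is a single character. The characters of the large spectrum may satisfy
   relations, so the mean of a Fejer kernel built on them is not known in advance. Kernels are
   therefore lists of formal words; the mean is the number of words with trivial value, and a
   partial isomorphism of large weight preserves this number. One list serves both groups, its
   letters being read as [chi] or as [phi chi]. Complexity fixes a bound on U_2 norms, this fixes
   the spectral threshold and the kernel length, and together with [f] they fix the list of words.
   The admissible distance is chosen last, and nothing depends on [g]. *)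
Require Import Defs.
From HB Require Import structures.
From mathcomp Require Import all_boot all_order all_algebra.
From mathcomp Require Import complex ring lra.
From mathcomp Require Import all_classical all_reals all_analysis.
From mathcomp Require Import measurable_realfun.

Set Implicit Arguments.
Unset Strict Implicit.
Unset Printing Implicit Defensive.

Import Order.TTheory GRing.Theory Num.Theory.
Import numFieldNormedType.Exports.

Local Open Scope classical_set_scope.
Local Open Scope complex_scope.
Local Open Scope ring_scope.


(** * Complex-valued expectations *)

Section ComplexModulus.
Context (R : realType).
Implicit Types z w : R[i].

(** The norm of an element of [R[i]] lies again in [R[i]]; estimates and limits are carried out with
    this copy of it in [R]. *)
Definition modulus z : R := complex.Re `|z|.

Lemma normE z : `|z| = (modulus z)%:C.
Proof. by rewrite /modulus RRe_real// normr_real. Qed.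

Lemma modulus_ge0 z : 0 <= modulus z.
Proof. by rewrite -lecR -normE normr_ge0. Qed.

Lemma modulus_le z r : (`|z| <= r%:C) = (modulus z <= r).
Proof. by rewrite normE lecR. Qed.

Lemma modulusM z w : modulus (z * w) = modulus z * modulus w.
Proof. by apply: complexI; rewrite rmorphM/= -!normE normrM. Qed.

Lemma modulusD z w : modulus (z + w) <= modulus z + modulus w.
Proof. by rewrite -lecR rmorphD/= -!normE ler_normD. Qed.

Lemma modulusN z : modulus (- z) = modulus z.
Proof. by rewrite /modulus normrN. Qed.

Lemma modulusB z w : modulus (z - w) <= modulus z + modulus w.
Proof. by rewrite -[modulus w]modulusN modulusD. Qed.

Lemma modulusJ z : modulus z^* = modulus z.
Proof. by rewrite /modulus norm_conjC. Qed.

Lemma modulus0 : modulus 0 = 0.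
Proof. by rewrite /modulus normr0. Qed.

Lemma modulus1 : modulus 1 = 1.
Proof. by rewrite /modulus normr1. Qed.

Lemma modulus_eq0 z : modulus z = 0 -> z = 0.
Proof. by move=> z0; apply/eqP; rewrite -normr_eq0 normE z0. Qed.

Lemma modulus_real (r : R) : modulus r%:C = `|r|.
Proof. by rewrite /modulus normc_def/= expr0n addr0 sqrtr_sqr. Qed.

Lemma mulJ z : z * z^* = (modulus z ^+ 2)%:C.
Proof. by rewrite -normCK normE rmorphXn. Qed.

Lemma sqr_modulus z : modulus z ^+ 2 = complex.Re z ^+ 2 + complex.Im z ^+ 2.
Proof. by apply: complexI; rewrite rmorphXn/= -normE add_Re2_Im2. Qed.

Lemma Re_le_modulus z : `|complex.Re z| <= modulus z.
Proof. by rewrite -lecR -normE normc_ge_Re. Qed.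

Lemma Im_le_modulus z : `|complex.Im z| <= modulus z.
Proof.
rewrite -(ler_pXn2r (ltn0Sn 1)) ?nnegrE ?modulus_ge0// sqr_modulus.
by rewrite real_normK ?num_real// lerDr sqr_ge0.
Qed.

Lemma modulus_le_ReIm z : modulus z <= `|complex.Re z| + `|complex.Im z|.
Proof.
rewrite -(ler_pXn2r (ltn0Sn 1)) ?nnegrE ?modulus_ge0 ?addr_ge0//.
by rewrite sqr_modulus sqrrD !real_normK ?num_real// lerD2r lerDl mulrn_wge0 ?mulr_ge0.
Qed.

Lemma ReD z w : complex.Re (z + w) = complex.Re z + complex.Re w.
Proof. by case: z w => ? ? []. Qed.
Lemma ImD z w : complex.Im (z + w) = complex.Im z + complex.Im w.
Proof. by case: z w => ? ? []. Qed.
Lemma ReN z : complex.Re (- z) = - complex.Re z.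
Proof. by case: z. Qed.
Lemma ImN z : complex.Im (- z) = - complex.Im z.
Proof. by case: z. Qed.
Lemma ReM z w : complex.Re (z * w) =
  complex.Re z * complex.Re w - complex.Im z * complex.Im w.
Proof. by case: z w => ? ? []. Qed.
Lemma ImM z w : complex.Im (z * w) =
  complex.Re z * complex.Im w + complex.Im z * complex.Re w.
Proof. by case: z w => ? ? []. Qed.
Lemma ReJ z : complex.Re z^* = complex.Re z.
Proof. by case: z. Qed.
Lemma ImJ z : complex.Im z^* = - complex.Im z.
Proof. by case: z. Qed.

Lemma complex_ext z w :
  complex.Re z = complex.Re w -> complex.Im z = complex.Im w -> z = w.
Proof. by case: z w => ? ? [? ?] /= -> ->. Qed.

End ComplexModulus.

(** * Bounded measurable complex functions *)

Section ComplexMeasurable.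
Context (R : realType).

Definition cmeas d (X : measurableType d) (f : X -> R[i]) : Prop :=
  measurable_fun setT (fun x => complex.Re (f x)) /\
  measurable_fun setT (fun x => complex.Im (f x)).

Definition bmeas d (X : measurableType d) (f : X -> R[i]) : Prop :=
  cmeas f /\ exists M, forall x, modulus (f x) <= M.

Context d (X : measurableType d).
Implicit Types f g : X -> R[i].

Lemma cmeas_cst (c : R[i]) : cmeas (fun _ : X => c).
Proof. by split; exact: measurable_cst. Qed.

Lemma cmeasD f g : cmeas f -> cmeas g -> cmeas (fun x => f x + g x).
Proof.
move=> [f1 f2] [g1 g2]; split.
  under eq_fun do rewrite ReD; exact: measurable_funD.
under eq_fun do rewrite ImD; exact: measurable_funD.
Qed.

Lemma cmeasN f : cmeas f -> cmeas (fun x => - f x).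
Proof.
move=> [f1 f2]; split.
  under eq_fun do rewrite ReN; exact: measurableT_comp.
under eq_fun do rewrite ImN; exact: measurableT_comp.
Qed.

Lemma cmeasM f g : cmeas f -> cmeas g -> cmeas (fun x => f x * g x).
Proof.
move=> [f1 f2] [g1 g2]; split.
  under eq_fun do rewrite ReM.
  by apply: measurable_funB; exact: measurable_funM.
under eq_fun do rewrite ImM.
by apply: measurable_funD; exact: measurable_funM.
Qed.

Lemma cmeasJ f : cmeas f -> cmeas (fun x => (f x)^*).
Proof.
move=> [f1 f2]; split; first by under eq_fun do rewrite ReJ.
under eq_fun do rewrite ImJ; exact: measurableT_comp.
Qed.

Lemma cmeas_comp d' (Y : measurableType d') (u : Y -> X) f :
  cmeas f -> measurable_fun setT u -> cmeas (fun y => f (u y)).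
Proof. by move=> [f1 f2] mu; split;
  [exact: (measurableT_comp f1 mu)|exact: (measurableT_comp f2 mu)]. Qed.

Lemma cmeas_real (r : X -> R) : measurable_fun setT r -> cmeas (fun x => (r x)%:C).
Proof. by move=> mr; split => //=; exact: measurable_cst. Qed.

Lemma bmeas_cst (c : R[i]) : bmeas (fun _ : X => c).
Proof. by split; [exact: cmeas_cst | exists (modulus c)]. Qed.

Lemma bmeasD f g : bmeas f -> bmeas g -> bmeas (fun x => f x + g x).
Proof.
move=> [mf [M fM]] [mg [N gN]]; split; first exact: cmeasD.
by exists (M + N) => x; rewrite (le_trans (modulusD _ _))// lerD.
Qed.

Lemma bmeasN f : bmeas f -> bmeas (fun x => - f x).
Proof.
move=> [mf [M fM]]; split; first exact: cmeasN.
by exists M => x; rewrite modulusN.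
Qed.

Lemma bmeasB f g : bmeas f -> bmeas g -> bmeas (fun x => f x - g x).
Proof. by move=> bf bg; apply: bmeasD => //; exact: bmeasN. Qed.

Lemma bmeasM f g : bmeas f -> bmeas g -> bmeas (fun x => f x * g x).
Proof.
move=> [mf [M fM]] [mg [N gN]]; split; first exact: cmeasM.
by exists (M * N) => x; rewrite modulusM ler_pM// modulus_ge0.
Qed.

Lemma bmeasJ f : bmeas f -> bmeas (fun x => (f x)^*).
Proof.
move=> [mf [M fM]]; split; first exact: cmeasJ.
by exists M => x; rewrite modulusJ.
Qed.

Lemma bmeas_comp d' (Y : measurableType d') (u : Y -> X) f :
  bmeas f -> measurable_fun setT u -> bmeas (fun y => f (u y)).
Proof.
by move=> [mf [M fM]] mu; split; [exact: cmeas_comp | exists M].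
Qed.

Lemma bmeas_prod (I : Type) (s : seq I) (P : pred I) (f : I -> X -> R[i]) :
  (forall i, bmeas (f i)) -> bmeas (fun x => \prod_(i <- s | P i) f i x).
Proof.
move=> mf; elim: s => [|i s IH].
  by under eq_fun do rewrite big_nil; exact: bmeas_cst.
under eq_fun do rewrite big_cons; case: (P i) => //.
exact: bmeasM.
Qed.

Lemma bmeas_sum (I : Type) (s : seq I) (P : pred I) (f : I -> X -> R[i]) :
  (forall i, bmeas (f i)) -> bmeas (fun x => \sum_(i <- s | P i) f i x).
Proof.
move=> mf; elim: s => [|i s IH].
  by under eq_fun do rewrite big_nil; exact: bmeas_cst.
under eq_fun do rewrite big_cons; case: (P i) => //.
exact: bmeasD.
Qed.

End ComplexMeasurable.

Ltac bmeas := repeat lazymatch goal with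
  | |- bmeas (fun _ => _ + - _) => apply: bmeasB
  | |- bmeas (fun _ => _ + _) => apply: bmeasD
  | |- bmeas (fun _ => _ * _) => apply: bmeasM
  | |- bmeas (fun _ => - _) => apply: bmeasN
  | |- bmeas (fun _ => _^*) => apply: bmeasJ
  | |- bmeas (fun _ => \sum_(_ <- _ | _) _) => apply: bmeas_sum => ?
  | |- bmeas (fun _ => \prod_(_ <- _ | _) _) => apply: bmeas_prod => ?
  | |- _ => first [assumption | exact: bmeas_cst]
  end.

(** * Expectation, squared L^2 norm and the Cauchy-Schwarz inequality *)

Section Expectation.
Context (R : realType) d (X : measurableType d) (P : probability X R).
Implicit Types f g : X -> R[i].

Definition cexp f : R[i] :=
  (\int[P]_x complex.Re (f x)) +i* (\int[P]_x complex.Im (f x)).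

Lemma bounded_integrable (r : X -> R) (M : R) :
  measurable_fun setT r -> (forall x, `|r x| <= M) ->
  P.-integrable setT (EFin \o r).
Proof.
move=> mr rM; apply: measurable_bounded_integrable => //.
  by apply: (@le_lt_trans _ _ 1%E); [exact: probability_le1|exact: ltry].
exists M; split; first exact: num_real.
by move=> N MN x _ /=; exact: le_trans (rM x) (ltW MN).
Qed.

Lemma bmeas_Re f : bmeas f -> P.-integrable setT (EFin \o (fun x => complex.Re (f x))).
Proof.
by move=> [[mf _] [M fM]]; apply: (@bounded_integrable _ M) => // x;
  rewrite (le_trans (Re_le_modulus _)).
Qed.

Lemma bmeas_Im f : bmeas f -> P.-integrable setT (EFin \o (fun x => complex.Im (f x))).
Proof.
by move=> [[_ mf] [M fM]]; apply: (@bounded_integrable _ M) => // x;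
  rewrite (le_trans (Im_le_modulus _)).
Qed.

Lemma cexpD f g : bmeas f -> bmeas g ->
  cexp (fun x => f x + g x) = cexp f + cexp g.
Proof.
move=> bf bg; apply: complex_ext => /=.
  under eq_Rintegral do rewrite ReD.
  by rewrite RintegralD//; exact: bmeas_Re.
under eq_Rintegral do rewrite ImD.
by rewrite RintegralD//; exact: bmeas_Im.
Qed.

Lemma cexpZ c f : bmeas f -> cexp (fun x => c * f x) = c * cexp f.
Proof.
move=> bf; have fR := bmeas_Re bf; have fI := bmeas_Im bf.
have Z (r : R) (h : X -> R) : P.-integrable setT (EFin \o h) ->
    P.-integrable setT (EFin \o (fun x => r * h x)).
  by move=> ih; exact: (@integrableZl _ _ _ P setT measurableT r (EFin \o h)).
apply: complex_ext => /=.
  under eq_Rintegral do rewrite ReM.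
  by rewrite RintegralB ?RintegralZl ?ReM//; exact: Z.
under eq_Rintegral do rewrite ImM.
by rewrite RintegralD ?RintegralZl ?ImM//; exact: Z.
Qed.

Lemma cexp_cst c : cexp (fun=> c) = c.
Proof.
have PT : P setT = 1%E by exact: probability_setT.
by apply: complex_ext => /=; rewrite Rintegral_cst//= PT/= mulr1.
Qed.

Lemma cexpJ f : bmeas f -> cexp (fun x => (f x)^*) = (cexp f)^*.
Proof.
move=> bf; apply: complex_ext => /=.
  by apply: eq_Rintegral => x _; rewrite ReJ.
under eq_Rintegral do rewrite ImJ -mulN1r.
by rewrite RintegralZl ?mulN1r//; exact: bmeas_Im.
Qed.

Lemma eq_cexp f g : f =1 g -> cexp f = cexp g.
Proof. by move=> /funext ->. Qed.

Lemma cexp_real (r : X -> R) : cexp (fun x => (r x)%:C) = (\int[P]_x r x)%:C.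
Proof.
by apply: complex_ext => //=; rewrite Rintegral_cst// mul0r.
Qed.

Lemma cexp_ge0 f : (forall x, 0 <= f x) -> 0 <= cexp f.
Proof.
move=> f0; have -> : f = fun x => (complex.Re (f x))%:C.
  by apply/funext => x; rewrite RRe_real// ger0_real.
by rewrite cexp_real lecR Rintegral_ge0// => x _; have := f0 x; rewrite lecE => /andP[].
Qed.

Lemma cexpN f : bmeas f -> cexp (fun x => - f x) = - cexp f.
Proof. by move=> bf; under eq_cexp do rewrite -mulN1r; rewrite cexpZ// mulN1r. Qed.

Lemma cexpB f g : bmeas f -> bmeas g ->
  cexp (fun x => f x - g x) = cexp f - cexp g.
Proof. by move=> bf bg; rewrite cexpD ?cexpN//; exact: bmeasN. Qed.

Lemma cexpZr c f : bmeas f -> cexp (fun x => f x * c) = cexp f * c.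
Proof. by move=> bf; under eq_cexp do rewrite mulrC; rewrite cexpZ// mulrC. Qed.

Lemma cexp_sum (I : Type) (s : seq I) (Q : pred I) (f : I -> X -> R[i]) :
  (forall i, bmeas (f i)) ->
  cexp (fun x => \sum_(i <- s | Q i) f i x) = \sum_(i <- s | Q i) cexp (f i).
Proof.
move=> bf; elim: s => [|i s IH].
  by rewrite big_nil; under eq_cexp do rewrite big_nil; rewrite cexp_cst.
rewrite big_cons -IH; under eq_cexp do rewrite big_cons.
by case: (Q i) => //; rewrite cexpD//; exact: bmeas_sum.
Qed.

Definition sqnorm f : R := complex.Re (cexp (fun x => f x * (f x)^*)).

Lemma sqnormE f : (sqnorm f)%:C = cexp (fun x => f x * (f x)^*).
Proof.
rewrite /sqnorm RRe_real// ger0_real// cexp_ge0// => x.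
exact: mul_conjC_ge0.
Qed.

Lemma sqnorm_ge0 f : 0 <= sqnorm f.
Proof. by rewrite -lecR sqnormE cexp_ge0// => x; exact: mul_conjC_ge0. Qed.

Lemma sqnormZ c f : bmeas f -> sqnorm (fun x => c * f x) = modulus c ^+ 2 * sqnorm f.
Proof.
move=> bf; apply: complexI; rewrite rmorphM /= !sqnormE -mulJ -cexpZ; last by bmeas.
by apply: eq_cexp => x; rewrite rmorphM mulrACA.
Qed.

Lemma sqnorm_mono f g : bmeas f -> bmeas g ->
  (forall x, modulus (f x) <= modulus (g x)) -> sqnorm f <= sqnorm g.
Proof.
move=> bf bg fg; rewrite -subr_ge0 -lecR rmorphB/= !sqnormE -cexpB; first last.
- by apply: bmeasM => //; exact: bmeasJ.
- by apply: bmeasM => //; exact: bmeasJ.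
apply: cexp_ge0 => x; rewrite !mulJ -rmorphB/= lecR subr_ge0.
by rewrite lerXn2r ?nnegrE ?modulus_ge0.
Qed.

Lemma sqnorm_le f (M : R) : bmeas f -> (forall x, modulus (f x) <= M) ->
  sqnorm f <= M ^+ 2.
Proof.
move=> bf fM; have M0 : 0 <= M by rewrite (le_trans _ (fM point))// modulus_ge0.
have := @sqnorm_mono f (fun=> M%:C) bf (bmeas_cst _ _).
have -> : sqnorm (fun=> M%:C) = M ^+ 2.
  by rewrite /sqnorm (cexp_cst (M%:C * _)) mulJ/= modulus_real ger0_norm.
by apply=> x; rewrite modulus_real ger0_norm.
Qed.

Lemma cauchy_schwarz f g : bmeas f -> bmeas g ->
  modulus (cexp (fun x => f x * (g x)^*)) ^+ 2 <= sqnorm f * sqnorm g.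
Proof.
move=> bf bg; set c := cexp _; set a := sqnorm f; set b := sqnorm g.
have a0 : 0 <= a by exact: sqnorm_ge0.
have b0 : 0 <= b by exact: sqnorm_ge0.
(* Positivity of [|s f - c g|^2] for real [s] gives this quadratic inequality. *)
have quad (s : R) :
    0 <= s ^+ 2 * a - 2 * s * modulus c ^+ 2 + modulus c ^+ 2 * b.
  have := sqnorm_ge0 (fun x => s%:C * f x - c * g x).
  rewrite -lecR sqnormE.
  have bfJ := bmeasJ bf; have bgJ := bmeasJ bg.
  rewrite (@eq_cexp _ (fun x => (s ^+ 2)%:C * (f x * (f x)^*) -
     (s%:C * c^*) * (f x * (g x)^*) - (s%:C * c) * (f x * (g x)^*)^* +
     (c * c^*) * (g x * (g x)^*))); last first.
    move=> x; have -> : (s%:C * f x - c * g x)^* = s%:C * (f x)^* - c^* * (g x)^*.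
      by rewrite rmorphB !rmorphM /= [X in X * _]conjc_real.
    by rewrite [(f x * _)^*]rmorphM /= conjCK rmorphXn /=; ring.
  rewrite cexpD; [|by bmeas|by bmeas].
  rewrite cexpB; [|by bmeas|by bmeas].
  rewrite cexpB; [|by bmeas|by bmeas].
  rewrite !cexpZ; [|by bmeas..].
  rewrite cexpJ; last by bmeas.
  rewrite -!sqnormE -/c -/a -/b.
  move: (s ^+ 2) (modulus c ^+ 2) (mulJ c) => s2 m2 cJ.
  rewrite (_ : _ + _ = (s2 * a - 2 * s * m2 + m2 * b)%:C) ?lecR//.
  by rewrite !(rmorphD, rmorphB, rmorphM, rmorphN, rmorph_nat)/= -cJ; ring.
have [b_gt0|] := ltP 0 b.
  have := quad b; have -> : b ^+ 2 * a - 2 * b * modulus c ^+ 2 + modulus c ^+ 2 * b =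
    b * (a * b - modulus c ^+ 2) by ring.
  by rewrite pmulr_rge0// subr_ge0.
move=> b_le0; have {b_le0}b_eq0 : b = 0 by apply/le_anti; rewrite b_le0 b0.
(* With [b = 0] the quadratic is negative at small positive [s] unless [c = 0]. This [s] is small
   enough, and the [+ 1] covers the case [a = 0]. *)
have := quad (modulus c ^+ 2 / (a + 1)); rewrite b_eq0 !mulr0 addr0.
set m := modulus c ^+ 2; have m0 : 0 <= m by exact: sqr_ge0.
have a1 : 0 < a + 1 by rewrite ltr_wpDl.
have -> : (m / (a + 1)) ^+ 2 * a - 2 * (m / (a + 1)) * m =
   - (m ^+ 2 * ((a + 2) / (a + 1) ^+ 2)) by field; rewrite gt_eqF.
rewrite oppr_ge0 pmulr_lle0; first by rewrite le_eqVlt ltNge sqr_ge0 orbF sqrf_eq0 => /eqP ->.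
by rewrite divr_gt0 ?exprn_gt0// ltr_wpDl.
Qed.

Lemma sqr_modulus_cexp f : bmeas f -> modulus (cexp f) ^+ 2 <= sqnorm f.
Proof.
move=> bf; have := cauchy_schwarz bf (bmeas_cst X 1).
under eq_cexp do rewrite conjC1 mulr1.
by rewrite [sqnorm (fun=> 1)]/sqnorm conjC1 mulr1 cexp_cst/= mulr1.
Qed.

Lemma modulus_cexp f (M : R) : bmeas f -> (forall x, modulus (f x) <= M) ->
  modulus (cexp f) <= M.
Proof.
move=> bf fM; have M0 : 0 <= M by rewrite (le_trans _ (fM point))// modulus_ge0.
rewrite -(ler_pXn2r (ltn0Sn 1)) ?nnegrE ?modulus_ge0//.
by rewrite (le_trans (sqr_modulus_cexp bf))// sqnorm_le.
Qed.

Lemma ae_eq_cexp f g : cmeas f -> cmeas g -> {ae P, forall x, f x = g x} ->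
  cexp f = cexp g.
Proof.
move=> [f1 f2] [g1 g2] fg; apply: complex_ext => /=; congr fine;
  apply: ae_eq_integral => //; try exact/measurable_EFinP;
  by apply: filterS fg => x ->.
Qed.

End Expectation.

(** * Dependence on parameters, Fubini and change of variables *)

Section ParametricExpectation.
Context (R : realType) d (X : measurableType d) d' (Y : measurableType d').

Lemma measurable_Rintegral_snd (Q : probability Y R) (F : X * Y -> R) :
  measurable_fun setT F -> measurable_fun setT (fun x => \int[Q]_y F (x, y)).
Proof.
move=> mF; apply: measurableT_comp => //.
rewrite (_ : (fun x => _) = fun x => (\int[Q]_y (EFin \o F)^\+%E (x, y) -
  \int[Q]_y (EFin \o F)^\-%E (x, y))%E).
  apply: emeasurable_funB.
    apply: (@measurable_fun_fubini_tonelli_F _ _ _ _ _ Q ((EFin \o F)^\+)%E) => //.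
    by apply: measurable_funepos; exact/measurable_EFinP.
  apply: (@measurable_fun_fubini_tonelli_F _ _ _ _ _ Q ((EFin \o F)^\-)%E) => //.
  by apply: measurable_funeneg; exact/measurable_EFinP.
apply/funext => x; rewrite [LHS]integralE; congr (_ - _)%E.
  by apply: eq_integral => y _; rewrite /= !funeposE.
by apply: eq_integral => y _; rewrite /= !funenegE.
Qed.

Lemma cmeas_cexp (Q : probability Y R) (F : X * Y -> R[i]) :
  cmeas F -> cmeas (fun x => cexp Q (fun y => F (x, y))).
Proof.
by move=> [F1 F2]; split => /=;
  [apply: (measurable_Rintegral_snd Q F1)|apply: (measurable_Rintegral_snd Q F2)].
Qed.

Lemma cmeas_pair1 (F : X * Y -> R[i]) x : cmeas F -> cmeas (fun y => F (x, y)).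
Proof. by move=> mF; apply: (cmeas_comp mF); exact: measurable_pair1. Qed.

Lemma bmeas_pair1 (F : X * Y -> R[i]) x : bmeas F -> bmeas (fun y => F (x, y)).
Proof. by move=> [mF [M FM]]; split; [exact: cmeas_pair1|exists M]. Qed.

Lemma bmeas_cexp (Q : probability Y R) (F : X * Y -> R[i]) :
  bmeas F -> bmeas (fun x => cexp Q (fun y => F (x, y))).
Proof.
move=> bF; have [mF [M FM]] := bF; split; first exact: cmeas_cexp.
by exists M => x; apply: modulus_cexp => //; exact: bmeas_pair1.
Qed.

Lemma Rintegral_Fubini (P : probability X R) (Q : probability Y R) (F : X * Y -> R)
    (M : R) : measurable_fun setT F -> (forall z, `|F z| <= M) ->
  \int[P]_x \int[Q]_y F (x, y) = \int[Q]_y \int[P]_x F (x, y).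
Proof.
move=> mF FM; rewrite /Rintegral; congr fine.
under eq_integral => x _.
  rewrite fineK; last first.
    apply: (integrable_fin_num measurableT) => //.
    apply: (@bounded_integrable _ _ _ Q _ M) => //.
    by apply: (measurableT_comp mF); exact: measurable_pair1.
  over.
under [RHS]eq_integral => y _.
  rewrite fineK; last first.
    apply: (integrable_fin_num measurableT) => //.
    apply: (@bounded_integrable _ _ _ P _ M) => //.
    by apply: (measurableT_comp mF); exact: measurable_pair2.
  over.
apply: (@Fubini _ _ X Y R P Q (EFin \o F)).
exact: (@bounded_integrable _ _ _ (P \x Q)%E F M).
Qed.

Lemma cexp_Fubini (P : probability X R) (Q : probability Y R) (F : X * Y -> R[i]) :
  bmeas F -> cexp P (fun x => cexp Q (fun y => F (x, y))) =
             cexp Q (fun y => cexp P (fun x => F (x, y))).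
Proof.
move=> [[m1 m2] [M FM]]; apply: complex_ext => /=.
  by apply: (Rintegral_Fubini P Q m1 (M := M)) => z; rewrite (le_trans (Re_le_modulus _)).
by apply: (Rintegral_Fubini P Q m2 (M := M)) => z; rewrite (le_trans (Im_le_modulus _)).
Qed.

Lemma Rintegral_measure_preserving (P : probability X R) (Q : probability Y R)
    (phi : X -> Y) (r : Y -> R) :
  measurable_fun setT phi ->
  (forall B, measurable B -> P (phi @^-1` B) = Q B) ->
  measurable_fun setT r -> \int[P]_x r (phi x) = \int[Q]_y r y.
Proof.
move=> mphi phiE mr; congr fine; rewrite [LHS]integralE [RHS]integralE.
have mr' : measurable_fun setT (EFin \o r) by exact/measurable_EFinP.
have E (h : Y -> \bar R) : measurable_fun setT h -> (forall y, 0 <= h y)%E ->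
    (\int[P]_x h (phi x) = \int[Q]_y h y)%E.
  move=> mh h0; rewrite -(@eq_measure_integral _ _ _ setT Q (pushforward P phi)).
    rewrite (ge0_integral_pushforward mphi)//.
  by move=> B mB _; exact: phiE.
congr (_ - _)%E.
  transitivity (\int[P]_x (EFin \o r)^\+%E (phi x))%E.
    by apply: eq_integral => x _; rewrite !funeposE.
  by apply: E => //; exact: measurable_funepos.
transitivity (\int[P]_x (EFin \o r)^\-%E (phi x))%E.
  by apply: eq_integral => x _; rewrite !funenegE.
by apply: E => //; exact: measurable_funeneg.
Qed.

Lemma cexp_measure_preserving (P : probability X R) (Q : probability Y R)
    (phi : X -> Y) (f : Y -> R[i]) :
  measurable_fun setT phi ->
  (forall B, measurable B -> P (phi @^-1` B) = Q B) ->
  cmeas f -> cexp P (fun x => f (phi x)) = cexp Q f.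
Proof.
move=> mphi phiE [m1 m2]; apply: complex_ext => /=.
  exact: (Rintegral_measure_preserving mphi phiE m1).
exact: (Rintegral_measure_preserving mphi phiE m2).
Qed.

End ParametricExpectation.

(** * Haar measure *)

Section BorelGroup.
Context (R : realType) (A : compact_abelian_group R).

Lemma open_borel (U : set A) : open U -> measurable (U : set (borel A)).
Proof. by move=> oU; apply: sub_sigma_algebra. Qed.

Lemma countable_open_basis : exists V : nat -> set A,
  (forall n, open (V n)) /\
  forall x U, nbhs x U -> exists n, V n x /\ V n `<=` U.
Proof.
have [B cB [oB bB]] := cag_second_countable A.
have /pfcard_geP[B0|[f]] := cB.
  have [/= V] := bB (0 : A) _ (@filterT _ (nbhs (0 : A)) _).
  by rewrite B0 => -[].
exists f; split=> [n|x U /(bB x)[V [BV Vx] VU]].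
  by apply: oB; exact: (@funS _ _ _ _ f).
have [n _ fnV] := @surj _ _ _ _ f V BV.
by exists n; rewrite fnV.
Qed.

Lemma measurable_continuous (B : compact_abelian_group R) (u : A -> B) :
  continuous u -> measurable_fun setT (u : borel A -> borel B).
Proof.
move=> cu; apply: (@measurability _ _ (borel A) (borel B) setT u
  (open : set (set (pointed0 B)))) => //.
move=> _ [U oU <-]; rewrite setTI; apply: open_borel.
by move/continuousP : cu; exact.
Qed.

Lemma measurable_continuous_real (u : A -> R) :
  continuous u -> measurable_fun setT (u : borel A -> R).
Proof.
move=> cu; apply: (measurability (@RGenOpens.G R)); first exact: RGenOpens.measurableE.
move=> _ [_ [x [y ->]] <-]; rewrite setTI; apply: open_borel.
by move/continuousP : cu; apply; exact: interval_open.
Qed.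

(** The source carries the product of the two Borel sigma-algebras. Second countability makes the
    preimage of an open set a countable union of rectangles of basic open sets, hence measurable
    there. *)
Lemma measurable_add :
  measurable_fun setT ((fun p => (p.1 : A) + (p.2 : A)) : borel A * borel A -> borel A).
Proof.
have [V [oV bV]] := countable_open_basis.
apply: (@measurability _ _ (borel A * borel A)%type (borel A) setT _
  (open : set (set (pointed0 A)))) => //.
move=> _ [U oU <-]; rewrite setTI.
rewrite (_ : _ @^-1` _ = \bigcup_m \bigcup_(n in [set n | forall x y : A,
    V m x -> V n y -> U (x + y)]) (V m `*` V n)).
  apply: bigcupT_measurable => m; apply: bigcup_measurable => n _.
  by apply: measurableX; exact: open_borel.
apply/seteqP; split=> [[x y] /= Uxy|[x y] [m _ [n]]]; last first.
  by move=> /= mn [/= Vx Vy]; exact: mn.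
have := @add_continuous A (x, y) U (open_nbhs_nbhs (conj oU Uxy)).
case=> -[P Q] /= [/bV[m [Vmx mP]] /bV[n [Vny nQ]] PQ].
exists m => //; exists n => //= x' y' /mP Px /nQ Qy.
exact: (PQ (x', y')).
Qed.

Section Arguments.
Context d (X : measurableType d).

Lemma measurable_addA (u v : X -> A) :
  measurable_fun setT (u : X -> borel A) -> measurable_fun setT (v : X -> borel A) ->
  measurable_fun setT ((fun x => u x + v x) : X -> borel A).
Proof.
move=> mu mv; exact: (measurableT_comp measurable_add (measurable_fun_pair mu mv)).
Qed.

Lemma measurable_oppA (u : X -> A) :
  measurable_fun setT (u : X -> borel A) ->
  measurable_fun setT ((fun x => - u x) : X -> borel A).
Proof.
apply: (measurableT_comp (@measurable_continuous A (fun x => - x) _)).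
exact: opp_continuous.
Qed.

Lemma measurable_subA (u v : X -> A) :
  measurable_fun setT (u : X -> borel A) -> measurable_fun setT (v : X -> borel A) ->
  measurable_fun setT ((fun x => u x - v x) : X -> borel A).
Proof. by move=> mu mv; apply: measurable_addA => //; exact: measurable_oppA. Qed.

Lemma measurable_mulzA (u : X -> A) (z : int) :
  measurable_fun setT (u : X -> borel A) ->
  measurable_fun setT ((fun x => u x *~ z) : X -> borel A).
Proof.
move=> mu; have P n : measurable_fun setT ((fun x => u x *+ n) : X -> borel A).
  elim: n => [|n IH]; first exact: measurable_cst.
  under eq_fun do rewrite mulrS; exact: measurable_addA.
by case: z => n; [exact: P | exact: measurable_oppA (P n.+1)].
Qed.

End Arguments.

Lemma measurable_translate (y : A) :
  measurable_fun setT ((fun x => y + x) : borel A -> borel A).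
Proof. by apply: measurable_addA; [exact: measurable_cst|exact: measurable_id]. Qed.

(** * Continuity of measure under small translations *)

Definition shift (y : A) (B : set (borel A)) : set (borel A) :=
  (fun x : A => y + x) @^-1` B.

Lemma measurable_shift (y : A) (B : set (borel A)) :
  measurable B -> measurable (shift y B).
Proof.
by move=> mB; rewrite -[shift y B]setTI; exact: (measurable_translate y).
Qed.

(** [C] and its shift have equal measure, so both halves of their symmetric difference do too. This
    carries continuity under shifts over to complements. *)
Lemma haar_setD_shift y (C : set (borel A)) : measurable C ->
  haar A ((setT `\` C) `\` shift y (setT `\` C)) = haar A (C `\` shift y C).
Proof.
move=> mC; pose D := shift y C; have mD : measurable D by exact: measurable_shift.
have CD : haar A C = haar A D by rewrite /D/shift haar_invariant.
rewrite (_ : _ `\` shift y _ = D `\` C); last first.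
  by rewrite !setTD /shift preimage_setC setDE setCK setIC -setDE.
have h1 := measureDI (haar A) mD mC; have h2 := measureDI (haar A) mC mD.
rewrite setIC in h2.
transitivity (haar A D - haar A (D `&` C))%E.
  by rewrite h1 addeK// fin_num_measure//; exact: measurableI.
by rewrite -CD h2 addeK// fin_num_measure//; exact: measurableI.
Qed.

(** The measured points are those of [B] that translation by [y] moves out of [C]. Two sets are
    allowed so that each piece of a union can be tested against the whole union. *)
Let shift_continuous (B C : set (borel A)) := forall eps : R, 0 < eps ->
  \forall y \near (0 : A), (haar A (B `\` shift y C) < eps%:E)%E.

(** Errors add up over finite unions, and what a finite union misses of [B] has measure tending to 0
    by continuity from above; each of the two costs [e / 2]. *)
Lemma shift_continuous_bigcup (B : set (borel A)) (F : nat -> set (borel A)) :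
  measurable B -> (forall n, measurable (F n)) -> B = \bigcup_n F n ->
  (forall n, shift_continuous (F n) B) -> shift_continuous B B.
Proof.
move=> mB mF BF FB.
have mD C y : measurable C -> measurable (C `\` shift y B).
  by move=> mC; apply: measurableD => //; exact: measurable_shift.
pose U N : set (borel A) := \big[setU/set0]_(i < N) F i.
have mU N : measurable (U N) by exact: bigsetU_measurable.
have UB N : shift_continuous (U N) B.
  elim: N => [|N IH] e e0.
    by apply: nearW => y; rewrite /U big_ord0 set0D measure0 lte_fin.
  have e20 : 0 < e / 2 by rewrite divr_gt0.
  have := IH _ e20; have := FB N _ e20; apply: filterS2 => y yF yU.
  rewrite /U big_ord_recr/= setDUl.
  apply: (le_lt_trans (measureU2 _ (mD _ _ (mU N)) (mD _ _ (mF N)))).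
  by rewrite [e]splitr EFinD; exact: lteD.
move=> e e0; have e20 : 0 < e / 2 by rewrite divr_gt0.
have : (haar A \o (fun N => B `\` U N)) N @[N --> \oo] --> haar A (\bigcap_N (B `\` U N)).
  apply: nonincreasing_cvg_mu.
  - by apply: (@le_lt_trans _ _ 1%E); [apply: probability_le1; exact: measurableD|exact: ltry].
  - by move=> N; exact: measurableD.
  - by apply: bigcapT_measurable => N; exact: measurableD.
  - move=> m n mn; apply/subsetPset; apply: setDS.
    exact: subset_bigsetU.
rewrite (_ : \bigcap_N _ = set0); last first.
  rewrite -subset0 => x /= H; have [+ _] := H 0 I; rewrite BF => -[n _ Fnx].
  have [_] := H n.+1 I; apply; rewrite /U big_ord_recr/=; by right.
rewrite measure0 => cv.
have : \forall N \near \oo, (haar A (B `\` U N) < (e / 2)%:E)%E.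
  apply: (cv [set z | (z < (e / 2)%:E)%E]); apply: open_nbhs_nbhs; split.
    exact: open_ereal_lt_ereal.
  by rewrite /= lte_fin.
case=> N _ /(_ N (leqnn N)) /= Ne.
have := UB N _ e20; apply: filterS => y yU.
apply: (@le_lt_trans _ _ (haar A ((U N `\` shift y B) `|` (B `\` U N)))%E).
  apply: le_measure; rewrite ?inE.
  - exact: mD.
  - by apply: measurableU; [exact: mD|exact: measurableD].
  - move=> x [Bx nx]; have [Ux|nUx] := pselect (U N x); [by left|by right].
apply: (le_lt_trans (measureU2 _ (mD _ _ (mU N)) (measurableD mB (mU N)))).
by rewrite [e]splitr EFinD; exact: lteD.
Qed.

(** The sets with this property are closed under complements and countable unions, so it is enough
    to treat open sets. *)
Lemma shift_continuous_borel (B : set (borel A)) :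
  measurable B -> shift_continuous B B.
Proof.
have [V [oV bV]] := countable_open_basis.
suff : (measurable : set (set (borel A))) `<=`
   [set B | measurable B /\ shift_continuous B B] by move=> H /H[].
apply: smallest_sub.
  split=> [|C [mC CC]|F FF].
  - split; first exact: measurable0.
    by move=> e e0; apply: nearW => y; rewrite set0D measure0 lte_fin.
  - split; first exact: measurableD.
    move=> e /CC; apply: filterS => y; apply: le_lt_trans.
    by rewrite haar_setD_shift.
  - pose G : nat -> set (borel A) := F.
    have GG n : measurable (G n) /\ shift_continuous (G n) (G n) := FF n.
    have mG n : measurable (G n) := proj1 (GG n).
    have mU : measurable (\bigcup_n G n) by exact: bigcupT_measurable.
    split; first exact: mU.
    apply: (shift_continuous_bigcup mU mG) => // n e e0.
    have [_ /(_ _ e0)] := GG n; apply: filterS => y; apply: le_lt_trans.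
    apply: le_measure; rewrite ?inE.
    + by apply: measurableD => //; exact: measurable_shift.
    + by apply: measurableD => //; exact: measurable_shift.
    + by apply: setDS; apply: preimage_subset; exact: bigcup_sup.
move=> U oU; split; first exact: open_borel.
(* By continuity of addition, an open [U] is the union of the basic sets that all small translations
   keep inside [U]. For such a set the difference to be measured is empty near 0. *)
pose good n := exists2 W, nbhs (0 : A) W & forall x y, W x -> V n y -> U (x + y).
pose F n : set (borel A) := if `[< good n >] then V n else set0.
apply: (@shift_continuous_bigcup _ F).
- exact: open_borel.
- by move=> n; rewrite /F; case: ifP => _; [exact: open_borel|exact: measurable0].
- apply/seteqP; split=> [x Ux|x [n _]]; last first.
    rewrite /F; case: ifP => // /asboolP[W W0 WU] Vx.
    by rewrite -[x]add0r; apply: WU => //; exact: nbhs_singleton.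
  have Ux0 : U (0 + x) by rewrite add0r.
  have := @add_continuous A (0, x) U (open_nbhs_nbhs (conj oU Ux0)).
  case=> -[P Q] /= [P0 /bV[n [Vnx nQ]] PQ].
  exists n => //; rewrite /F ifT//; apply/asboolP; exists P => // x' y' Px /nQ Qy.
  exact: (PQ (x', y')).
move=> n e e0; rewrite /F; case: ifP => [/asboolP[W W0 WU]|_].
  apply: filterS W0 => y Wy; rewrite (_ : _ `\` _ = set0) ?measure0 ?lte_fin//.
  by rewrite -subset0 => x [Vx]; apply; exact: WU.
by apply: nearW => y; rewrite set0D measure0 lte_fin.
Qed.

(** If translation by [y] sent no point of [B] back into [B], removing the shift would leave all of
    [B]; for small [y] this contradicts shift continuity with error [haar A B]. *)
Lemma nbhs0_sub_self (B : set (borel A)) : measurable B -> (0 < haar A B)%E ->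
  \forall y \near (0 : A), exists2 x : A, B x & B (y + x).
Proof.
move=> mB B0; have Bfin : haar A B \is a fin_num by exact: fin_num_measure.
have e0 : 0 < fine (haar A B) by rewrite -lte_fin fineK.
have := shift_continuous_borel mB e0; apply: filterS => y; rewrite fineK// => yB.
apply: contrapT => nxB; move: yB; rewrite (_ : _ `\` _ = B) ?ltxx//.
by apply/seteqP; split=> [x []//|x Bx]; split=> // Byx; apply: nxB; exists x.
Qed.

End BorelGroup.

Section HaarExpectation.
Context (R : realType).

(** The indicator of [phi x + y] lying in [C] is integrated in both orders. Over [y] first,
    invariance on [B] gives [haar B C]. Over [x] first, [y] is written as a value of [phi] and
    invariance on [A] gives the measure of the preimage. *)
Lemma haar_epimorphism (A B : compact_abelian_group R) (phi : A -> B) :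
  measurable_fun setT (phi : borel A -> borel B) ->
  (forall x y, phi (x + y) = phi x + phi y) -> (forall y, exists x, phi x = y) ->
  forall C : set (borel B), measurable C ->
    haar A (phi @^-1` C : set (borel A)) = haar B C.
Proof.
move=> mphi phiD surj C mC.
pose F (z : borel A * borel B) : R := \1_C ((phi z.1 : B) + (z.2 : B)).
have mF : measurable_fun setT F.
  apply: (measurableT_comp (f := (\1_C : borel B -> R))); first exact: measurable_indic.
  apply: measurable_addA; last exact: measurable_snd.
  exact: (measurableT_comp mphi measurable_fst).
have bF z : `|F z| <= 1.
  by rewrite /F indicE; case: (_ \in _); rewrite ?normr1// normr0.
have := Rintegral_Fubini (haar A) (haar B) mF bF.
have -> : \int[haar A]_x \int[haar B]_y F (x, y) = fine (haar B C).
  transitivity (\int[haar A]_x fine (haar B C)).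
    apply: eq_Rintegral => x _.
    rewrite -(haar_invariant (phi x) mC) /Rintegral.
    rewrite -[X in fine X = _]/(\int[haar B]_y (\1_(shift (phi x) C) y)%:E)%E.
    by rewrite integral_indic ?setIT//; exact: measurable_shift.
  rewrite Rintegral_cst// (_ : fine (haar A setT) = 1) ?mulr1//.
  by have -> : haar A setT = 1%E by exact: probability_setT.
have -> : \int[haar B]_y \int[haar A]_x F (x, y) = fine (haar A (phi @^-1` C)).
  transitivity (\int[haar B]_x fine (haar A (phi @^-1` C))).
    apply: eq_Rintegral => y _; have [a ay] := surj y.
    have mphiC : measurable (phi @^-1` C : set (borel A)).
      by rewrite -[_ @^-1` _]setTI; exact: mphi.
    rewrite -(haar_invariant a mphiC) /Rintegral.
    transitivity (fine (\int[haar A]_x (\1_(shift a (phi @^-1` C)) x)%:E)%E).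
      congr fine; apply: eq_integral => x _; congr EFin; rewrite /F !indicE; congr (_%:R).
      by congr nat_of_bool; apply/idP/idP; rewrite !inE /shift/= -ay phiD addrC.
    by rewrite integral_indic ?setIT//; exact: measurable_shift.
  rewrite Rintegral_cst// (_ : fine (haar B setT) = 1) ?mulr1//.
  by have -> : haar B setT = 1%E by exact: probability_setT.
move=> E; have mphiC : measurable (phi @^-1` C : set (borel A)).
  by rewrite -[_ @^-1` _]setTI; exact: mphi.
by rewrite -[LHS]fineK ?fin_num_measure// -E fineK// fin_num_measure.
Qed.

Lemma cexp_epimorphism (A B : compact_abelian_group R) (phi : A -> B) (f : B -> R[i]) :
  measurable_fun setT (phi : borel A -> borel B) ->
  (forall x y, phi (x + y) = phi x + phi y) -> (forall y, exists x, phi x = y) ->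
  cmeasurable f -> cexp (haar A) (fun x => f (phi x)) = cexp (haar B) f.
Proof.
move=> mphi phiD surj mf; apply: (cexp_measure_preserving mphi) => // C.
exact: haar_epimorphism.
Qed.

Context (A : compact_abelian_group R).
Implicit Types f : A -> R[i].

Lemma cexp_translate f (y : A) : cmeasurable f ->
  cexp (haar A) (fun x => f (y + x)) = cexp (haar A) f.
Proof.
move=> mf; apply: (cexp_measure_preserving (measurable_translate y)) => // B.
exact: haar_invariant.
Qed.

Lemma cexp_opp f : cmeasurable f ->
  cexp (haar A) (fun x => f (- x)) = cexp (haar A) f.
Proof.
apply: (cexp_epimorphism (phi := fun x : A => - x)).
- by apply: measurable_oppA; exact: measurable_id.
- by move=> x y; rewrite opprD.
- by move=> y; exists (- y); rewrite opprK.
Qed.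

Lemma measurable_character_continuous (chi : A -> R[i]) :
  cmeasurable chi -> (forall x, modulus (chi x) = 1) ->
  (forall x y, chi (x + y) = chi x * chi y) -> continuous (chi : A -> R[i]^o).
Proof.
move=> [m1 m2] chi1 chiD.
have near0 (e : R) : 0 < e -> \forall y \near (0 : A), modulus (chi y - 1) < e.
  move=> e0; have e4 : 0 < e / 4 by rewrite divr_gt0.
  (* Preimages of boxes with rational centre and half-width [e / 4]: two values in one box differ by
     less than [e / 2] in each coordinate. Countably many of them cover the group, so one has
     positive measure. *)
  pose B (q : rat * rat) : set (borel A) :=
    [set x | complex.Re (chi x) \in `](ratr q.1 - e / 4), (ratr q.1 + e / 4)[] `&`
    [set x | complex.Im (chi x) \in `](ratr q.2 - e / 4), (ratr q.2 + e / 4)[].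
  have mB q : measurable (B q).
    apply: measurableI.
      rewrite -[X in measurable X]setTI;
      exact: (m1 measurableT _ (measurable_itv `](ratr q.1 - e / 4), (ratr q.1 + e / 4)[)).
    rewrite -[X in measurable X]setTI;
    exact: (m2 measurableT _ (measurable_itv `](ratr q.2 - e / 4), (ratr q.2 + e / 4)[)).
  pose F n : set (borel A) := if unpickle n is Some q then B q else set0.
  have FT : \bigcup_n F n = setT.
    apply/seteqP; split=> // x _.
    have [q1 q1x] : exists q, ratr q \in `](complex.Re (chi x) - e / 4), (complex.Re (chi x) + e / 4)[.
      by apply: rat_in_itvoo; lra.
    have [q2 q2x] : exists q, ratr q \in `](complex.Im (chi x) - e / 4), (complex.Im (chi x) + e / 4)[.
      by apply: rat_in_itvoo; lra.
    exists (pickle (q1, q2)); [exact: I|]; rewrite /F pickleK.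
    by split => /=; move: q1x q2x; rewrite !in_itv/= => /andP[? ?] /andP[? ?]; lra.
  have [q Bq] : exists q, (0 < haar A (B q))%E.
    apply: contrapT => nB.
    have : (haar A).-negligible (\bigcup_n F n).
      apply: negligible_bigcup => n; rewrite /F.
      case: (unpickle n) => [q|]; last exact: negligible_set0.
      apply/negligibleP; first exact: mB.
      apply/eqP; rewrite eq_le measure_ge0 andbT leNgt; apply/negP => H.
      by apply: nB; exists q.
    rewrite FT => /negligibleP => /(_ measurableT).
    move=> h0; have := etrans (esym h0) (probability_setT (haar A)).
    by move/eqP; rewrite eq_sym onee_eq0.
  have := nbhs0_sub_self (mB q) Bq; apply: filterS => y [x].
  rewrite /B/= !in_itv/= => -[/andP[a1 a2] /andP[a3 a4]] [/andP[b1 b2] /andP[b3 b4]].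
  have -> : modulus (chi y - 1) = modulus (chi (y + x) - chi x).
    by rewrite chiD -[X in _ * _ - X]mul1r -mulrBl modulusM chi1 mulr1.
  rewrite (le_lt_trans (modulus_le_ReIm _))// ReD ImD ReN ImN [e]splitr ltrD// ltr_norml; lra.
move=> z; apply/cvgrPdist_lt => e e0.
have eE : e = (complex.Re e)%:C by rewrite RRe_real// gtr0_real.
have e0' : 0 < complex.Re e by rewrite -ltcR -eE.
have cz : ((fun w : A => w - z) w @[w --> z] --> (0 : A)).
  rewrite -[X in _ --> X](subrr z).
  exact: (cvg_comp _ _ (cvg_pair (@cvg_id _ (nbhs z)) (@cvg_cst _ z _ (nbhs z) _))
    (@sub_continuous A (z, z))).
have cz' : \forall w \near z, modulus (chi (w - z) - 1) < complex.Re e.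
  exact: (cz _ (near0 _ e0')).
near=> w; have wz : modulus (chi (w - z) - 1) < complex.Re e by near: w.
rewrite eE distrC (_ : chi w = chi (w - z) * chi z); last by rewrite -chiD subrK.
by rewrite -[X in `|_ - X|]mul1r -mulrBl normE ltcR modulusM chi1 mulr1.
Unshelve. all: by end_near.
Qed.

Lemma bmeas_character (chi : dual R A) : @bmeas R _ (borel A) chi.
Proof.
split; last by exists 1 => x; rewrite -modulus_le char_norm.
have H (h : R[i] -> R) : (forall z w, `|h z - h w| <= modulus (z - w)) ->
    measurable_fun setT ((fun x => h (chi x)) : borel A -> R).
  move=> hL; apply: measurable_continuous_real => x; apply/cvgrPdist_lt => e e0.
  have /cvgrPdist_lt/(_ e%:C) := @char_continuous _ _ chi x.
  rewrite ltcR => /(_ e0); apply: filterS => y.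
  by rewrite normE ltcR; apply: le_lt_trans.
split; apply: H => z w.
  by rewrite -ReN -ReD Re_le_modulus.
by rewrite -ImN -ImD Im_le_modulus.
Qed.

End HaarExpectation.

(** * The convolution algebra *)

Section ConvolutionAlgebra.
Context (R : realType) (A : compact_abelian_group R).

(** Functions bounded everywhere, not classes modulo null sets: convolution is defined at every
    point, the laws of the algebra are plain equalities, and evaluation at 0 plays the role of a
    trace. *)
Record bfun := BFun { bval :> A -> R[i]; bfunP : @bmeas R _ (borel A) bval }.

Lemma bfun_ext (f g : bfun) : (forall x, f x = g x) -> f = g.
Proof.
case: f g => [f bf] [g bg] /= /funext fg; subst g.
by congr BFun; exact: Prop_irrelevance.
Qed.

Implicit Types f g h : bfun.
Local Notation E := (cexp (haar A)).
Local Notation "|| f ||^2" := (sqnorm (haar A) f) (at level 0, f at level 50).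

Lemma bfun_comp d (X : measurableType d) f (u : X -> A) :
  measurable_fun setT (u : X -> borel A) -> bmeas (fun x => f (u x)).
Proof. exact: (bmeas_comp (bfunP f)). Qed.

Lemma badd_subproof f g : @bmeas R _ (borel A) (fun x => f x + g x).
Proof. by apply: bmeasD; exact: bfunP. Qed.
Definition badd f g := BFun (badd_subproof f g).

Lemma bscale_subproof c f : @bmeas R _ (borel A) (fun x => c * f x).
Proof. by apply: bmeasM; [exact: bmeas_cst|exact: bfunP]. Qed.
Definition bscale c f := BFun (bscale_subproof c f).

Lemma measurable_reflect (y : A) :
  measurable_fun setT ((fun x => y - x) : borel A -> borel A).
Proof. by apply: measurable_subA; [exact: measurable_cst|exact: measurable_id]. Qed.

Definition btranslate (y : A) f := BFun (bfun_comp f (measurable_translate y)).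

Lemma bstar_subproof f : @bmeas R _ (borel A) (fun x => (f (- x))^*).
Proof.
apply: bmeasJ; apply: bfun_comp; apply: measurable_oppA; exact: measurable_id.
Qed.
Definition bstar f := BFun (bstar_subproof f).

Lemma bmeas_conv_kernel f g :
  bmeas (fun z : borel A * borel A => f z.2 * g ((z.1 : A) - (z.2 : A))).
Proof.
apply: bmeasM; apply: bfun_comp; first exact: measurable_snd.
by apply: measurable_subA; [exact: measurable_fst|exact: measurable_snd].
Qed.

Lemma bconv_subproof f g :
  @bmeas R _ (borel A) (fun x => E (fun y => f y * g (x - y))).
Proof. exact: (bmeas_cexp (haar A) (bmeas_conv_kernel f g)). Qed.
Definition bconv f g := BFun (bconv_subproof f g).

Lemma cexp_reflect f (x : A) : E (fun y => f (x - y)) = E f.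
Proof.
transitivity (E (fun y => btranslate x f (- y))); first by [].
rewrite cexp_opp; last exact: (bfunP (btranslate x f)).1.
by apply: cexp_translate; exact: (bfunP f).1.
Qed.

Lemma bconv_integrand f g x : @bmeas R _ (borel A) (fun y => f y * g (x - y)).
Proof.
by apply: bmeasM; [exact: bfunP|apply: bfun_comp; exact: measurable_reflect].
Qed.

Lemma bconvC f g : bconv f g = bconv g f.
Proof.
apply: bfun_ext => x /=.
rewrite -(cexp_reflect (BFun (bconv_integrand g f x)) x) /=.
by apply: eq_cexp => y; rewrite subKr mulrC.
Qed.

Lemma bconvA f g h : bconv (bconv f g) h = bconv f (bconv g h).
Proof.
apply: bfun_ext => x /=.
transitivity (E (fun y => E (fun z => f z * g (y - z) * h (x - y)))).
  by apply: eq_cexp => y; rewrite cexpZr//; exact: bconv_integrand.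
rewrite (cexp_Fubini (haar A) (haar A) (F := fun p : borel A * borel A =>
   f p.2 * g ((p.1 : A) - (p.2 : A)) * h (x - (p.1 : A)))); last first.
  apply: bmeasM; first exact: bmeas_conv_kernel.
  apply: bfun_comp; apply: measurable_subA; [exact: measurable_cst|exact: measurable_fst].
apply: eq_cexp => z /=.
rewrite -cexpZ; last exact: bconv_integrand.
have bF : @bmeas R _ (borel A) (fun y => f z * g (y - z) * h (x - y)).
  apply: bmeasM; first apply: bmeasM; first exact: bmeas_cst.
    apply: bfun_comp; apply: measurable_subA; [exact: measurable_id|exact: measurable_cst].
  by apply: bfun_comp; exact: measurable_reflect.
rewrite -(cexp_translate z bF.1).
apply: eq_cexp => y; rewrite -mulrA; congr (_ * (g _ * h _)).
  by rewrite addrC addKr.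
by rewrite opprD addrA.
Qed.

Lemma bconvDl f g h : bconv (badd f g) h = badd (bconv f h) (bconv g h).
Proof.
apply: bfun_ext => x /=; rewrite -cexpD; try exact: bconv_integrand.
by apply: eq_cexp => y; rewrite mulrDl.
Qed.

Lemma bconvZl c f h : bconv (bscale c f) h = bscale c (bconv f h).
Proof.
apply: bfun_ext => x /=; rewrite -cexpZ; last exact: bconv_integrand.
by apply: eq_cexp => y; rewrite mulrA.
Qed.

Lemma bconvDr f g h : bconv h (badd f g) = badd (bconv h f) (bconv h g).
Proof. by rewrite bconvC bconvDl !(bconvC h). Qed.

Lemma bconvZr c f h : bconv h (bscale c f) = bscale c (bconv h f).
Proof. by rewrite bconvC bconvZl (bconvC h). Qed.

Lemma bconv_translate y f g : bconv (btranslate y f) g = btranslate y (bconv f g).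
Proof.
rewrite bconvC (bconvC f); apply: bfun_ext => x /=.
by apply: eq_cexp => z; rewrite addrA.
Qed.

Lemma bconvCA f g h : bconv f (bconv g h) = bconv g (bconv f h).
Proof. by rewrite -!bconvA (bconvC f). Qed.

Lemma bstarK f : bstar (bstar f) = f.
Proof. by apply: bfun_ext => x /=; rewrite opprK conjCK. Qed.

Lemma bstarD f g : bstar (badd f g) = badd (bstar f) (bstar g).
Proof. by apply: bfun_ext => x /=; rewrite rmorphD. Qed.

Lemma bstarZ c f : bstar (bscale c f) = bscale c^* (bstar f).
Proof. by apply: bfun_ext => x /=; rewrite rmorphM. Qed.

Lemma bstar_translate y f : bstar (btranslate y f) = btranslate (- y) (bstar f).
Proof. by apply: bfun_ext => x /=; rewrite opprD opprK. Qed.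

Lemma bstar_conv f g : bstar (bconv f g) = bconv (bstar f) (bstar g).
Proof.
apply: bfun_ext => x /=; rewrite -cexpJ; last exact: bconv_integrand.
rewrite -[RHS]cexp_opp; last exact: (bconv_integrand (bstar f) (bstar g) x).1.
by apply: eq_cexp => y; rewrite rmorphM /= opprK opprD.
Qed.

Lemma bconv_star f g : bconv f (bstar g) 0 = E (fun x => f x * (g x)^*).
Proof. by apply: eq_cexp => x; rewrite /= sub0r opprK. Qed.

Lemma bconv_star0 f : bconv f (bstar f) 0 = (|| f ||^2)%:C.
Proof. by rewrite bconv_star sqnormE. Qed.

Lemma sqnorm_star f : || bstar f ||^2 = || f ||^2.
Proof. by apply: complexI; rewrite -!bconv_star0 bstarK bconvC. Qed.

Lemma modulus_bconv0 f g :
  modulus (bconv f (bstar g) 0) ^+ 2 <= || f ||^2 * || g ||^2.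
Proof. by rewrite bconv_star; apply: cauchy_schwarz; exact: bfunP. Qed.

Lemma sqnorm_translate y f : || btranslate y f ||^2 = || f ||^2.
Proof.
apply: complexI; rewrite !sqnormE.
have bF : @bmeas R _ (borel A) (fun x => f x * (f x)^*).
  by apply: bmeasM; [exact: bfunP|apply: bmeasJ; exact: bfunP].
exact: (cexp_translate y bF.1).
Qed.

(** Cauchy-Schwarz at each point; convolving with a fixed function thus turns L^2 convergence into
    uniform convergence. *)
Lemma modulus_bconv f g x : modulus (bconv f g x) ^+ 2 <= || f ||^2 * || g ||^2.
Proof.
have -> : bconv f g x = bconv (btranslate x f) (bstar (bstar g)) 0.
  by rewrite bstarK bconv_translate /= addr0.
by rewrite (le_trans (modulus_bconv0 _ _))// sqnorm_star sqnorm_translate.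
Qed.

Lemma sqnorm_badd f g : bstar f = f -> bstar g = g ->
  (|| badd f (bscale (-1) g) ||^2)%:C =
  bconv f f 0 - 2 * bconv f g 0 + bconv g g 0.
Proof.
move=> fs gs; rewrite -bconv_star0 bstarD bstarZ fs gs rmorphN1.
rewrite bconvDl !bconvDr !bconvZl !bconvZr (bconvC g f) /=; ring.
Qed.

Lemma bscaleA c c' f : bscale c (bscale c' f) = bscale (c * c') f.
Proof. by apply: bfun_ext => x /=; rewrite mulrA. Qed.

Definition ucvg (u : nat -> bfun) (v : bfun) := forall e : R, 0 < e ->
  exists N, forall n, (N <= n)%N -> forall x, modulus (u n x - v x) <= e.

Lemma bounded_bfun f : exists2 M : R, 0 < M & forall x, modulus (f x) <= M.
Proof.
have [_ [M fM]] := bfunP f; exists (M + 1).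
  by rewrite ltr_wpDl// (le_trans _ (fM 0))// modulus_ge0.
by move=> x; rewrite (le_trans (fM x))// lerDl.
Qed.

Lemma ucvg_unique u v w : ucvg u v -> ucvg u w -> v = w.
Proof.
move=> uv uw; apply: bfun_ext => x; apply/eqP; rewrite -subr_eq0; apply/eqP.
apply: modulus_eq0; apply/le_anti; rewrite modulus_ge0 andbT.
apply/ler_addgt0Pl => e e0; rewrite addr0.
have e2 : 0 < e / 2 by rewrite divr_gt0.
have [N1 H1] := uv _ e2; have [N2 H2] := uw _ e2.
have h1 := H1 _ (leq_maxl N1 N2) x; have h2 := H2 _ (leq_maxr N1 N2) x.
set n := maxn N1 N2 in h1 h2.
rewrite (_ : v x - w x = (u n x - w x) - (u n x - v x)); last by ring.
by rewrite (le_trans (modulusB _ _))// [e]splitr lerD.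
Qed.

Lemma ucvg_sub u v (s : nat -> nat) : (forall n, (n <= s n)%N) -> ucvg u v ->
  ucvg (fun n => u (s n)) v.
Proof.
move=> s_ge uv e /uv[N H]; exists N => n Nn x.
by apply: H; exact: leq_trans (s_ge n).
Qed.

Lemma ucvg_conv u v f : ucvg u v -> ucvg (fun n => bconv f (u n)) (bconv f v).
Proof.
move=> uv e e0; have [M M0 fM] := bounded_bfun f.
have eM : 0 < e / M by rewrite divr_gt0.
have [N H] := uv _ eM; exists N => n Nn x.
have -> : bconv f (u n) x - bconv f v x = bconv f (badd (u n) (bscale (-1) v)) x.
  by rewrite bconvDr bconvZr /= mulN1r.
apply: modulus_cexp; first exact: bconv_integrand.
move=> y /=; rewrite modulusM mulN1r -(divfK (lt0r_neq0 M0) e) mulrC.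
by apply: ler_pM; rewrite ?modulus_ge0//; exact: H.
Qed.

Lemma ucvg_scale u v c : ucvg u v -> ucvg (fun n => bscale c (u n)) (bscale c v).
Proof.
move=> uv e e0; have c1 : 0 < modulus c + 1 by rewrite ltr_wpDl ?modulus_ge0.
have ec : 0 < e / (modulus c + 1) by rewrite divr_gt0.
have [N H] := uv _ ec; exists N => n Nn x /=.
rewrite -mulrBr modulusM (@le_trans _ _ ((modulus c + 1) * (e / (modulus c + 1))))//.
  by apply: ler_pM; rewrite ?modulus_ge0 ?lerDl ?H.
by rewrite mulrC divfK// gt_eqF.
Qed.

Lemma ucvg_star u v : ucvg u v -> ucvg (fun n => bstar (u n)) (bstar v).
Proof.
move=> uv e /uv[N H]; exists N => n Nn x /=.
by rewrite -rmorphB modulusJ; exact: H.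
Qed.

Lemma ucvg_diag u v : ucvg u v -> ucvg (fun n => bconv (u n) (u n)) (bconv v v).
Proof.
move=> uv e e0; have [M M0 vM] := bounded_bfun v.
have K0 : 0 < 2 * M + 1 by lra.
(* The difference of the two squares is the convolution of [u n - v] with [u n + v]; the [1] in the
   minimum bounds the second factor by [2 * M + 1]. *)
have eK : 0 < Num.min 1 (e / (2 * M + 1)) by rewrite lt_min ltr01 divr_gt0.
have [N H] := uv _ eK; exists N => n Nn x.
pose d := badd (u n) (bscale (-1) v).
have -> : bconv (u n) (u n) x - bconv v v x = bconv d (badd (u n) v) x.
  by rewrite /d bconvDl !bconvDr !bconvZl (bconvC v) /=; ring.
have dle y : modulus (d y) <= Num.min 1 (e / (2 * M + 1)).
  by rewrite /d /= mulN1r; exact: H.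
apply: modulus_cexp; first exact: bconv_integrand.
move=> y; rewrite modulusM -[leRHS](divfK (lt0r_neq0 K0) e).
apply: ler_pM; rewrite ?modulus_ge0//.
  by rewrite (le_trans (dle y))// ge_min lexx orbT.
have := dle (x - y); rewrite le_min => /andP[d1 _].
rewrite (_ : _ (x - y) = d (x - y) + 2 * v (x - y)); last by rewrite /d /=; ring.
rewrite (le_trans (modulusD _ _))// addrC lerD// modulusM.
rewrite (_ : modulus 2 = 2) ?ler_pM2l//.
by rewrite (_ : 2 = (2 : R)%:C) ?modulus_real ?ger0_norm// rmorph_nat.
Qed.

Lemma ucvg_cauchy (u : nat -> bfun) :
  (forall e : R, 0 < e -> exists N, forall n k, (N <= n)%N -> (N <= k)%N ->
     forall x, modulus (u n x - u k x) <= e) -> exists v, ucvg u v.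
Proof.
move=> cu.
have C (h : R[i] -> R) : (forall z w, `|h z - h w| <= modulus (z - w)) ->
    forall x, cvgn (fun n => h (u n x)).
  move=> hL x; apply/cauchy_cvgP/cauchy_ballP => e e0.
  have e2 : 0 < e / 2 by rewrite divr_gt0.
  have [N H] := cu _ e2.
  exists ((fun n => h (u n x)) @` [set n | (N <= n)%N],
          (fun n => h (u n x)) @` [set n | (N <= n)%N]).
    by split; exists N => // n Nn; exists n.
  move=> [_ _] [/= [n Nn <-] [k Nk <-]]; rewrite -ball_normE /=.
  rewrite (le_lt_trans (hL _ _))// (le_lt_trans (H _ _ Nn Nk x))//.
  by rewrite ltr_pdivrMr// mulr_natr mulr2n ltrDl.
have LR (z w : R[i]) : `|complex.Re z - complex.Re w| <= modulus (z - w).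
  by rewrite -ReN -ReD Re_le_modulus.
have LI (z w : R[i]) : `|complex.Im z - complex.Im w| <= modulus (z - w).
  by rewrite -ImN -ImD Im_le_modulus.
have cRe := C _ LR; have cIm := C _ LI.
pose v x := limn (fun n => complex.Re (u n x)) +i* limn (fun n => complex.Im (u n x)).
have uv e : 0 < e -> exists N, forall n, (N <= n)%N -> forall x, modulus (u n x - v x) <= e.
  move=> e0; have e2 : 0 < e / 2 by rewrite divr_gt0.
  have [N H] := cu _ e2; exists N => n Nn x.
  have D (h : R[i] -> R) (cvh : cvgn (fun n => h (u n x))) :
      (forall z w, `|h z - h w| <= modulus (z - w)) ->
      `|h (u n x) - limn (fun n => h (u n x))| <= e / 2.
    move=> hL; apply/ler_addgt0Pr => d d0.
    have /cvgrPdist_lt/(_ d d0)[K _ HK] := cvh.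
    have HKk := HK _ (leq_maxl K N); set k := maxn K N in HKk.
    have Nk : (N <= k)%N by exact: leq_maxr.
    rewrite (_ : h (u n x) - _ = (h (u n x) - h (u k x)) -
      (limn (fun n => h (u n x)) - h (u k x))); last by ring.
    by rewrite (le_trans (ler_normB _ _))// lerD ?(ltW HKk)// (le_trans (hL _ _))// H.
  rewrite (le_trans (modulus_le_ReIm _))// ReD ImD ReN ImN [e]splitr.
  by apply: lerD; [exact: (D _ (cRe x) LR)|exact: (D _ (cIm x) LI)].
have bv : @bmeas R _ (borel A) v.
  split; last first.
    have [N H] := uv 1 ltr01; have [M _ uM] := bounded_bfun (u N).
    exists (M + 1) => x; rewrite (_ : v x = u N x - (u N x - v x)); last by ring.
    by rewrite (le_trans (modulusB _ _))// lerD// H.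
  split; apply: measurable_fun_cvg.
  - by move=> m; exact: (bfunP (u m)).1.1.
  - by move=> x _; exact: cRe.
  - by move=> m; exact: (bfunP (u m)).1.2.
  - by move=> x _; exact: cIm.
by exists (BFun bv).
Qed.

End ConvolutionAlgebra.

(** * The inverse theorem for the U_2 norm *)

Section PowerIteration.
Context (R : realType).

(** [lam] is the limit of the ratios [r n], which increase by log-convexity and are bounded by [m 0]
    by submultiplicativity. The lower bound on [m j] is the limit in [n] of [r n ^+ j.+1 * m n <= m
    (n + j).+1 <= m n * m j]. *)
Lemma log_convex_growth (m : nat -> R) : (forall n, 0 < m n) ->
    (forall n, m n.+1 ^+ 2 <= m n * m n.+2) ->
    (forall n j, m (n + j).+1 <= m n * m j) ->
  exists lam : R, [/\ 0 < lam, m 1 / m 0 <= lam,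
    forall n, m n.+1 <= lam * m n & forall j, lam ^+ j.+1 <= m j].
Proof.
move=> m0 mconvex msub; pose r n := m n.+1 / m n.
have rE n : m n.+1 = r n * m n by rewrite /r divfK// lt0r_neq0.
have r0 n : 0 < r n by rewrite divr_gt0.
have r_incr : nondecreasing_seq r.
  apply/nondecreasing_seqP => n.
  by rewrite /r ler_pdivrMr// mulrAC ler_pdivlMr// -expr2 mulrC.
have r_bound n : r n <= m 0 by rewrite ler_pdivrMr// mulrC -[n in leLHS]addn0.
have r_cvg : cvgn r.
  by apply: nondecreasing_is_cvgn => //; exists (m 0) => _ [n _ <-].
have r_lim n : r n <= limn r by exact: nondecreasing_cvgn_le.
have rm n j : r n ^+ j * m n <= m (n + j)%N.
  elim: j => [|j IH]; first by rewrite expr0 mul1r addn0.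
  rewrite addnS rE exprS -mulrA; apply: ler_pM => //; first exact: ltW.
    by rewrite mulr_ge0 ?exprn_ge0// ltW.
  by apply: r_incr; rewrite leq_addr.
have rj n j : r n ^+ j.+1 <= m j.
  rewrite -(ler_pM2r (m0 n)) (le_trans (rm n j.+1))// addnS mulrC.
  exact: msub.
exists (limn r); split.
- exact: lt_le_trans (r0 0) (r_lim 0).
- exact: r_lim 0.
- by move=> n; rewrite rE ler_wpM2r// ltW.
move=> j; have cvX : (fun n => r n ^+ j.+1) n @[n --> \oo] --> limn r ^+ j.+1.
  apply: (@cvg_comp _ _ _ r (fun x : R => x ^+ j.+1) _ _ _ r_cvg).
  exact: exprn_continuous.
rewrite -(cvg_lim _ cvX)//; apply: limr_le.
  exact: cvgP cvX.
exact: nearW.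
Qed.

(** Division by the powers of [lam] makes the sequence nonincreasing and keeps it nonnegative, so it
    converges. *)
Lemma scaled_growth_cauchy (m : nat -> R) (lam : R) : 0 < lam ->
    (forall n, 0 < m n) -> (forall n, m n.+1 <= lam * m n) ->
  forall e : R, 0 < e -> exists N, forall n k, (N <= n)%N -> (N <= k)%N ->
    `|m n / lam ^+ n.+1 - m k / lam ^+ k.+1| <= e.
Proof.
move=> lam0 m0 mlam e e0; pose s n := m n / lam ^+ n.+1.
have s_decr : nonincreasing_seq s.
  apply/nonincreasing_seqP => n; rewrite /s [lam ^+ n.+2]exprS invfM mulrA.
  by rewrite ler_pM2r ?invr_gt0 ?exprn_gt0// ler_pdivrMr// mulrC.
have s_cvg : cvgn s.
  apply: nonincreasing_is_cvgn => //; exists 0 => _ [n _ <-].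
  by rewrite divr_ge0 ?exprn_ge0 ?ltW.
have e2 : 0 < e / 2 by rewrite divr_gt0.
have /cvgrPdist_le/(_ _ e2)[N _ HN] := s_cvg.
exists N => n k Nn Nk; rewrite -/(s n) -/(s k).
rewrite (_ : s n - s k = (limn s - s k) - (limn s - s n)); last by ring.
by rewrite (le_trans (ler_normB _ _))// [e]splitr lerD// HN.
Qed.

Context (A : compact_abelian_group R).
Implicit Types e f g h : bfun A.
Local Notation "|| f ||^2" := (sqnorm (haar A) f) (at level 0, f at level 50).

Lemma fourierE (f : A -> R[i]) chi :
  fourier f chi = cexp (haar A) (fun x => f x * (chi x)^*).
Proof. by []. Qed.

(** Convolution has in general no unit among bounded functions, so index [n] stands for [n + 1]
    factors. *)
Fixpoint bpow f n := if n is k.+1 then bconv f (bpow f k) else f.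

Lemma bpow_conv f n k : bconv (bpow f n) (bpow f k) = bpow f (n + k).+1.
Proof. by elim: n => // n IH; rewrite /= bconvA IH. Qed.

(** The autocorrelation of [g]; its Fourier transform is the squared modulus of that of [g]. *)
Definition bgram g := bconv g (bstar g).

Lemma bstar_gram g : bstar (bgram g) = bgram g.
Proof. by rewrite bstar_conv bstarK bconvC. Qed.

Lemma bpow_star f n : bstar f = f -> bstar (bpow f n) = bpow f n.
Proof. by move=> fs; elim: n => //= n IH; rewrite bstar_conv IH fs. Qed.

(** A square root of the power [bpow (bgram g) n], in the sense of [broot_gram]. The value of that
    power at 0 thereby becomes a squared norm, hence nonnegative and accessible to
    Cauchy-Schwarz. *)
Fixpoint broot g n :=
  match n with 0 => g | 1 => bgram g | k.+2 => bconv (bgram g) (broot g k) end.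

Lemma broot_gram g n : bgram (broot g n) = bpow (bgram g) n.
Proof.
suff : bgram (broot g n) = bpow (bgram g) n /\
       bgram (broot g n.+1) = bpow (bgram g) n.+1 by case.
elim: n => [|n [IH1 IH2]]; split=> //=.
  by rewrite {1}/bgram bstar_gram.
rewrite {1}/bgram bstar_conv bstar_gram bconvA (bconvCA (broot g n)).
by rewrite -[bconv (broot g n) _]/(bgram _) IH1.
Qed.

Lemma bpow0 g n : bpow (bgram g) n 0 = (|| broot g n ||^2)%:C.
Proof. by rewrite -broot_gram bconv_star0. Qed.

Lemma modulus_bpow g n x : modulus (bpow (bgram g) n x) <= || broot g n ||^2.
Proof.
rewrite -(ler_pXn2r (ltn0Sn 1)) ?nnegrE ?modulus_ge0 ?sqnorm_ge0//.
by rewrite -broot_gram (le_trans (modulus_bconv _ _ _))// sqnorm_star expr2.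
Qed.

Lemma sqnorm_gram_le g : || bgram g ||^2 <= || g ||^2 ^+ 2.
Proof. by apply: sqnorm_le; [exact: bfunP|move=> x; exact: (modulus_bpow g 0)]. Qed.

(** [v] is the uniform limit of the powers of [bgram g] divided by powers of their growth rate
    [lam]. The rescaled powers are at least 1 at 0, and so is [v 0], which is its squared norm. The
    last clause places [v] below any idempotent that fixes [g], as needed for splitting. *)
Lemma spectral_idempotent g : 0 < || bgram g ||^2 ->
  exists (lam : R) (v : bfun A),
    [/\ || bgram g ||^2 / || g ||^2 <= lam, bconv v v = v /\ bstar v = v,
        bconv (bgram g) v = bscale lam%:C v, 1 <= || v ||^2 &
        forall e, bconv g e = g -> bconv v e = v].
Proof.
move=> G0; set G := bgram g; pose m n := || broot g n ||^2.
have g0 : 0 < || g ||^2.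
  rewrite lt0r sqnorm_ge0 andbT; apply/eqP => g0.
  by have := sqnorm_gram_le g; rewrite g0 expr0n /= leNgt G0.
have m_convex n : m n.+1 ^+ 2 <= m n * m n.+2.
  have : modulus (bconv (bconv G (broot g n)) (bstar (broot g n)) 0) ^+ 2 <=
    m n.+2 * m n by exact: modulus_bconv0.
  rewrite bconvA -[bconv (broot g n) _]/(bgram _) broot_gram -/(bpow G n.+1).
  by rewrite bpow0 modulus_real ger0_norm ?sqnorm_ge0// mulrC.
have m_sub n j : m (n + j).+1 <= m n * m j.
  rewrite -[leLHS](ger0_norm (sqnorm_ge0 _ _)) -modulus_real -bpow0 -bpow_conv.
  apply: modulus_cexp; first exact: bconv_integrand.
  by move=> y; rewrite modulusM ler_pM ?modulus_ge0// modulus_bpow.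
have m_gt0 n : 0 < m n.
  suff : 0 < m n /\ 0 < m n.+1 by case.
  elim: n => [|n [p1 p2]]; first by split; [exact: g0|exact: G0].
  split; first exact: p2.
  by rewrite -(pmulr_rgt0 _ p1); apply: lt_le_trans (m_convex n); rewrite exprn_gt0.
have [lam [lam0 lam1 mlam lamm]] := log_convex_growth m_gt0 m_convex m_sub.
have m_cauchy := scaled_growth_cauchy lam0 m_gt0 mlam.
pose s n := m n / lam ^+ n.+1.
have s_ge1 n : 1 <= s n by rewrite ler_pdivlMr ?exprn_gt0// mul1r.
pose u n := bscale (lam ^- n.+1)%:C (bpow G n).
have u0 n : u n 0 = (s n)%:C by rewrite /= bpow0 -rmorphM /s mulrC.
have us n : bstar (u n) = u n.
  rewrite /u bstarZ bpow_star ?bstar_gram//; congr bscale; exact: conjc_real.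
have uconv n k : bconv (u n) (u k) = u (n + k).+1.
  rewrite /u bconvZl bconvZr bpow_conv bscaleA -rmorphM -invfM -exprD.
  by rewrite addnS addSn.
(* The squared norm of [u n - u k] is a combination of values of the convergent sequence [s], so the
   [u n] are Cauchy in L^2; one more convolution with [u 0] makes this uniform and shifts the index
   by one. *)
have u_cauchy (e : R) : 0 < e -> exists N, forall n k, (N <= n)%N -> (N <= k)%N ->
    forall x, modulus (u n.+1 x - u k.+1 x) <= e.
  move=> e0; pose c := || u 0 ||^2 + 1.
  have c0 : 0 < c by rewrite ltr_wpDl ?sqnorm_ge0.
  have d0 : 0 < e ^+ 2 / c / 2 by rewrite !divr_gt0 ?exprn_gt0.
  have [N HN] := m_cauchy _ d0; exists N => n k Nn Nk x.
  pose w := badd (u n) (bscale (-1) (u k)).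
  have -> : u n.+1 x - u k.+1 x = bconv w (u 0) x.
    by rewrite bconvDl bconvZl !uconv !addn0 /= mulN1r.
  rewrite -(ler_pXn2r (ltn0Sn 1)) ?nnegrE ?modulus_ge0 ?(ltW e0)//.
  rewrite (le_trans (modulus_bconv _ _ _))//.
  have wE : || w ||^2 = (s (n + n).+1 - s (n + k).+1) + (s (k + k).+1 - s (n + k).+1).
    apply: complexI; rewrite sqnorm_badd// !uconv !u0.
    by rewrite !(rmorphD, rmorphN) /=; ring.
  have w_le : || w ||^2 <= e ^+ 2 / c.
    rewrite wE [leRHS]splitr; apply: lerD; apply: le_trans (ler_norm _) _; apply: HN;
    by rewrite ?leqW// (leq_trans _ (leq_addr _ _))// ?leqW// leqW.
  rewrite (@le_trans _ _ (e ^+ 2 / c * c))//; last by rewrite divfK// lt0r_neq0.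
  by apply: ler_pM; rewrite ?sqnorm_ge0 ?lerDl.
have [v uv] := ucvg_cauchy u_cauchy.
have vv : bconv v v = v.
  apply: (ucvg_unique (ucvg_diag uv)).
  rewrite (_ : (fun n => _) = fun n => u (n + n.+1).+1.+1).
    by apply: (ucvg_sub (s := fun n => (n + n.+1).+1) _ uv) => n; rewrite -addnS leq_addr.
  by apply/funext => n; rewrite uconv addSn.
have vs : bstar v = v.
  by apply: (ucvg_unique (ucvg_star uv)); under eq_fun do rewrite us.
have v0 : v 0 = (|| v ||^2)%:C by rewrite -bconv_star0 vs vv.
exists lam, v; split => //.
- apply: (ucvg_unique (ucvg_conv G uv)).
  rewrite (_ : (fun n => _) = fun n => bscale lam%:C (u n.+2)).
    by apply: ucvg_scale; exact: (ucvg_sub (s := S) _ uv).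
  apply/funext => n; rewrite /u bconvZr bscaleA -rmorphM; congr (bscale _%:C _).
  by rewrite [in RHS]exprS [in RHS]invfM mulVKf// lt0r_neq0.
- rewrite leNgt; apply/negP => v_lt1.
  have e0 : 0 < (1 - || v ||^2) / 2 by rewrite divr_gt0// subr_gt0.
  have [N /(_ N (leqnn N) 0)] := uv _ e0.
  rewrite u0 v0 -rmorphB modulus_real => /(le_trans (ler_norm _)).
  by have := s_ge1 N.+1; lra.
move=> e ge; apply: (@ucvg_unique _ _ (fun n => bconv e (u n.+1))).
  by rewrite bconvC; exact: ucvg_conv.
rewrite (_ : (fun n => _) = fun n => u n.+1)//; apply/funext => n.
rewrite /u bconvZr bconvC; congr bscale.
have Ge : bconv G e = G by rewrite /G/bgram (bconvC g) bconvA ge.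
by rewrite /= bconvA (bconvC _ e) -bconvA Ge.
Qed.

Lemma idempotent0 e : bconv e e = e -> bstar e = e -> e 0 = (|| e ||^2)%:C.
Proof. by move=> ee es; rewrite -bconv_star0 es ee. Qed.

Lemma modulus_idempotent e x : bconv e e = e -> bstar e = e ->
  modulus (e x) <= || e ||^2.
Proof.
move=> ee es; rewrite -(ler_pXn2r (ltn0Sn 1)) ?nnegrE ?modulus_ge0 ?sqnorm_ge0//.
by rewrite -{1}ee expr2; exact: modulus_bconv.
Qed.

Lemma sqnorm0_conv f e : || f ||^2 = 0 -> bconv f e = f -> forall x, f x = 0.
Proof.
move=> f0 fe x; apply: modulus_eq0; apply/eqP.
by rewrite -sqrf_eq0 eq_le sqr_ge0 andbT -fe (le_trans (modulus_bconv _ _ _))// f0 mul0r.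
Qed.

(* An idempotent whose norm is within 1 of the least possible one cannot be
   split, because every nonzero idempotent has norm at least 1. *)
Lemma unsplittable_idempotent g : 0 < || bgram g ||^2 ->
  exists (lam : R) (e : bfun A),
    [/\ || bgram g ||^2 / || g ||^2 <= lam, bconv e e = e /\ bstar e = e,
        bconv (bgram g) e = bscale lam%:C e, 0 < || e ||^2 &
        forall h, bconv h e = h -> exists mu, bgram h = bscale mu e].
Proof.
move=> G0; have [lam [v [glam [vv vs] Gv v1 _]]] := spectral_idempotent G0.
pose P e := [/\ bconv e e = e, bstar e = e, bconv (bgram g) e = bscale lam%:C e &
               0 < || e ||^2].
have Pv : P v by split=> //; exact: lt_le_trans v1.
pose S := [set || e ||^2 | e in P].
have Sinf : has_inf S.
  split; first by exists (|| v ||^2); exists v.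
  by exists 0 => _ [e _ <-]; exact: sqnorm_ge0.
have [_ [e Pe <-] e_lt] := inf_adherent ltr01 Sinf.
have [ee es Ge e0] := Pe.
exists lam, e; split=> // h he.
have He : bconv (bgram h) e = bgram h.
  by rewrite /bgram (bconvC h) bconvA he.
have [H0|H0] := eqVneq (|| bgram h ||^2) 0.
  exists 0; apply: bfun_ext => x /=; rewrite mul0r.
  exact: (sqnorm0_conv H0 He).
have H1 : 0 < || bgram h ||^2 by rewrite lt0r H0 sqnorm_ge0.
have [mu [e1 [_ [e11 e1s] He1 e1_ge1 /(_ _ he) e1e]]] := spectral_idempotent H1.
exists mu%:C; rewrite -{1}He; suff <- : e1 = e by [].
(* [e2] is again an idempotent with eigenvalue [lam], and its squared norm is at most that of [e]
   minus 1, hence below the infimum. So it vanishes and [e1 = e]. *)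
pose e2 := badd e (bscale (-1) e1).
have e22 : bconv e2 e2 = e2.
  rewrite /e2 bconvDl !bconvDr !bconvZl !bconvZr ee e11 (bconvC e) e1e.
  by apply: bfun_ext => x /=; ring.
have e2s : bstar e2 = e2 by rewrite /e2 bstarD bstarZ es e1s rmorphN1.
have Ge2 : bconv (bgram g) e2 = bscale lam%:C e2.
  have Ge1 : bconv (bgram g) e1 = bscale lam%:C e1.
    by rewrite -[in LHS]e1e bconvCA Ge bconvZr e1e.
  by rewrite /e2 bconvDr bconvZr Ge Ge1; apply: bfun_ext => x /=; ring.
have e2E : || e2 ||^2 = || e ||^2 - || e1 ||^2.
  by apply: complexI; rewrite rmorphB /= -(idempotent0 e22 e2s) -(idempotent0 ee es)
    -(idempotent0 e11 e1s) /= mulN1r.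
have e20 : || e2 ||^2 = 0.
  apply/eqP; rewrite -[_ == 0]negbK; apply/negP => e20.
  have Pe2 : P e2 by split=> //; rewrite lt0r e20 sqnorm_ge0.
  have : inf S <= || e2 ||^2 by apply: ge_inf; [exact: Sinf.2|exists e2].
  rewrite e2E; move: e_lt e1_ge1; move: (inf S) (|| e ||^2) (|| e1 ||^2) => p q r.
  by clear; lra.
apply: bfun_ext => x; apply/eqP; rewrite eq_sym -subr_eq0; apply/eqP.
by have := sqnorm0_conv e20 e22 x; rewrite /= mulN1r.
Qed.

Lemma imaginaryM : 'i%C * 'i%C = -1 :> R[i].
Proof. by rewrite -expr2 sqr_i. Qed.

(** Polarization. For [|c| = 1], the autocorrelation of [e] plus [c] times its translate by [y] is
    twice [e] plus [c] times the translate by [y] plus the conjugate of [c] times the translate by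
    [-y], and it is a multiple of [e]. The cases [c = 1] and [c = i] isolate the translate by
    [y]. *)
Lemma translate_unsplittable e : bconv e e = e -> bstar e = e ->
  (forall h, bconv h e = h -> exists mu, bgram h = bscale mu e) ->
  forall y, exists k, forall x, e (y + x) = k * e x.
Proof.
move=> ee es emin y.
have H c : c * c^* = 1 -> exists mu, forall x,
    c * e (y + x) + c^* * e (- y + x) = mu * e x.
  move=> c1; have he : bconv (badd e (bscale c (btranslate y e))) e =
      badd e (bscale c (btranslate y e)).
    by rewrite bconvDl bconvZl bconv_translate ee.
  have [mu hmu] := emin _ he; exists (mu - 2) => x.
  have : bgram (badd e (bscale c (btranslate y e))) x = mu * e x by rewrite hmu.
  rewrite /bgram bstarD bstarZ bstar_translate es bconvDl !bconvDr !bconvZl !bconvZr.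
  rewrite (bconvC e (btranslate _ _)) !bconv_translate (bconvC e (btranslate _ _)).
  rewrite bconv_translate ee /= mulrA c1 mul1r addKr => h1.
  by rewrite mulrBl -h1; ring.
have [mu1 H1] : exists mu, forall x, e (y + x) + e (- y + x) = mu * e x.
  have [|mu hmu] := H 1; first by rewrite conjC1 mulr1.
  by exists mu => x; rewrite -hmu conjC1 !mul1r.
have [mu2 H2] : exists mu, forall x, 'i%C * e (y + x) - 'i%C * e (- y + x) = mu * e x.
  have iJ : ('i%C : R[i])^* = - 'i%C by apply: complex_ext => /=; rewrite ?oppr0.
  have [|mu hmu] := H 'i%C; first by rewrite iJ mulrN imaginaryM opprK.
  by exists mu => x; rewrite -hmu iJ mulNr.
exists ((mu1 - 'i%C * mu2) / 2) => x.
have E2 : 2 * e (y + x) = (mu1 - 'i%C * mu2) * e x.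
  rewrite mulrBl -mulrA -H1 -H2 -mulrBr !mulrA imaginaryM; ring.
by rewrite mulrAC -E2 mulrC mulKf// pnatr_eq0.
Qed.

(** The character is [e / e 0] for an unsplittable [e]: since translates of [e] are multiples of
    [e], it is multiplicative. The bound is the one that Parseval would give for the largest
    [|fourier g chi|^2], as a ratio of the fourth to the second moment. *)
Lemma exists_character g : 0 < || bgram g ||^2 ->
  exists chi : dual R A,
    || bgram g ||^2 / || g ||^2 <= modulus (fourier g chi) ^+ 2.
Proof.
move=> G0; have [lam [e [glam [ee es] Ge e0 emin]]] := unsplittable_idempotent G0.
have eT := translate_unsplittable ee es emin.
have ez : e 0 = (|| e ||^2)%:C by exact: idempotent0.
have ez0 : e 0 != 0 by rewrite ez (inj_eq (@complexI _)) lt0r_neq0.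
pose chi x := e x / e 0.
have echi y x : e (y + x) = chi y * e x.
  have [k kE] := eT y; rewrite kE; congr (_ * _).
  by rewrite /chi -[y in e y]addr0 kE mulfK.
have chiD x y : chi (x + y) = chi x * chi y by rewrite {1}/chi echi -mulrA.
have chi0 : chi 0 = 1 by rewrite /chi divff.
have chi_le1 x : modulus (chi x) <= 1.
  rewrite /chi modulusM (_ : modulus (e 0)^-1 = (|| e ||^2)^-1).
    by rewrite ler_pdivrMr// mul1r modulus_idempotent.
  by rewrite ez -rmorphV ?unitfE ?lt0r_neq0// modulus_real ger0_norm ?invr_ge0 ?sqnorm_ge0.
(* [chi x] and [chi (- x)] are inverse to each other and neither exceeds 1 in modulus. *)
have chi_mod x : modulus (chi x) = 1.
  apply/le_anti; rewrite chi_le1 leNgt/=; apply/negP => lt1.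
  have : modulus (chi x * chi (- x)) = 1 by rewrite -chiD subrr chi0 modulus1.
  rewrite modulusM => E; have := chi_le1 (- x); have := modulus_ge0 (chi (- x)).
  move: lt1 E; set a := modulus (chi x); set b := modulus _ => a1 ab b0 b1.
  have : a * b <= a by rewrite ler_piMr ?modulus_ge0.
  by rewrite ab leNgt a1.
have mchi : cmeasurable chi.
  by apply: (@cmeasM _ _ (borel A) e (fun=> (e 0)^-1)); [exact: (bfunP e).1|exact: cmeas_cst].
have chi_norm x : `|chi x| = 1 by rewrite normE chi_mod.
pose X := Character (measurable_character_continuous mchi chi_mod chiD) chi_norm chiD.
have chiN y : chi (- y) = (chi y)^*.
  have c0 : chi y != 0 by rewrite -normr_eq0 chi_norm oner_eq0.
  by apply: (mulfI c0); rewrite -chiD subrr chi0 mulJ chi_mod expr1n.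
have conv_e f x : bconv f e x = fourier f X * e x.
  rewrite !fourierE -cexpZr; last first.
    by apply: bmeasM; [exact: bfunP|apply: bmeasJ; exact: (bmeas_character X)].
  by apply: eq_cexp => y; rewrite /= addrC echi chiN mulrA.
have starX : fourier (bstar g) X = (fourier g X)^*.
  have bF : @bmeas R _ (borel A) (fun x => g x * (chi x)^*).
    by apply: bmeasM; [exact: bfunP|apply: bmeasJ; exact: (bmeas_character X)].
  rewrite !fourierE -cexpJ; last exact: bF.
  rewrite -[RHS]cexp_opp; last exact: (bmeasJ bF).1.
  by apply: eq_cexp => x; rewrite [RHS]rmorphM /= chiN conjCK.
(* Convolution by [g] multiplies [e] by [fourier g X], so [bgram g] multiplies it by the squared
   modulus; but that eigenvalue is [lam]. *)
exists X; suff -> : modulus (fourier g X) ^+ 2 = lam by [].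
apply: complexI; apply: (mulIf ez0).
transitivity (bconv (bgram g) e 0); last by rewrite Ge.
rewrite /bgram bconvA (_ : bconv (bstar g) e = bscale (fourier (bstar g) X) e).
  by rewrite bconvZr /= -[cexp _ _]/(bconv g e 0) conv_e starX mulrA (mulrC _^*) mulJ.
by apply: bfun_ext => x; rewrite conv_e.
Qed.

End PowerIteration.

(** * Bounding the U_2 norm by the largest Fourier coefficient *)

Section InverseTheorem.
Context (R : realType) (A : compact_abelian_group R).
Implicit Types h : bfun A.

Lemma bgramE h a : bgram h a = cexp (haar A) (fun y => (h y)^* * h (a + y)).
Proof.
have bF : @bmeas R _ (borel A) (fun y => h y * (h (- (a - y)))^*).
  exact: (bconv_integrand h (bstar h) a).
transitivity (cexp (haar A) (fun y => h (a + y) * (h (- (a - (a + y))))^*)).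
  by symmetry; exact: (cexp_translate a bF.1).
apply: eq_cexp => y; rewrite (_ : a - (a + y) = - y) ?opprK 1?mulrC//.
by rewrite opprD addrA subrr sub0r.
Qed.

(** For fixed [x] and [a] the average over [b] is [bgram h a], after translating by [x]; the
    remaining average over [x] is its conjugate. *)
Lemma U2norm_gram h : U2norm h = sqnorm (haar A) (bgram h) `^ (4%:R^-1).
Proof.
congr (complex.Re _ `^ _).
have bT y : @bmeas R _ (borel A) (fun x => h (y + x)) by exact: bfunP (btranslate y h).
transitivity (cexp (haar A) (fun x => cexp (haar A) (fun a =>
    h x * (h (x + a))^* * bgram h a))).
  apply: eq_cexp => x; apply: eq_cexp => a; rewrite bgramE.
  have bF : @bmeas R _ (borel A) (fun b => (h b)^* * h (a + b)).
    by apply: bmeasM => //; apply: bmeasJ; exact: bfunP.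
  rewrite -(cexp_translate x bF.1) -cexpZ.
    by apply: eq_cexp => b; rewrite -mulrA addrCA addrA.
  apply: bmeasM; first by apply: bmeasJ; exact: bT.
  apply: bfun_comp; apply: measurable_addA; first exact: measurable_cst.
  by apply: measurable_addA; [exact: measurable_cst|exact: measurable_id].
rewrite (cexp_Fubini (haar A) (haar A) (F := fun p : borel A * borel A =>
   h p.1 * (h ((p.1 : A) + (p.2 : A)))^* * bgram h p.2)); last first.
  apply: bmeasM; last by apply: bfun_comp; exact: measurable_snd.
  apply: bmeasM; first by apply: bfun_comp; exact: measurable_fst.
  apply: bmeasJ; apply: bfun_comp.
  by apply: measurable_addA; [exact: measurable_fst|exact: measurable_snd].
apply: eq_cexp => a.
rewrite -[LHS]/(cexp (haar A) (fun x : A => h x * (h (x + a))^* * bgram h a)).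
have bG : @bmeas R _ (borel A) (fun x => (h x)^* * h (a + x)).
  by apply: bmeasM => //; apply: bmeasJ; exact: bfunP.
rewrite cexpZr; last first.
  apply: bmeasM; first exact: bfunP.
  by apply: bmeasJ; apply: bfun_comp; apply: measurable_addA;
    [exact: measurable_id|exact: measurable_cst].
rewrite mulrC; congr (_ * _); rewrite bgramE -cexpJ//.
by apply: eq_cexp => x; rewrite rmorphM /= conjCK addrC.
Qed.

(** The character found by [exists_character] bounds the squared norm of [bgram h], the fourth power
    of the U_2 norm, by [delta ^+ 4] times the squared norm of [h], which is at most 1. *)
Lemma U2norm_le h (delta : R) : 0 < delta -> (forall x, modulus (h x) <= 1) ->
  (forall chi, modulus (fourier h chi) <= delta ^+ 2) -> U2norm h <= delta.
Proof.
move=> d0 h1 hd; rewrite U2norm_gram.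
have h_le1 : sqnorm (haar A) h <= 1.
  by have := sqnorm_le (haar A) (bfunP h) h1; rewrite expr1n.
have [->|G0] := eqVneq (sqnorm (haar A) (bgram h)) 0.
  by rewrite powR0 ?ltW// invr_eq0 pnatr_eq0.
have {}G0 : 0 < sqnorm (haar A) (bgram h) by rewrite lt0r G0 sqnorm_ge0.
have hpos : 0 < sqnorm (haar A) h.
  rewrite lt0r sqnorm_ge0 andbT; apply/eqP => g0.
  by have := sqnorm_gram_le h; rewrite g0 expr0n /= leNgt G0.
have [chi] := exists_character G0; rewrite ler_pdivrMr// => hchi.
have {hchi} : sqnorm (haar A) (bgram h) <= delta ^+ 4.
  apply: (le_trans hchi); rewrite -[leRHS]mulr1 ler_pM// ?sqr_ge0 ?sqnorm_ge0//.
  rewrite (_ : delta ^+ 4 = (delta ^+ 2) ^+ 2); last by rewrite -exprM.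
  by rewrite lerXn2r ?nnegrE ?modulus_ge0 ?sqr_ge0.
move=> /(ge0_ler_powR (r := 4%:R^-1)) H.
apply: le_trans (H _ _ _) _;
  rewrite ?nnegrE ?invr_ge0 ?ler0n ?sqnorm_ge0 ?exprn_ge0 ?(ltW d0)//.
by rewrite -powR_mulrn ?(ltW d0)// -powRrM mulfV ?pnatr_eq0// powRr1 ?(ltW d0).
Qed.

End InverseTheorem.

(** * Iterated expectations *)

Section TupleMeasurability.
Context (R : realType) (A : compact_abelian_group R).

(* [tpred Q F] is the predicate [Q] for the function of x and of the coordinates
   of t with values [F x t]; this avoids a measurable structure on tuples. *)
Fixpoint tpred (V : Type)
    (Q : forall (d : measure_display) (X : measurableType d), (X -> V) -> Prop)
    n d (X : measurableType d) : (X -> n.-tuple A -> V) -> Prop :=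
  if n is m.+1 then fun F =>
    @tpred V Q m _ (X * borel A)%type (fun p t => F p.1 (cons_tuple (p.2 : A) t))
  else fun F => Q d X (fun x => F x [tuple]).

Notation tmeas := (tpred (@cmeas R)).
Notation tmeasA :=
  (tpred (fun d (X : measurableType d) (u : X -> A) => measurable_fun setT (u : X -> borel A))).

Lemma tpred_map2 (V1 V2 V3 : Type) (op : V1 -> V2 -> V3) Q1 Q2 Q3 n d
    (X : measurableType d) (F : X -> n.-tuple A -> V1) (G : X -> n.-tuple A -> V2) :
  (forall d (X : measurableType d) (f : X -> V1) (g : X -> V2),
     Q1 d X f -> Q2 d X g -> Q3 d X (fun x => op (f x) (g x))) ->
  tpred Q1 F -> tpred Q2 G -> tpred Q3 (fun x t => op (F x t) (G x t)).
Proof.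
move=> H; elim: n d X F G => [|n IH] d X F G /=; first exact: H.
exact: IH.
Qed.

Lemma tpred_map (V1 V2 : Type) (op : V1 -> V2) Q1 Q2 n d
    (X : measurableType d) (F : X -> n.-tuple A -> V1) :
  (forall d (X : measurableType d) (f : X -> V1),
     Q1 d X f -> Q2 d X (fun x => op (f x))) ->
  tpred Q1 F -> tpred Q2 (fun x t => op (F x t)).
Proof.
move=> H; elim: n d X F => [|n IH] d X F /=; first exact: H.
exact: IH.
Qed.

Lemma tpred_fst (V : Type) Q n d (X : measurableType d) (f : X -> V) :
  (forall d (X : measurableType d) d' (Y : measurableType d') (u : Y -> X) (f : X -> V),
     measurable_fun setT u -> Q d X f -> Q d' Y (fun y => f (u y))) ->
  Q d X f -> tpred Q (fun x (_ : n.-tuple A) => f x).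
Proof.
move=> H; elim: n d X f => [//|n IH] d X f Qf /=.
by apply: IH; apply: (H _ X) Qf; exact: measurable_fst.
Qed.

Lemma tmeas_fst n d (X : measurableType d) (f : X -> R[i]) :
  cmeas f -> tmeas (fun x (_ : n.-tuple A) => f x).
Proof.
by apply: tpred_fst => {}d {}X d' Y u {}f mu mf; exact: (cmeas_comp mf mu).
Qed.

Lemma tmeasA_fst n d (X : measurableType d) (u : X -> A) :
  measurable_fun setT (u : X -> borel A) -> tmeasA (fun x (_ : n.-tuple A) => u x).
Proof.
apply: tpred_fst => d1 X1 d' Y u' f mu mf.
exact: (@measurableT_comp _ _ _ Y X1 (borel A) f setT u' mf mu).
Qed.

Lemma tmeas_cst n d (X : measurableType d) (c : R[i]) :
  tmeas (fun (_ : X) (_ : n.-tuple A) => c).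
Proof. by apply: tmeas_fst; exact: cmeas_cst. Qed.

Lemma tmeasD n d (X : measurableType d) (F G : X -> n.-tuple A -> R[i]) :
  tmeas F -> tmeas G -> tmeas (fun x t => F x t + G x t).
Proof. by apply: tpred_map2 => ? ? ? ?; exact: cmeasD. Qed.

Lemma tmeasM n d (X : measurableType d) (F G : X -> n.-tuple A -> R[i]) :
  tmeas F -> tmeas G -> tmeas (fun x t => F x t * G x t).
Proof. by apply: tpred_map2 => ? ? ? ?; exact: cmeasM. Qed.

Lemma tmeas_sum n d (X : measurableType d) (I : Type) (s : seq I)
    (F : I -> X -> n.-tuple A -> R[i]) :
  (forall i, tmeas (F i)) -> tmeas (fun x t => \sum_(i <- s) F i x t).
Proof.
move=> mF; elim: s => [|i s IH].
  rewrite (_ : (fun _ _ => _) = fun _ _ => 0); first exact: tmeas_cst.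
  by apply/funext => x; apply/funext => t; rewrite big_nil.
rewrite (_ : (fun _ _ => _) = fun x t => F i x t + \sum_(j <- s) F j x t).
  exact: tmeasD.
by apply/funext => x; apply/funext => t; rewrite big_cons.
Qed.

Lemma tmeas_prod n d (X : measurableType d) (I : Type) (s : seq I)
    (F : I -> X -> n.-tuple A -> R[i]) :
  (forall i, tmeas (F i)) -> tmeas (fun x t => \prod_(i <- s) F i x t).
Proof.
move=> mF; elim: s => [|i s IH].
  rewrite (_ : (fun _ _ => _) = fun _ _ => 1); first exact: tmeas_cst.
  by apply/funext => x; apply/funext => t; rewrite big_nil.
rewrite (_ : (fun _ _ => _) = fun x t => F i x t * \prod_(j <- s) F j x t).
  exact: tmeasM.
by apply/funext => x; apply/funext => t; rewrite big_cons.
Qed.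

Lemma tmeas_funA n d (X : measurableType d) (f : A -> R[i]) (U : X -> n.-tuple A -> A) :
  cmeasurable f -> tmeasA U -> tmeas (fun x t => f (U x t)).
Proof.
move=> mf; apply: tpred_map => d1 X1 u mu.
exact: (@cmeas_comp _ _ (borel A) _ X1 u f mf mu).
Qed.

Lemma tmeasA_sum n d (X : measurableType d) (I : Type) (s : seq I)
    (U : I -> X -> n.-tuple A -> A) :
  (forall i, tmeasA (U i)) -> tmeasA (fun x t => \sum_(i <- s) U i x t).
Proof.
move=> mU; elim: s => [|i s IH].
  rewrite (_ : (fun _ _ => _) = fun _ _ => 0).
    by apply: tmeasA_fst; exact: measurable_cst.
  by apply/funext => x; apply/funext => t; rewrite big_nil.
rewrite (_ : (fun _ _ => _) = fun x t => U i x t + \sum_(j <- s) U j x t).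
  apply: (tpred_map2 (op := fun a b : A => a + b)) (mU i) IH => ? ? ? ?.
  exact: measurable_addA.
by apply/funext => x; apply/funext => t; rewrite big_cons.
Qed.

Lemma tmeasA_tnth n d (X : measurableType d) (j : 'I_n) :
  tmeasA (fun (_ : X) (t : n.-tuple A) => tnth t j).
Proof.
elim: n d X j => [|n IH] d X j; first by case: j.
rewrite /=; have [->|[j' ->]] : j = ord0 \/ exists j', j = lift ord0 j'.
  by case: (unliftP ord0 j) => [j' ->|->]; [right; exists j'|left].
- rewrite (_ : (fun _ _ => _) = fun (p : X * borel A) _ => (p.2 : A)).
    by apply: tmeasA_fst; exact: measurable_snd.
  by apply/funext => p; apply/funext => t; rewrite tnth0.
- rewrite (_ : (fun _ _ => _) = fun (p : X * borel A) t => tnth t j').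
    exact: IH.
  by apply/funext => p; apply/funext => t; rewrite tnthS.
Qed.

Lemma tmeasA_form k n d (X : measurableType d) (L : 'M[int]_(k, n)) i :
  tmeasA (fun (_ : X) (t : n.-tuple A) => linear_form_eval L i t).
Proof.
apply: tmeasA_sum => j; apply: (tpred_map (op := fun a : A => a *~ L i j)) (tmeasA_tnth X j) => ? ? u.
exact: measurable_mulzA.
Qed.

Lemma tmeas_form k n d (X : measurableType d) (L : 'M[int]_(k, n)) i (f : A -> R[i]) :
  cmeasurable f -> tmeas (fun (_ : X) (t : n.-tuple A) => f (linear_form_eval L i t)).
Proof. by move=> mf; apply: tmeas_funA => //; exact: tmeasA_form. Qed.

End TupleMeasurability.

Notation tmeas := (tpred (@cmeas _)).

Section TupleExpectation.
Context (R : realType) (A : compact_abelian_group R).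
Local Notation En := (@haar_expectation_n R A _).

Lemma cmeas_En n d (X : measurableType d) (F : X -> n.-tuple A -> R[i]) :
  tmeas F -> cmeas (fun x => En (F x)).
Proof.
elim: n d X F => [//|n IH] d X F /= mF.
exact: (cmeas_cexp (haar A) (IH _ _ _ mF)).
Qed.

Lemma modulus_En n d (X : measurableType d) (F : X -> n.-tuple A -> R[i]) (M : R) :
  tmeas F -> (forall x t, modulus (F x t) <= M) -> forall x, modulus (En (F x)) <= M.
Proof.
elim: n d X F => [|n IH] d X F /= mF FM x; first exact: FM.
have FM' := IH _ _ _ mF (fun _ _ => FM _ _).
apply: modulus_cexp => [|y]; last exact: (FM' (x, y)).
split; first exact: (cmeas_pair1 x (cmeas_En mF)).
by exists M => y; exact: (FM' (x, y)).
Qed.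

Lemma bmeas_En n d (X : measurableType d) (F : X -> n.-tuple A -> R[i]) (M : R) :
  tmeas F -> (forall x t, modulus (F x t) <= M) -> bmeas (fun x => En (F x)).
Proof.
by move=> mF FM; split; [exact: cmeas_En|exists M; exact: modulus_En].
Qed.

Lemma EnD n d (X : measurableType d) (F G : X -> n.-tuple A -> R[i]) (M N : R) :
  tmeas F -> (forall x t, modulus (F x t) <= M) ->
  tmeas G -> (forall x t, modulus (G x t) <= N) ->
  forall x, En (fun t => F x t + G x t) = En (F x) + En (G x).
Proof.
elim: n d X F G => [//|n IH] d X F G /= mF FM mG GN x.
rewrite -cexpD; first last.
- exact: (bmeas_pair1 x (bmeas_En mG (fun _ _ => GN _ _))).
- exact: (bmeas_pair1 x (bmeas_En mF (fun _ _ => FM _ _))).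
apply: eq_cexp => y.
exact: (IH _ _ _ _ mF (fun _ _ => FM _ _) mG (fun _ _ => GN _ _) (x, y)).
Qed.

Lemma EnZ n d (X : measurableType d) (F : X -> n.-tuple A -> R[i]) (M : R) c :
  tmeas F -> (forall x t, modulus (F x t) <= M) ->
  forall x, En (fun t => c * F x t) = c * En (F x).
Proof.
elim: n d X F => [//|n IH] d X F /= mF FM x.
rewrite -cexpZ; last exact: (bmeas_pair1 x (bmeas_En mF (fun _ _ => FM _ _))).
by apply: eq_cexp => y; exact: (IH _ _ _ mF (fun _ _ => FM _ _) (x, y)).
Qed.

Lemma En_cst n c : En (fun _ : n.-tuple A => c) = c.
Proof.
elim: n => [//|n IH] /=; rewrite -[RHS](cexp_cst (haar A)).
by apply: eq_cexp => x.
Qed.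

Lemma En_sum n d (X : measurableType d) (I : Type) (s : seq I)
    (F : I -> X -> n.-tuple A -> R[i]) (M : R) :
  (forall i, tmeas (F i)) -> (forall i x t, modulus (F i x t) <= M) ->
  forall x, En (fun t => \sum_(i <- s) F i x t) = \sum_(i <- s) En (F i x).
Proof.
move=> mF FM x; elim: s => [|i s IH].
  rewrite big_nil -[RHS](En_cst n); congr haar_expectation_n.
  by apply/funext => t; rewrite big_nil.
rewrite big_cons -IH -(EnD (M := M) (N := \sum_(i <- s) M)
   (G := fun x t => \sum_(j <- s) F j x t))//.
- by congr haar_expectation_n; apply/funext => t; rewrite big_cons.
- exact: tmeas_sum.
- move=> z t; elim: s {IH} => [|j s IH]; first by rewrite !big_nil modulus0.
  by rewrite !big_cons (le_trans (modulusD _ _))// lerD.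
Qed.

Lemma En_ge0 n (F : n.-tuple A -> R[i]) : (forall t, 0 <= F t) -> 0 <= En F.
Proof.
elim: n F => [|n IH] F F0; first exact: F0.
apply: (@cexp_ge0 _ _ _ (haar A) (fun x : A => En (fun t => F (cons_tuple x t)))) => x.
by apply: IH => t; exact: F0.
Qed.

Lemma cexp_eq0_ae (f : A -> R[i]) : @bmeas R _ (borel A) f -> (forall x, 0 <= f x) ->
  cexp (haar A) f = 0 -> {ae haar A, forall x, f x = 0}.
Proof.
move=> bf f0 Ef; have [[mf _] _] := bf.
have : (\int[haar A]_x `|(complex.Re (f x))%:E|)%E = 0.
  have := bmeas_Re (haar A) bf => /(integrable_fin_num measurableT) fin.
  rewrite (eq_integral (fun x : borel A => (complex.Re (f x))%:E)); last first.
    move=> x _; rewrite gee0_abs// lee_fin.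
    by have := f0 x; rewrite lecE => /andP[].
  rewrite -[LHS]fineK; last exact: fin.
  exact: (congr1 (fun z => (complex.Re z)%:E) Ef).
move/(ae_eq_integral_abs (haar A) measurableT).
have mE : measurable_fun setT (EFin \o (fun x : borel A => complex.Re (f x))).
  exact/measurable_EFinP.
move=> /(_ mE); apply: filterS => x /(_ I) /= [fx].
have := f0 x; rewrite lecE => /andP[/eqP im _].
by apply: complex_ext.
Qed.

(** Almost everywhere equality for iterated integrals: the exceptional set of tuples is represented
    by a nonnegative [m] of expectation zero. In the induction step, the inner expectation of [m]
    vanishes for almost every first coordinate. *)
Lemma eq_En_ae n d (X : measurableType d) (F G m : X -> n.-tuple A -> R[i]) (M : R) :
  tmeas F -> tmeas G -> tmeas m -> (forall x t, modulus (m x t) <= M) ->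
  (forall x t, 0 <= m x t) -> (forall x t, m x t = 0 -> F x t = G x t) ->
  forall x, En (m x) = 0 -> En (F x) = En (G x).
Proof.
elim: n d X F G m => [|n IH] d X F G m /= mF mG mm mM m0 FG x mx0; first exact: FG.
have bm := bmeas_En mm (fun _ _ => mM _ _).
apply: ae_eq_cexp.
- exact: (cmeas_pair1 x (cmeas_En mF)).
- exact: (cmeas_pair1 x (cmeas_En mG)).
have pos : forall y : A, 0 <= En (fun t => m x (cons_tuple y t)).
  by move=> y; apply: En_ge0 => t; exact: m0.
have : {ae haar A, forall y : A, En (fun t => m x (cons_tuple y t)) = 0}.
  exact: (cexp_eq0_ae (bmeas_pair1 x bm) pos mx0).
move=> [N [mN N0 sub]]; exists N; split=> // y FGy; apply: sub => my; apply: FGy.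
exact: (IH _ _ _ _ _ mF mG mm (fun _ _ => mM _ _) (fun _ _ => m0 _ _) (fun _ _ => FG _ _) (x, y) my).
Qed.

(** Translation by [y] multiplies the mean by [chi y], which differs from 1 for some [y] when [chi]
    is nontrivial. *)
Lemma cexp_character (chi : dual R A) :
  cexp (haar A) chi = (chi == 1%g)%:R.
Proof.
have [->|nchi] := eqVneq chi 1%g; first by rewrite -[RHS](cexp_cst (haar A)).
have [y chiy] : exists y, chi y != 1.
  apply: contrapT => H; move/eqP: nchi; apply; apply: dual_ext => x.
  by apply/eqP/negPn/negP => Hx; apply: H; exists x.
have bchi := bmeas_character chi.
have := cexp_translate y bchi.1.
under eq_cexp do rewrite charD.
rewrite cexpZ// => /eqP; rewrite -subr_eq0 -[X in _ - X]mul1r -mulrBl mulf_eq0 subr_eq0.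
by rewrite (negbTE chiy) => /eqP.
Qed.

Lemma En_characters n (psi : 'I_n -> dual R A) :
  En (fun t => \prod_(j < n) psi j (tnth t j)) = \prod_(j < n) (psi j == 1%g)%:R.
Proof.
elim: n psi => [|n IH] psi; first by rewrite /= !big_ord0.
rewrite /= big_ord_recl -IH -cexp_character -cexpZr; last exact: bmeas_character.
apply: eq_cexp => x; rewrite -(EnZ (X := borel A) (M := 1)
  (F := fun _ t => \prod_(j < n) psi (lift ord0 j) (tnth t j)) _ _ _ 0).
- congr haar_expectation_n; apply/funext => t; rewrite big_ord_recl tnth0.
  by congr (_ * _); apply: eq_bigr => j _; rewrite tnthS.
- apply: tmeas_prod => j; apply: tmeas_funA; first exact: (bmeas_character _).1.
  exact: tmeasA_tnth.
- move=> _ t; elim/big_ind: _ => [|a b a1 b1|j _]; first by rewrite modulus1.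
    by rewrite modulusM -[1]mul1r ler_pM// modulus_ge0.
  by rewrite -modulus_le char_norm.
Qed.

End TupleExpectation.

(** * Densities *)

Section Densities.
Context (R : realType).

Section OneGroup.
Context (A : compact_abelian_group R) (k n : nat) (L : 'M[int]_(k, n)).

Definition configuration (f : 'I_k -> A -> R[i]) (t : n.-tuple A) : R[i] :=
  \prod_(i < k) f i (linear_form_eval L i t).

Lemma multi_densityE f : multi_density L f = haar_expectation_n (configuration f).
Proof. by []. Qed.

Lemma tmeas_configuration d (X : measurableType d) (f : 'I_k -> A -> R[i]) :
  (forall i, cmeasurable (f i)) -> tmeas (fun _ : X => configuration f).
Proof. by move=> mf; apply: tmeas_prod => i; exact: tmeas_form. Qed.

Lemma modulus_configuration (M : R) (f : 'I_k -> A -> R[i]) t :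
  (forall i x, modulus (f i x) <= M) -> modulus (configuration f t) <= M ^+ k.
Proof.
move=> fM; rewrite -[in leRHS](card_ord k) -prodr_const /configuration.
elim/big_ind2: _ => [|a b c d ab cd|i _]; rewrite ?modulus1//.
by rewrite modulusM ler_pM ?modulus_ge0.
Qed.

Lemma multi_densityB (f g h : 'I_k -> A -> R[i]) (M : R) :
  (forall i, cmeasurable (f i)) -> (forall i x, modulus (f i x) <= M) ->
  (forall i, cmeasurable (g i)) -> (forall i x, modulus (g i x) <= M) ->
  (forall t, configuration f t - configuration g t = configuration h t) ->
  multi_density L f - multi_density L g = multi_density L h.
Proof.
move=> mf fM mg gM H; rewrite !multi_densityE.
have mF := tmeas_configuration (borel A) mf; have mG := tmeas_configuration (borel A) mg.
have FM (_ : borel A) t : modulus (configuration f t) <= M ^+ k by exact: modulus_configuration.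
have GM (_ : borel A) t : modulus (configuration g t) <= M ^+ k by exact: modulus_configuration.
rewrite -[X in _ + X]mulN1r -(EnZ (-1) mG GM (0 : A))
  -(EnD (N := M ^+ k) (G := fun (_ : borel A) t => -1 * configuration g t) mF FM _ _ (0 : A)).
- by congr haar_expectation_n; apply/funext => t; rewrite mulN1r H.
- by apply: tmeasM => //; exact: tmeas_cst.
- by move=> _ t; rewrite mulN1r modulusN; exact: (GM (0 : A)).
Qed.

Lemma multi_densityZ (f : 'I_k -> A -> R[i]) (M : R) (c : R[i]) :
  (forall i, cmeasurable (f i)) -> (forall i x, modulus (f i x) <= M) ->
  multi_density L (fun i x => c * f i x) = c ^+ k * multi_density L f.
Proof.
move=> mf fM; rewrite !multi_densityE.
have mF := tmeas_configuration (borel A) mf.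
have FM (_ : borel A) t : modulus (configuration f t) <= M ^+ k by exact: modulus_configuration.
rewrite -(EnZ _ mF FM (0 : A)); congr haar_expectation_n; apply/funext => t.
by rewrite /configuration big_split /= prodr_const card_ord.
Qed.

Section ComplexityBound.
Context (eps delta : R).
Hypothesis complexity : forall f : 'I_k -> A -> R[i],
  (forall i, cmeasurable (f i)) -> (forall i x, `|f i x| <= 1) ->
  (exists j, U2norm (f j) <= delta) -> `|multi_density L f| <= eps%:C.

Lemma multi_density_U2 (f : 'I_k -> A -> R[i]) (M : R) (j : 'I_k) : 0 < M ->
  (forall i, cmeasurable (f i)) -> (forall i x, modulus (f i x) <= M) ->
  U2norm (fun x => (M^-1)%:C * f j x) <= delta ->
  modulus (multi_density L f) <= M ^+ k * eps.
Proof.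
move=> M0 mf fM fj.
have -> : multi_density L f =
    M%:C ^+ k * multi_density L (fun i x => (M^-1)%:C * f i x).
  rewrite (multi_densityZ _ mf fM) mulrA -exprMn -rmorphM divff ?lt0r_neq0//.
  by rewrite expr1n mul1r.
rewrite modulusM -rmorphXn modulus_real ger0_norm ?exprn_ge0 ?(ltW M0)//.
apply: ler_wpM2l; first by rewrite exprn_ge0// ltW.
rewrite -modulus_le; apply: complexity; last by exists j.
  by move=> i; apply: (@cmeasM _ _ (borel A) (fun=> (M^-1)%:C) (f i) (cmeas_cst _ _) (mf i)).
move=> i x; rewrite modulus_le modulusM modulus_real ger0_norm ?invr_ge0 ?(ltW M0)//.
by rewrite mulrC ler_pdivrMr// mul1r.
Qed.

(* Telescoping: the factors [f] are replaced by [g] one at a time. *)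
Lemma density_U2 (f g : A -> R[i]) (a : R) : 0 < a ->
  cmeasurable f -> (forall x, modulus (f x) <= a) ->
  cmeasurable g -> (forall x, modulus (g x) <= a) ->
  U2norm (fun x => ((a + a)^-1)%:C * (f x - g x)) <= delta ->
  modulus (density L f - density L g) <= k%:R * ((a + a) ^+ k * eps).
Proof.
move=> a0 mf fa mg ga fg; pose H m (i : 'I_k) := if (i < m)%N then g else f.
have mH m i : cmeasurable (H m i) by rewrite /H; case: ifP.
have HM m i x : modulus (H m i x) <= a + a.
  by rewrite /H; case: ifP => _; rewrite (le_trans (fa x), le_trans (ga x)) ?lerDl ?ltW.
have step m : (m < k)%N ->
    modulus (multi_density L (H m) - multi_density L (H m.+1)) <= (a + a) ^+ k * eps.
  move=> mk; pose j := Ordinal mk.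
  (* [H m] and [H m.+1] differ only at [j], so their densities differ by a density with [f - g] in
     that place. The bound [a + a] on that factor is imposed on all the others as well. *)
  pose D i := if i == j then (fun x => f x - g x) else H m i.
  rewrite (multi_densityB (h := D) (mH _) (HM _) (mH _) (HM _)).
    apply: (@multi_density_U2 D (a + a) j).
    - exact: addr_gt0.
    - move=> i; rewrite /D; case: eqP => _; last exact: mH.
      exact: (@cmeasD _ _ (borel A) _ _ mf (@cmeasN _ _ (borel A) _ mg)).
    - move=> i x; rewrite /D; case: eqP => _; last exact: HM.
      by rewrite (le_trans (modulusB _ _))// lerD.
    - by rewrite /D eqxx.
  move=> t; rewrite /configuration (bigD1 j isT) [X in _ - X](bigD1 j isT).
  rewrite [RHS](bigD1 j isT) /= /D eqxx.
  have -> : H m j = f by rewrite /H ltnn.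
  have -> : H m.+1 j = g by rewrite /H ltnSn.
  rewrite mulrBl; congr (_ * _ - _ * _); apply: eq_bigr => i ij.
    by rewrite (negbTE ij).
  rewrite (negbTE ij) /H ltnS leq_eqVlt.
  by have /negbTE -> : (i : nat) != m by apply: contra_neq ij => im; exact: val_inj.
have tele m : (m <= k)%N -> modulus (multi_density L (H 0) - multi_density L (H m)) <=
    m%:R * ((a + a) ^+ k * eps).
  elim: m => [|m IH] mk; first by rewrite subrr modulus0 mul0r.
  rewrite -(subrK (multi_density L (H m)) (multi_density L (H 0))) -addrA.
  rewrite (le_trans (modulusD _ _))// -natr1 mulrDl mul1r lerD ?step//.
  by apply: IH; exact: ltnW.
have -> : density L f = multi_density L (H 0%N) by [].
have -> : density L g = multi_density L (H k).
  by congr multi_density; apply/funext => i; rewrite /H ltn_ord.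
exact: tele.
Qed.

End ComplexityBound.
End OneGroup.

Definition cindic (A : compact_abelian_group R) (N : set A) (x : A) : R[i] :=
  (\1_N x)%:C.

Lemma modulus_cindic (A : compact_abelian_group R) (N : set A) x :
  modulus (cindic N x) <= 1.
Proof. by rewrite modulus_real indicE; case: (_ \in _); rewrite ?normr1// normr0. Qed.

Lemma bmeas_cindic (A : compact_abelian_group R) (N : set (borel A)) : measurable N ->
  @bmeas R _ (borel A) (cindic N).
Proof.
move=> mN; split; first by apply: cmeas_real; exact: measurable_indic.
by exists 1 => x; exact: modulus_cindic.
Qed.

Lemma U2norm_cindic0 (A : compact_abelian_group R) (N : set (borel A)) :
  measurable N -> haar A N = 0%E -> U2norm (cindic N : A -> R[i]) = 0.
Proof.
move=> mN N0; pose h := BFun (bmeas_cindic mN).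
have h0 : sqnorm (haar A) h = 0.
  rewrite /sqnorm (@eq_cexp _ _ (borel A) _ _ (cindic N : borel A -> R[i])); last first.
    move=> x; rewrite mulJ /= modulus_real /cindic indicE.
    by case: (_ \in _); rewrite ?normr1 ?expr1n// normr0 expr0n.
  rewrite cexp_real /= /Rintegral.
  rewrite -[X in fine X]/(\int[haar A]_x (\1_N x)%:E)%E.
  by rewrite integral_indic ?setIT//; exact: (congr1 fine N0).
have -> : U2norm (cindic N : A -> R[i]) = _ := U2norm_gram h.
rewrite (_ : sqnorm _ _ = 0) ?powR0 ?invr_eq0 ?pnatr_eq0//.
apply/le_anti; rewrite sqnorm_ge0 andbT.
by rewrite (le_trans (sqnorm_gram_le h))// h0 expr0n.
Qed.

(** * Null sets and invariance under isomorphism *)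

Section NullSets.
Context (k n : nat) (L : 'M[int]_(k, n)) (F : compact_abelian_group R -> Prop).
Hypothesis complexity : true_complexity_at_most_1 L F.
Context (A : compact_abelian_group R).
Hypothesis FA : F A.

(* The indicator of a null set has U_2 norm zero. *)
Lemma form_null j (N : set (borel A)) : measurable N -> haar A N = 0%E ->
  haar_expectation_n (fun t : n.-tuple A => cindic N (linear_form_eval L j t)) = 0.
Proof.
move=> mN N0; pose f i : A -> R[i] := if i == j then cindic N else fun=> 1.
have -> : haar_expectation_n (fun t : n.-tuple A => cindic N (linear_form_eval L j t)) =
    multi_density L f.
  rewrite multi_densityE; congr haar_expectation_n; apply/funext => t.
  rewrite /configuration (bigD1 j)//= big1 => [|i ij]; last by rewrite /f (negbTE ij).
  by rewrite /f eqxx mulr1.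
apply: modulus_eq0; apply/le_anti; rewrite modulus_ge0 andbT.
apply/ler_addgt0Pl => e e0; rewrite addr0 -modulus_le.
have [delta d0 H] := complexity e0; apply: (H A FA).
- move=> i; rewrite /f; case: ifP => _; first exact: (bmeas_cindic mN).1.
  exact: (@cmeas_cst _ _ (borel A)).
- move=> i x; rewrite modulus_le /f; case: ifP => _; rewrite ?modulus1//.
  exact: modulus_cindic.
by exists j; rewrite /f eqxx U2norm_cindic0// ltW.
Qed.

(** [m] counts the forms that land in the exceptional null set. Where it vanishes both products
    agree, and its mean is 0 by [form_null]. *)
Lemma density_ae (f g : A -> R[i]) : cmeasurable f -> cmeasurable g ->
  {ae haar A, forall x, f x = g x} -> density L f = density L g.
Proof.
move=> mf mg [N [mN N0 sub]].
pose m (_ : borel A) (t : n.-tuple A) :=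
  \sum_(j < k) cindic N (linear_form_eval L j t).
have mi (j : 'I_k) : tmeas (fun (_ : borel A) (t : n.-tuple A) =>
    cindic N (linear_form_eval L j t)).
  by apply: tmeas_form; exact: (bmeas_cindic mN).1.
have i0 x : 0 <= cindic N x :> R[i].
  by rewrite /cindic lecR indicE; case: (_ \in _).
apply: (eq_En_ae (X := borel A) (m := m) (M := k%:R)
  (F := fun _ => configuration L (fun=> f)) (G := fun _ => configuration L (fun=> g))
  _ _ _ _ _ _ (x := 0 : A)).
- exact: tmeas_configuration.
- exact: tmeas_configuration.
- exact: tmeas_sum.
- move=> y t; rewrite -[in leRHS](card_ord k) -sumr_const /m.
  elim/big_ind2: _ => [|a b c d ab cd|j _]; first by rewrite modulus0.
    by rewrite (le_trans (modulusD _ _))// lerD.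
  exact: modulus_cindic.
- by move=> y t; apply: sumr_ge0.
- move=> y t mt; apply: eq_bigr => j _.
  have : cindic N (linear_form_eval L j t) = 0 :> R[i].
    apply/eqP; have /eqP := mt; rewrite psumr_eq0// => /allP /(_ j).
    by rewrite mem_index_enum => /(_ isT).
  rewrite /cindic indicE; case: (boolP (_ \in N)) => [_ /eqP|/negP nN _].
    by rewrite (inj_eq (@complexI _)) oner_eq0.
  apply: contrapT => fg; apply: nN; rewrite inE; exact: sub.
rewrite /m (En_sum (M := 1) (F := fun j (_ : borel A) t => cindic N (linear_form_eval L j t))
  _ mi _ (0 : A)).
  by apply: big1 => j _; exact: form_null.
by move=> j y t; exact: modulus_cindic.
Qed.

End NullSets.

Lemma En_epimorphism (A B : compact_abelian_group R) (phi : A -> B) n d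
    (X : measurableType d) (F : X -> n.-tuple B -> R[i]) :
  measurable_fun setT (phi : borel A -> borel B) ->
  (forall x y, phi (x + y) = phi x + phi y) -> (forall y, exists x, phi x = y) ->
  tmeas F -> forall x, haar_expectation_n (fun t : n.-tuple A => F x (map_tuple phi t)) =
    haar_expectation_n (F x).
Proof.
move=> mphi phiD surj; elim: n d X F => [|n IH] d X F mF x.
  by rewrite /=; congr (F x _); apply: val_inj.
transitivity (cexp (haar A) (fun y : A =>
    haar_expectation_n (fun t : n.-tuple B => F x (cons_tuple (phi y) t)))).
  apply: eq_cexp => y; rewrite -[RHS](IH _ _ _ mF (x, phi y)).
  congr haar_expectation_n; apply/funext => t; congr (F x _).
  exact: val_inj.
have mf : cmeasurable (fun y : B =>
    haar_expectation_n (fun t : n.-tuple B => F x (cons_tuple y t))).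
  pose G (p : X * borel B) (t : n.-tuple B) := F p.1 (cons_tuple (p.2 : B) t).
  have mG : tmeas G := mF.
  exact: (cmeas_pair1 x (cmeas_En mG)).
exact: (cexp_epimorphism mphi phiD surj mf).
Qed.

Lemma density_epimorphism (A B : compact_abelian_group R) (phi : {additive A -> B})
    k n (L : 'M[int]_(k, n)) (f : B -> R[i]) :
  continuous phi -> (forall y, exists x, phi x = y) -> cmeasurable f ->
  density L (fun x => f (phi x)) = density L f.
Proof.
move=> cphi surj mf; have mphi := measurable_continuous cphi.
rewrite /density !multi_densityE.
rewrite -(En_epimorphism (X := borel A) (F := fun _ => configuration L (fun=> f))
  mphi _ surj _ (0 : A)).
- congr haar_expectation_n; apply/funext => t; apply: eq_bigr => i _; congr f.
  rewrite /linear_form_eval raddf_sum; apply: eq_bigr => j _.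
  by rewrite raddfMz tnth_map.
- exact: raddfD.
- exact: tmeas_configuration.
Qed.

(** The common quotient [C] may lie outside the family, so values on null sets are changed only on
    [A] and [B], where complexity is available. The passage to [C] is then exact. *)
Lemma isomorphic_density (k n : nat) (L : 'M[int]_(k, n))
    (F : compact_abelian_group R -> Prop) (A B : compact_abelian_group R)
    (f : A -> R[i]) (g : B -> R[i]) :
  true_complexity_at_most_1 L F -> F A -> F B -> cmeasurable f -> cmeasurable g ->
  isomorphic f g -> density L f = density L g.
Proof.
move=> cL FA FB mf mg [C [h [alpha [beta [[mh _] [ca sa] [cb sb] haf hbg]]]]].
have sa' y : exists x, alpha x = y by have [x _ xy] := sa y I; exists x.
have sb' y : exists x, beta x = y by have [x _ xy] := sb y I; exists x.
have comp (D : compact_abelian_group R) (u : D -> C) : continuous u ->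
    cmeasurable (fun x => h (u x)).
  move=> /measurable_continuous mu.
  exact: (@cmeas_comp _ _ (borel C) _ (borel D) u h mh mu).
rewrite -(density_ae cL FA (comp _ _ ca) mf haf) -(density_ae cL FB (comp _ _ cb) mg hbg).
by rewrite !density_epimorphism.
Qed.

End Densities.

(** * Fejer kernels as lists of words *)

Section Words.
Context (G : groupType) (T : Type).

(* A letter (t, b) stands for t if b holds, and for the inverse of t otherwise. *)
Definition letter_exp (b : bool) : int := if b then 1 else -1.

Definition weval (u : T -> G) (w : seq (T * bool)) : G :=
  (\prod_(c <- w) expgz (u c.1) (letter_exp c.2))%g.

End Words.

(** The weight prescribes exactly [N] factors; shorter words are padded with exponent 0. *)
Lemma partial_isomorphism_word (G1 G2 : groupType) N (S1 : set G1) (S2 : set G2)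
    (phi : G1 -> G2) (w : seq (G1 * bool)) :
  partial_isomorphism N S1 S2 phi -> (size w <= N)%N -> (forall c, c \in w -> S1 c.1) ->
  (weval id w = 1%g) <-> (weval phi w = 1%g).
Proof.
move=> [_ H] wN wS; case: w => [|c0 w'] in wN wS *; first by rewrite /weval !big_nil.
set w := c0 :: w' in wN wS *.
(* The default [c0] is a letter of the word, so the padding positions hold an element of [S1] too;
   this is why the empty word is treated apart. *)
pose g (i : 'I_N) := (nth c0 w i).1.
pose alpha (i : 'I_N) : int := if (i < size w)%N then letter_exp (nth c0 w i).2 else 0.
have E (K : groupType) (v : G1 -> K) :
    (\prod_(i < N) expgz (v (g i)) (alpha i) = weval v w)%g.
  rewrite /weval [RHS](big_nth c0) big_mkord (big_ord_widen_cond N xpredT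
    (fun i => expgz (v (nth c0 w i).1) (letter_exp (nth c0 w i).2)) wN) /= [RHS]big_mkcond /=.
  by apply: eq_bigr => i _; rewrite /alpha; case: ifP.
have gS i : S1 (g i).
  rewrite /g; have [iw|iw] := ltnP i (size w); first by apply: wS; exact: mem_nth.
  by rewrite nth_default//; apply: wS; rewrite /w mem_head.
have aS i : alpha i \in [:: -1; 0; 1].
  by rewrite /alpha; case: ifP => // _; case: (nth c0 w i).2.
by have := H g alpha gS aS; rewrite (E _ id) (E _ phi).
Qed.

(** * Words in characters and the kernels they spell *)

Section CharacterWords.
Context (R : realType) (A : compact_abelian_group R).
Implicit Types chi psi : dual R A.
Local Notation E := (cexp (haar A)).

Lemma modulus_char chi x : modulus (chi x) = 1.
Proof. by rewrite /modulus char_norm. Qed.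

Lemma mulJ_char chi x : chi x * (chi x)^* = 1.
Proof. by rewrite mulJ modulus_char expr1n. Qed.

Lemma charN chi x : chi (- x) = (chi x)^*.
Proof.
have c0 : chi x != 0 by rewrite -normr_eq0 char_norm oner_eq0.
by apply: (mulfI c0); rewrite -charD subrr char0 mulJ_char.
Qed.

Lemma charMn chi x n : chi (x *+ n) = chi x ^+ n.
Proof. by elim: n => [|n IH]; rewrite ?char0// mulrS exprS charD IH. Qed.

Lemma char_sum chi (I : Type) (s : seq I) (F : I -> A) :
  chi (\sum_(i <- s) F i) = \prod_(i <- s) chi (F i).
Proof. by elim: s => [|i s IH]; rewrite ?big_nil ?char0// !big_cons charD IH. Qed.

Lemma dualM chi psi x : (chi * psi)%g x = chi x * psi x.
Proof. by []. Qed.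

Lemma dualV chi x : (chi^-1)%g x = (chi x)^*.
Proof. exact: charN. Qed.

Lemma cexp_orthogonal chi psi : E (fun x => chi x * (psi x)^*) = (chi == psi)%:R.
Proof.
rewrite -[RHS](_ : ((chi * psi^-1)%g == 1%g)%:R = _).
  by rewrite -cexp_character; apply: eq_cexp => x; rewrite dualM dualV.
congr (_%:R); congr nat_of_bool; apply/eqP/eqP => [cp|->]; last exact: mulgV.
apply: dual_ext => x; have := congr1 (fun k : dual R A => k x * psi x) cp.
by rewrite dualM dualV -mulrA [_^* * _]mulrC mulJ_char mulr1 mul1r.
Qed.

Context (T : eqType) (u : T -> dual R A).
Implicit Types w : seq (T * bool).

Lemma weval_nil x : weval u [::] x = 1.
Proof. by rewrite /weval big_nil. Qed.

Lemma weval_cons c w x :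
  weval u (c :: w) x = (if c.2 then u c.1 x else (u c.1 x)^*) * weval u w x.
Proof.
rewrite /weval big_cons dualM; congr (_ * _).
case: (c.2) => /=; first by rewrite expg1.
by rewrite expg1 charN.
Qed.

Lemma weval_cat w1 w2 x : weval u (w1 ++ w2) x = weval u w1 x * weval u w2 x.
Proof.
elim: w1 => [|c w1 IH] /=; first by rewrite weval_nil mul1r.
by rewrite !weval_cons IH mulrA.
Qed.

(** The letters keep their order because the values lie in a commutative group. *)
Definition winv w : seq (T * bool) := [seq (c.1, ~~ c.2) | c <- w].

Lemma weval_inv w x : weval u (winv w) x = (weval u w x)^*.
Proof.
elim: w => [|c w IH]; first by rewrite !weval_nil conjC1.
rewrite /= !weval_cons -/(winv w) IH rmorphM; congr (_ * _) => /=.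
by case: (c.2) => //=; rewrite conjCK.
Qed.

Definition wpow w (z : int) : seq (T * bool) :=
  match z with Posz m => flatten (nseq m w) | Negz m => flatten (nseq m.+1 (winv w)) end.

Lemma weval_flatten (ws : seq (seq (T * bool))) x :
  weval u (flatten ws) x = \prod_(w <- ws) weval u w x.
Proof.
elim: ws => [|w ws IH]; first by rewrite weval_nil big_nil.
by rewrite /= weval_cat IH big_cons.
Qed.

Lemma weval_flatten_nseq w m x : weval u (flatten (nseq m w)) x = weval u w x ^+ m.
Proof. by elim: m => [|m IH]; rewrite ?weval_nil// [LHS]weval_cat IH exprS. Qed.

Lemma weval_pow w z x : weval u (wpow w z) x = weval u w (x *~ z).
Proof.
case: z => m; rewrite /wpow weval_flatten_nseq; first by rewrite charMn.
by rewrite NegzE mulrNz -pmulrn charN charMn weval_inv rmorphXn.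
Qed.

Definition wpoly (W : seq (seq (T * bool))) (x : A) : R[i] := \sum_(w <- W) weval u w x.

Definition wmul (W1 W2 : seq (seq (T * bool))) := [seq a ++ b | a <- W1, b <- W2].

Lemma wpoly_mul W1 W2 x : wpoly (wmul W1 W2) x = wpoly W1 x * wpoly W2 x.
Proof.
rewrite /wpoly big_allpairs_dep mulr_suml; apply: eq_bigr => a _.
by rewrite mulr_sumr; apply: eq_bigr => b _; rewrite weval_cat.
Qed.

Lemma wpoly_inv W x : wpoly (map winv W) x = (wpoly W x)^*.
Proof.
by rewrite /wpoly big_map rmorph_sum; apply: eq_bigr => w _; rewrite weval_inv.
Qed.

Lemma bmeas_wpoly W : @bmeas R _ (borel A) (wpoly W).
Proof.
apply: (@bmeas_sum R _ (borel A) _ W xpredT (fun w => weval u w)) => w.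
exact: bmeas_character.
Qed.

(** This is the mean of [wpoly W], by orthogonality, and the normalizing constant of the kernels. It
    depends only on which words are trivial. *)
Definition relations (W : seq (seq (T * bool))) : nat := count (fun w => weval u w == 1%g) W.

Lemma cexp_wpoly W : E (wpoly W) = (relations W)%:R.
Proof.
rewrite /wpoly (@cexp_sum _ _ _ _ _ W xpredT
  (fun w (x : borel A) => weval u w x)); last first.
  by move=> w; exact: bmeas_character.
under eq_bigr do rewrite cexp_character.
rewrite -natr_sum /relations -sum1_count [in RHS]big_mkcond /=.
by congr (_%:R); apply: eq_bigr => w _; case: ifP.
Qed.

Definition geometric_words (t : T) (N : nat) := [seq nseq i (t, true) | i <- iota 0 N].

Lemma weval_nseq t i x : weval u (nseq i (t, true)) x = u t x ^+ i.
Proof. by elim: i => [|i IH]; rewrite ?weval_nil// [LHS]weval_cons IH exprS. Qed.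

Lemma wpoly_geometric t N x :
  wpoly (geometric_words t N) x = \sum_(i < N) u t x ^+ i.
Proof.
rewrite /wpoly big_map -(big_mkord xpredT (fun i => u t x ^+ i)) /index_iota subn0.
by apply: eq_bigr => i _; rewrite weval_nseq.
Qed.

(* [fejer_words s N] expands [|\prod_(t <- s) \sum_(i < N) t ^ i| ^ 2]. *)
Fixpoint dirichlet_words (s : seq T) (N : nat) :=
  if s is t :: s' then wmul (geometric_words t N) (dirichlet_words s' N) else [:: [::]].

Definition fejer_words s N := wmul (dirichlet_words s N) (map winv (dirichlet_words s N)).

Lemma wpoly_dirichlet s N x :
  wpoly (dirichlet_words s N) x = \prod_(t <- s) \sum_(i < N) u t x ^+ i.
Proof.
elim: s => [|t s IH] /=; first by rewrite /wpoly big_seq1 weval_nil big_nil.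
by rewrite wpoly_mul wpoly_geometric IH big_cons.
Qed.

Lemma wpoly_fejer s N x : wpoly (fejer_words s N) x =
  wpoly (dirichlet_words s N) x * (wpoly (dirichlet_words s N) x)^*.
Proof. by rewrite wpoly_mul wpoly_inv. Qed.

Lemma sqnorm_dirichlet s N :
  sqnorm (haar A) (wpoly (dirichlet_words s N)) = (relations (fejer_words s N))%:R.
Proof.
apply: complexI; rewrite sqnormE rmorph_nat -cexp_wpoly.
by apply: eq_cexp => x; rewrite wpoly_fejer.
Qed.

(** The empty word occurs in the list, so normalization by this count is legitimate. *)
Lemma relations_fejer_gt0 s N : (0 < N)%N -> (0 < relations (fejer_words s N))%N.
Proof.
move=> N0; have nil_mem r : [::] \in dirichlet_words r N.
  elim: r => [|t r IH] /=; first by rewrite mem_head.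
  apply: (allpairs_f cat (x := [::]) _ IH).
  by apply/mapP; exists 0%N => //; rewrite mem_iota.
rewrite -has_count; apply/hasP; exists [::]; last by rewrite /weval big_nil.
apply: (allpairs_f cat (x := [::]) (y := [::]) (nil_mem s)).
exact: (map_f winv (nil_mem s)).
Qed.

Lemma fejer_words_letters s N w c : w \in fejer_words s N -> c \in w -> c.1 \in s.
Proof.
have D r v d : v \in dirichlet_words r N -> d \in v -> d.1 \in r.
  elim: r v => [|t r IH] v /=; first by rewrite inE => /eqP ->.
  case/allpairsP => -[a b] [/= /mapP[i _ ->] br ->]; rewrite mem_cat => /orP[].
    by rewrite mem_nseq => /andP[_ /eqP ->]; rewrite mem_head.
  by move=> db; rewrite inE (IH _ br db) orbT.
case/allpairsP => -[a b] [/= ad /mapP[b' bd ->] ->]; rewrite mem_cat => /orP[].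
  exact: D.
by case/mapP => d db ->; exact: (D _ _ d bd db).
Qed.

(* Discarding the off-diagonal terms of the square of the geometric sum is
   allowed since they are sums of characters, which have nonnegative mean. *)
Lemma relations_fejer_cons t s N :
  (N * relations (fejer_words s N) <= relations (fejer_words (t :: s) N))%N.
Proof.
pose K := fejer_words s N.
pose c i j : seq (T * bool) := nseq i (t, true) ++ winv (nseq j (t, true)).
pose W i j := [seq c i j ++ w | w <- K].
rewrite -(ler_nat (R[i])) natrM -[X in _ <= X]cexp_wpoly.
have -> : E (wpoly (fejer_words (t :: s) N)) =
    \sum_(i < N) \sum_(j < N) (relations (W i j))%:R.
  transitivity (E (fun x => \sum_(i < N) \sum_(j < N) wpoly (W i j) x)).
    apply: eq_cexp => x; rewrite wpoly_fejer /= wpoly_mul wpoly_geometric rmorphM.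
    rewrite mulrACA -wpoly_fejer rmorph_sum big_distrlr mulr_suml /=.
    apply: eq_bigr => i _; rewrite mulr_suml; apply: eq_bigr => j _.
    rewrite /wpoly big_map mulr_sumr; apply: eq_bigr => w _.
    by rewrite /c !weval_cat weval_inv !weval_nseq.
  rewrite (@cexp_sum _ _ _ _ _ _ xpredT (fun i (x : borel A) => _)); last first.
    by move=> i; apply: (@bmeas_sum R _ (borel A) _ _ xpredT) => j; exact: bmeas_wpoly.
  apply: eq_bigr => i _; rewrite (@cexp_sum _ _ _ _ _ _ xpredT (fun j (x : borel A) => _)).
    by apply: eq_bigr => j _; exact: cexp_wpoly.
  by move=> j; exact: bmeas_wpoly.
rewrite -[X in X%:R * _](card_ord N) mulr_natl -sumr_const; apply: ler_sum => i _.
rewrite (bigD1 i)//= -[X in X <= _]addr0 lerD//; last by apply: sumr_ge0.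
rewrite ler_nat /relations /W count_map sub_count// => w /eqP w1.
apply/eqP; apply: dual_ext => x.
by rewrite /c !weval_cat weval_inv w1 mulJ_char mul1r.
Qed.

End CharacterWords.

(** * Approximation by normalized Fejer kernels *)

Section FejerApproximation.
Context (R : realType) (A : compact_abelian_group R).
Implicit Types (chi psi : dual R A) (f g : bfun A).
Local Notation E := (cexp (haar A)).
Local Notation "|| f ||^2" := (sqnorm (haar A) f) (at level 0, f at level 50).

Definition bchar chi : bfun A := BFun (bmeas_character chi).

Lemma bmeas_fourier f chi : @bmeas R _ (borel A) (fun x => f x * (chi x)^*).
Proof. by apply: bmeasM; [exact: bfunP|apply: bmeasJ; exact: bmeas_character]. Qed.

Lemma bconv_char f chi x : bconv f (bchar chi) x = fourier f chi * chi x.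
Proof.
rewrite fourierE -cexpZr; last exact: bmeas_fourier.
by apply: eq_cexp => y /=; rewrite charD charN mulrA mulrAC.
Qed.

Lemma fourier_conv f g chi : fourier (bconv f g) chi = fourier f chi * fourier g chi.
Proof.
have H (h : bfun A) : fourier h chi = bconv h (bchar chi) 0 by rewrite bconv_char char0 mulr1.
rewrite [LHS]H bconvA (_ : bconv g (bchar chi) = bscale (fourier g chi) (bchar chi)).
  by rewrite bconvZr /= -[cexp _ _]/(bconv f (bchar chi) 0) -H mulrC.
by apply: bfun_ext => x; rewrite bconv_char.
Qed.

Lemma fourierD f g chi : fourier (badd f g) chi = fourier f chi + fourier g chi.
Proof.
rewrite !fourierE -cexpD; try exact: bmeas_fourier.
by apply: eq_cexp => x; rewrite mulrDl.
Qed.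

Lemma fourierZ c f chi : fourier (bscale c f) chi = c * fourier f chi.
Proof.
rewrite !fourierE -cexpZ; last exact: bmeas_fourier.
by apply: eq_cexp => x; rewrite mulrA.
Qed.

Lemma modulus_fourier f (a : R) chi : (forall x, modulus (f x) <= a) ->
  modulus (fourier f chi) <= a.
Proof.
move=> fa; apply: modulus_cexp; first exact: bmeas_fourier.
by move=> x; rewrite modulusM modulusJ modulus_char mulr1.
Qed.

(** Cauchy-Schwarz for [f] against its projection [p]: both their inner product and the squared norm
    of [p] equal the sum [S]. *)
Lemma bessel f (s : seq (dual R A)) : uniq s ->
  \sum_(chi <- s) modulus (fourier f chi) ^+ 2 <= || f ||^2.
Proof.
move=> us; set S := \sum_(_ <- _) _.
have S0 : 0 <= S by apply: sumr_ge0 => chi _; exact: sqr_ge0.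
pose p x := \sum_(chi <- s) fourier f chi * chi x.
have bterm chi : @bmeas R _ (borel A) (fun x => fourier f chi * chi x).
  by apply: bmeasM; [exact: bmeas_cst|exact: bmeas_character].
have bp : @bmeas R _ (borel A) p by exact: (bmeas_sum (X := borel A) s xpredT bterm).
have pS (g : borel A -> R[i]) (c : dual R A -> R[i]) : bmeas g ->
    (forall chi, chi \in s -> E (fun x => g x * (chi x)^*) = c chi) ->
    E (fun x => g x * (p x)^*) = \sum_(chi <- s) (fourier f chi)^* * c chi.
  move=> bg gc.
  rewrite (@eq_cexp _ _ _ _ _ (fun x => \sum_(chi <- s) (fourier f chi)^* * (g x * (chi x)^*))).
    have bgc chi : @bmeas R _ (borel A) (fun x => g x * (chi x)^*).
      by apply: bmeasM => //; apply: bmeasJ; exact: bmeas_character.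
    rewrite (@cexp_sum _ _ _ _ _ s xpredT
      (fun chi (x : borel A) => (fourier f chi)^* * (g x * (chi x)^*))).
      rewrite !big_seq; apply: eq_bigr => chi chis; rewrite cexpZ; first by rewrite gc.
      exact: bgc.
    move=> chi; apply: bmeasM; [exact: bmeas_cst|exact: bgc].
  move=> x; rewrite rmorph_sum mulr_sumr; apply: eq_bigr => chi _.
  by rewrite rmorphM mulrCA.
have pE psi : psi \in s -> E (fun x => p x * (psi x)^*) = fourier f psi.
  move=> psis; rewrite (@eq_cexp _ _ (borel A) _ _
    (fun x : borel A => \sum_(chi <- s) fourier f chi * (chi x * (psi x)^*))); last first.
    by move=> x; rewrite mulr_suml; apply: eq_bigr => chi _; rewrite mulrA.
  have bcp chi : @bmeas R _ (borel A) (fun x => chi x * (psi x)^*).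
    by apply: bmeasM; [exact: bmeas_character|apply: bmeasJ; exact: bmeas_character].
  rewrite (@cexp_sum _ _ _ _ _ s xpredT
      (fun chi (x : borel A) => fourier f chi * (chi x * (psi x)^*))); last first.
    by move=> chi; apply: bmeasM; [exact: bmeas_cst|exact: bcp].
  rewrite (bigD1_seq psi)//= big1 ?addr0 => [|chi cp].
    by rewrite cexpZ ?cexp_orthogonal ?eqxx ?mulr1//; exact: bcp.
  by rewrite cexpZ ?cexp_orthogonal ?(negbTE cp) ?mulr0//; exact: bcp.
have SE : \sum_(chi <- s) (fourier f chi)^* * fourier f chi = S%:C.
  by rewrite rmorph_sum; apply: eq_bigr => chi _; rewrite mulrC mulJ.
have fp : E (fun x => f x * (p x)^*) = S%:C.
  by rewrite (pS f (fourier f)) ?SE//; exact: bfunP.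
have pp : || p ||^2 = S.
  by apply: complexI; rewrite sqnormE (pS p (fourier f))// SE.
have := cauchy_schwarz (haar A) (bfunP f) bp; rewrite fp pp modulus_real ger0_norm//.
have [->|S1] := eqVneq S 0; first by rewrite sqnorm_ge0.
by rewrite expr2 ler_pM2r// lt0r S1.
Qed.

(** Bessel bounds the length of any duplicate-free list of large characters, so adding a missing one
    repeatedly must stop. *)
Lemma finite_spectrum f (eta : R) : 0 < eta ->
  exists s : seq (dual R A), forall chi, (chi \in s) = (eta < modulus (fourier f chi)).
Proof.
move=> eta0; pose B := Num.bound (|| f ||^2 / eta ^+ 2).
pose large chi := eta < modulus (fourier f chi).
have bound (s : seq (dual R A)) : uniq s -> all large s -> (size s < B)%N.
  move=> us /allP sL; rewrite -(ltr_nat R).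
  apply: (le_lt_trans _ (archi_boundP _)).
    rewrite ler_pdivlMr ?exprn_gt0// (le_trans _ (bessel f us))//.
    have -> : (size s)%:R * eta ^+ 2 = \sum_(chi <- s) eta ^+ 2.
      elim: (s) => [|c r IH]; first by rewrite big_nil mul0r.
      by rewrite big_cons -IH /= -natr1 mulrDl mul1r addrC.
    rewrite !big_seq; apply: ler_sum => chi /sL /ltW.
    by move=> le_eta; rewrite lerXn2r ?nnegrE ?modulus_ge0 ?(ltW eta0).
  by rewrite divr_ge0 ?sqr_ge0 ?sqnorm_ge0.
suff [s sL] : exists s : seq (dual R A), forall chi, large chi -> chi \in s.
  exists [seq chi <- s | large chi] => chi; rewrite mem_filter -/(large chi).
  by have [/sL ->|] := boolP (large chi).
have ext m (s : seq (dual R A)) : uniq s -> all large s -> (B <= size s + m)%N ->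
    exists s : seq (dual R A), forall chi, large chi -> chi \in s.
  elim: m s => [|m IH] s us sL.
    by rewrite addn0 leqNgt bound.
  move=> Bs; have [H|H] := pselect (forall chi, large chi -> chi \in s); first by exists s.
  have [chi [chiL chis]] : exists chi, large chi /\ chi \notin s.
    apply: contrapT => K; apply: H => chi chiL; apply: contrapT => /negP chis.
    by apply: K; exists chi.
  by apply: (IH (chi :: s)); rewrite /= ?chis ?chiL// addSnnS.
exact: (ext B [::]).
Qed.

Context (T : eqType) (u : T -> dual R A).
Implicit Types (s : seq T) (N : nat).

(** The kernel is the squared modulus of the Dirichlet product, so its mean dominates all its
    Fourier coefficients. *)
Lemma fejer_le s N chi :
  modulus (E (fun x => wpoly u (fejer_words s N) x * (chi x)^*)) <=
  (relations u (fejer_words s N))%:R.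
Proof.
set r := relations _ _; pose P := wpoly u (dirichlet_words s N).
have bP : @bmeas R _ (borel A) P by exact: bmeas_wpoly.
have bPc : @bmeas R _ (borel A) (fun x => P x * chi x).
  by apply: bmeasM => //; exact: bmeas_character.
rewrite -(ler_pXn2r (ltn0Sn 1)) ?nnegrE ?modulus_ge0 ?ler0n//.
rewrite (@eq_cexp _ _ (borel A) _ _ (fun x => P x * (P x * chi x)^*)); last first.
  by move=> x; rewrite wpoly_fejer rmorphM mulrA.
rewrite (le_trans (cauchy_schwarz _ bP bPc))// expr2 -/P.
have Pr : || P ||^2 = r%:R by exact: sqnorm_dirichlet.
rewrite Pr ler_wpM2l// -Pr; apply: sqnorm_mono => // x.
by rewrite modulusM modulus_char mulr1.
Qed.

(** Multiplied by [1 - u t], the geometric factor of [t] telescopes to modulus at most 2, leaving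
    the product [Q] of the other factors. Cauchy-Schwarz and [relations_fejer_cons] then save a
    factor [sqrt N]; the length [N] is the square [M ^ 2] so that this saving is [M]. *)
Lemma fejer_near1 s M t : (0 < M)%N -> t \in s ->
  M%:R * modulus (E (fun x => wpoly u (fejer_words s (M ^ 2)) x * (1 - u t x)^*)) <=
  2 * (relations u (fejer_words s (M ^ 2)))%:R.
Proof.
move=> M0 ts; set N := (M ^ 2)%N; set r := relations _ _; set X := modulus _.
pose P := wpoly u (dirichlet_words s N).
pose Q := wpoly u (dirichlet_words (rem t s) N).
have bP : @bmeas R _ (borel A) P by exact: bmeas_wpoly.
have bQ : @bmeas R _ (borel A) Q by exact: bmeas_wpoly.
have bPz : @bmeas R _ (borel A) (fun x => P x * (1 - u t x)).
  apply: bmeasM => //; apply: bmeasB; [exact: bmeas_cst|exact: bmeas_character].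
have PQ x : P x = (\sum_(i < N) u t x ^+ i) * Q x.
  by rewrite /P /Q !wpoly_dirichlet (perm_big _ (perm_to_rem ts)) big_cons.
have rE : r = relations u (fejer_words (t :: rem t s) N).
  apply/eqP; rewrite -(eqr_nat R) -!sqnorm_dirichlet; apply/eqP; congr sqnorm.
  apply/funext => x; rewrite -/(P x) PQ [RHS]wpoly_dirichlet big_cons.
  by rewrite /Q wpoly_dirichlet.
have X2 : X ^+ 2 <= r%:R * (2 ^+ 2 * || Q ||^2).
  rewrite /X (@eq_cexp _ _ (borel A) _ _ (fun x => P x * (P x * (1 - u t x))^*)); last first.
    by move=> x; rewrite wpoly_fejer -/(P x) rmorphM mulrA.
  rewrite (le_trans (cauchy_schwarz _ bP bPz))// sqnorm_dirichlet -/r ler_wpM2l//.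
  have m2 : modulus (2 : R[i]) = 2 by rewrite -[2](rmorph_nat (real_complex R)) modulus_real ger0_norm.
  rewrite -[X in X ^+ 2]m2 -sqnormZ//; apply: sqnorm_mono => //.
    by apply: bmeasM => //; exact: bmeas_cst.
  move=> x; rewrite PQ mulrAC [leLHS]modulusM [leRHS]modulusM ler_wpM2r ?modulus_ge0//.
  rewrite mulrC -opprB mulNr -subrX1 modulusN (le_trans (modulusB _ _))//.
  rewrite modulus1 m2 -lerBrDr (_ : 2 - 1 = 1 :> R); last by ring.
  by elim: (N) => [|i IH]; rewrite ?modulus1// exprS modulusM modulus_char mul1r.
have rr : N%:R * || Q ||^2 <= r%:R.
  by rewrite sqnorm_dirichlet -natrM ler_nat rE; exact: relations_fejer_cons.
rewrite -(ler_pXn2r (ltn0Sn 1)) ?nnegrE ?mulr_ge0 ?modulus_ge0 ?ler0n//.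
rewrite exprMn -natrX (@le_trans _ _ (N%:R * (r%:R * (2 ^+ 2 * || Q ||^2))))//.
  by rewrite ler_wpM2l.
rewrite (_ : _ * _ = (2 ^+ 2 * r%:R) * (N%:R * || Q ||^2)); last by ring.
by rewrite exprMn [r%:R ^+ 2]expr2 [leRHS]mulrA ler_wpM2l// mulr_ge0.
Qed.

Definition bwpoly (W : seq (seq (T * bool))) : bfun A := BFun (bmeas_wpoly u W).

(** For Fejer words this is convolution with a nonnegative kernel of mean 1. *)
Definition fapprox (W : seq (seq (T * bool))) f : bfun A :=
  bscale ((relations u W)%:R^-1)%:C (bconv f (bwpoly W)).

Lemma fapproxE W f x : fapprox W f x =
  \sum_(w <- W) ((relations u W)%:R^-1)%:C * fourier f (weval u w) * weval u w x.
Proof.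
under eq_bigr do rewrite -mulrA; rewrite -mulr_sumr /fapprox /=; congr (_ * _).
rewrite (@eq_cexp _ _ (borel A) _ _ (fun y =>
  \sum_(w <- W) f y * (weval u w y)^* * weval u w x)); last first.
  move=> y; rewrite /wpoly mulr_sumr; apply: eq_bigr => w _.
  by rewrite charD charN mulrCA mulrC.
rewrite (@cexp_sum _ _ _ _ _ W xpredT (fun w (y : borel A) =>
  f y * (weval u w y)^* * weval u w x)).
  by apply: eq_bigr => w _; rewrite cexpZr//; exact: bmeas_fourier.
by move=> w; apply: bmeasM; [exact: bmeas_fourier|exact: bmeas_cst].
Qed.

Lemma modulus_fapprox s N f (a : R) x : (0 < N)%N -> (forall x, modulus (f x) <= a) ->
  modulus (fapprox (fejer_words s N) f x) <= a.
Proof.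
move=> N0 fa; have r0 : 0 < (relations u (fejer_words s N))%:R :> R.
  by rewrite ltr0n relations_fejer_gt0.
have a0 : 0 <= a by rewrite (le_trans _ (fa 0))// modulus_ge0.
rewrite /fapprox /= modulusM modulus_real ger0_norm ?invr_ge0 ?ler0n//.
rewrite ler_pdivrMl// mulrC.
set r := relations _ _ in r0 *; pose P := wpoly u (dirichlet_words s N).
pose h := BFun (bmeas_wpoly u (dirichlet_words s N)).
have bPx : @bmeas R _ (borel A) (fun y => P (x - y)) by exact: (bfun_comp h (measurable_reflect x)).
have bfP : @bmeas R _ (borel A) (fun y => f y * P (x - y)).
  by apply: bmeasM => //; exact: bfunP.
have Px : sqnorm (haar A) (fun y => P (x - y)) = r%:R.
  rewrite /r -sqnorm_dirichlet; apply: complexI; rewrite !sqnormE.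
  have bPP : @bmeas R _ (borel A) (fun y => P y * (P y)^*).
    by apply: bmeasM; [exact: bmeas_wpoly|apply: bmeasJ; exact: bmeas_wpoly].
  exact: (cexp_reflect (BFun bPP) x).
rewrite -(ler_pXn2r (ltn0Sn 1)) ?nnegrE ?modulus_ge0 ?mulr_ge0 ?ler0n//.
rewrite (@eq_cexp _ _ (borel A) _ _ (fun y => f y * P (x - y) * (P (x - y))^*)); last first.
  by move=> y; rewrite wpoly_fejer mulrA.
rewrite (le_trans (cauchy_schwarz _ bfP bPx))// Px exprMn [r%:R ^+ 2]expr2 mulrA ler_wpM2r//.
have aE : modulus (a%:C : R[i]) = a by rewrite modulus_real ger0_norm.
rewrite -Px -[X in X ^+ 2]aE -sqnormZ//; apply: sqnorm_mono => //.
  by apply: bmeasM => //; exact: bmeas_cst.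
by move=> y; rewrite !modulusM aE ler_wpM2r ?modulus_ge0.
Qed.

Lemma fourier_fapprox W f chi : fourier (fapprox W f) chi =
  ((relations u W)%:R^-1)%:C * (fourier f chi * E (fun x => wpoly u W x * (chi x)^*)).
Proof. by rewrite fourierZ fourier_conv. Qed.

(** The coefficient of [f] gets multiplied by 1 minus the normalized kernel coefficient. That factor
    is at most 2 always, and at most [2 / M] at the letters of the kernel, which include every
    character where [f] exceeds [eta]. *)
Lemma fourier_fapprox_diff s M f (a eta : R) : (0 < M)%N ->
  (forall x, modulus (f x) <= a) ->
  (forall chi, eta < modulus (fourier f chi) -> exists2 t, t \in s & chi = u t) ->
  forall chi, modulus (fourier (badd f (bscale (-1) (fapprox (fejer_words s (M ^ 2)) f))) chi)
    <= 2 * Num.max eta (a / M%:R).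
Proof.
move=> M0 fa spec chi.
have N0 : (0 < M ^ 2)%N by rewrite expn_gt0 M0.
have r0 : 0 < (relations u (fejer_words s (M ^ 2)))%:R :> R.
  by rewrite ltr0n relations_fejer_gt0.
rewrite fourierD fourierZ fourier_fapprox mulN1r mulrCA -[X in X - _]mulr1 -mulrBr modulusM.
set W := fejer_words s (M ^ 2) in r0 *; set r := relations u W in r0 *.
set K := E _.
have Kr : modulus K <= r%:R by exact: fejer_le.
have rV : modulus ((r%:R^-1)%:C : R[i]) = r%:R^-1.
  by rewrite modulus_real ger0_norm// invr_ge0 ler0n.
have [le_eta|gt_eta] := leP (modulus (fourier f chi)) eta.
  rewrite mulrC; apply: ler_pM; rewrite ?modulus_ge0 ?le_max ?le_eta//.
  rewrite (le_trans (modulusB _ _))// modulus1 modulusM rV (_ : 2 = 1 + 1 :> R)//.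
  by rewrite lerD2l ler_pdivrMl// mulr1.
have [t ts chit] := spec _ gt_eta.
rewrite (@le_trans _ _ (a * (2 / M%:R)))//; last first.
  by rewrite mulrCA ler_pM2l// le_max lexx orbT.
apply: ler_pM; rewrite ?modulus_ge0 ?(modulus_fourier _ fa)//.
have -> : 1 - (r%:R^-1)%:C * K =
    (r%:R^-1)%:C * E (fun x => wpoly u W x * (1 - u t x)^*).
  have bK : @bmeas R _ (borel A) (wpoly u W) by exact: bmeas_wpoly.
  rewrite (@eq_cexp _ _ (borel A) _ _ (fun x => wpoly u W x - wpoly u W x * (chi x)^*)).
    rewrite cexpB//; last by apply: bmeasM => //; apply: bmeasJ; exact: bmeas_character.
    rewrite cexp_wpoly -/r -/K mulrBr; congr (_ - _).
    by rewrite -(rmorph_nat (real_complex R)) -rmorphM mulVf ?rmorph1// lt0r_neq0.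
  by move=> x; rewrite chit rmorphB rmorph1 mulrBr mulr1.
rewrite modulusM rV ler_pdivrMl// mulrA ler_pdivlMr ?ltr0n//.
by rewrite mulrC [leRHS]mulrC; exact: fejer_near1.
Qed.

End FejerApproximation.

(** * Comparison of densities under a partial isomorphism *)

Section Comparison.
Context (R : realType).

(** Telescoping over the factors; [1 <= b] makes up for the factor replaced by the difference. *)
Lemma prod_close (I : Type) (s : seq I) (x y : I -> R[i]) (b d : R) :
  1 <= b -> 0 <= d -> (forall i, modulus (x i) <= b) -> (forall i, modulus (y i) <= b) ->
  (forall i, modulus (x i - y i) <= d) ->
  modulus (\prod_(i <- s) x i - \prod_(i <- s) y i) <= (size s)%:R * (b ^+ size s * d).
Proof.
move=> b1 d0 xb yb xyd; have b0 : 0 <= b by rewrite (le_trans _ b1).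
have yP r : modulus (\prod_(i <- r) y i) <= b ^+ size r.
  elim: r => [|i r IH]; first by rewrite big_nil modulus1.
  by rewrite big_cons modulusM exprS ler_pM ?modulus_ge0.
elim: s => [|i s IH]; first by rewrite !big_nil subrr modulus0 mul0r.
rewrite !big_cons /=; set X := \prod_(_ <- _) _; set Y := \prod_(_ <- _) _.
rewrite (_ : x i * X - y i * Y = x i * (X - Y) + (x i - y i) * Y); last by ring.
rewrite [leRHS](_ : _ = (size s)%:R * (b ^+ (size s).+1 * d) + b ^+ (size s).+1 * d).
  rewrite (le_trans (modulusD _ _))// lerD// modulusM.
    rewrite (@le_trans _ _ (b * ((size s)%:R * (b ^+ size s * d))))//.
      by rewrite ler_pM ?modulus_ge0.
    by rewrite mulrCA ler_wpM2l// exprS mulrA.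
  rewrite mulrC exprS; apply: ler_pM; rewrite ?modulus_ge0//.
  by rewrite (le_trans (yP s))// ler_peMl// exprn_ge0.
by rewrite -natr1 mulrDl mul1r.
Qed.

Section TrigonometricDensity.
Context (A : compact_abelian_group R) (T : eqType) (u : T -> dual R A).
Context (k n : nat) (L : 'M[int]_(k, n)) (W : seq (seq (T * bool))).

(** After choosing the word [q i] in the [i]-th factor of the configuration, this is the word of the
    character that acts on the variable [x_j]. *)
Definition form_word (q : {ffun 'I_k -> 'I_(size W)}) (j : 'I_n) : seq (T * bool) :=
  flatten [seq wpow (nth [::] W (q i)) (L i j) | i <- enum 'I_k].

Definition approx_coef (f : bfun A) (p : 'I_(size W)) : R[i] :=
  ((relations u W)%:R^-1)%:C * fourier f (weval u (nth [::] W p)).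

(** The product over the forms is expanded into characters of the separate variables, and
    orthogonality is applied in each variable. What is left involves only coefficients and
    relations, the data that a partial isomorphism controls. *)
Lemma density_fapprox (f : bfun A) : density L (fapprox u W f) =
  \sum_(q : {ffun 'I_k -> 'I_(size W)})
    (\prod_(i < k) approx_coef f (q i)) * \prod_(j < n) (weval u (form_word q j) == 1%g)%:R.
Proof.
rewrite /density multi_densityE.
pose chi q (t : n.-tuple A) := \prod_(j < n) weval u (form_word q j) (tnth t j).
have conf t : configuration L (fun=> fapprox u W f) t =
    \sum_(q : {ffun 'I_k -> 'I_(size W)}) (\prod_(i < k) approx_coef f (q i)) * chi q t.
  transitivity (\prod_(i < k) \sum_(p < size W) approx_coef f p *
      weval u (nth [::] W p) (linear_form_eval L i t)).
    by apply: eq_bigr => i _; rewrite fapproxE (big_nth [::]) big_mkord.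
  rewrite bigA_distr_bigA /=; apply: eq_bigr => q _; rewrite big_split /=; congr (_ * _).
  transitivity (\prod_(i < k) \prod_(j < n)
      weval u (wpow (nth [::] W (q i)) (L i j)) (tnth t j)).
    apply: eq_bigr => i _; rewrite /linear_form_eval char_sum.
    by apply: eq_bigr => j _; rewrite weval_pow.
  rewrite exchange_big /=; apply: eq_bigr => j _.
  by rewrite /form_word weval_flatten big_map big_enum.
have mchi q : tmeas (fun (_ : borel A) => chi q).
  apply: tmeas_prod => j; apply: tmeas_funA; first exact: (bmeas_character _).1.
  exact: tmeasA_tnth.
have chi1 q t : modulus (chi q t) <= 1.
  rewrite /chi; elim/big_ind: _ => [|a b a1 b1|j _]; first by rewrite modulus1.
    by rewrite modulusM -[1]mul1r ler_pM// modulus_ge0.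
  by rewrite modulus_char.
pose c (q : {ffun 'I_k -> 'I_(size W)}) := \prod_(i < k) approx_coef f (q i).
pose M := \sum_(q : {ffun 'I_k -> 'I_(size W)}) modulus (c q).
transitivity (haar_expectation_n (fun t : n.-tuple A =>
    \sum_(q <- index_enum {ffun 'I_k -> 'I_(size W)}) c q * chi q t)).
  by congr haar_expectation_n; apply/funext => t; rewrite conf.
rewrite (En_sum (M := M) (F := fun q (_ : borel A) t => c q * chi q t) _ _ _ (0 : A)).
- apply: eq_bigr => q _; rewrite -En_characters.
  exact: (EnZ (F := fun (_ : borel A) => chi q) (M := 1) _ (mchi q) (fun _ => chi1 q) (0 : A)).
- by move=> q; apply: tmeasM => //; exact: tmeas_cst.
- move=> q y t; rewrite modulusM /M (bigD1 q)//= -[leLHS]addr0 lerD//.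
    by rewrite ler_piMr ?modulus_ge0.
  by apply: sumr_ge0 => q' _; exact: modulus_ge0.
Qed.

End TrigonometricDensity.

(** * Transfer along a partial isomorphism *)

Section Transfer.
Context (A B : compact_abelian_group R) (f : bfun A) (g : bfun B).
Context (delta : R) (S1 : set (dual R A)) (S2 : set (dual R B)) (phi : dual R A -> dual R B).
Hypothesis iso : eps_isomorphism delta (fourier f) (fourier g) S1 S2 phi.
Context (s : seq (dual R A)) (sS : forall chi, chi \in s -> S1 chi).
Let letters_in (w : seq (dual R A * bool)) := forall c, c \in w -> c.1 \in s.
Let wlen := `|Num.ceil delta^-1|%N.

Lemma transfer_relation w : letters_in w -> (size w <= wlen)%N ->
  (weval id w == 1%g) = (weval phi w == 1%g).
Proof.
move=> ws wl; have [pi _ _ _] := iso.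
have H := partial_isomorphism_word pi wl (fun c cw => sS (ws c cw)).
by apply/eqP/eqP => /H.
Qed.

(** Equality with a single letter becomes a relation one letter longer; hence the strict length
    bound in [transfer_fourier]. *)
Lemma weval_rcons_eq1 (D : compact_abelian_group R) (v : dual R A -> dual R D) w chi :
  (weval v (rcons w (chi, false)) = 1%g) <-> weval v w = v chi.
Proof.
rewrite -cats1; split=> H; apply: dual_ext => x.
  have := congr1 (fun k : dual R D => k x * v chi x) H.
  rewrite weval_cat weval_cons weval_nil mulr1 -mulrA [_^* * _]mulrC mulJ_char mulr1.
  by rewrite mul1r.
by rewrite weval_cat weval_cons weval_nil mulr1 /= H mulJ_char.
Qed.

(* A word value lies in [S1] iff the corresponding value lies in [S2]; outside
   both coefficients are small. *)
Lemma transfer_fourier w : letters_in w -> (size w < wlen)%N ->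
  modulus (fourier f (weval id w) - fourier g (weval phi w)) <= delta + delta.
Proof.
move=> ws wl; have [pi s1 s2 fg] := iso; have [[fS _ surj] _] := pi.
have rel sigma : S1 sigma -> weval id w = sigma <-> weval phi w = phi sigma.
  move=> Ss; have H := @partial_isomorphism_word _ _ _ _ _ _ (rcons w (sigma, false)) pi.
  rewrite -(weval_rcons_eq1 id) -(weval_rcons_eq1 phi); apply: H.
    by rewrite size_rcons.
  by move=> c; rewrite mem_rcons inE => /orP[/eqP ->//|/ws]; exact: sS.
have small (D : compact_abelian_group R) (h : bfun D) (S : set (dual R D)) chi :
    supp delta (fourier h) `<=` S -> ~ S chi -> modulus (fourier h chi) <= delta.
  move=> sS' nS; rewrite leNgt; apply/negP => lt; apply: nS; apply: sS'.
  by rewrite /supp/= normE ltcR.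
have d0 : 0 <= delta.
  have [S1w|nS1] := pselect (S1 (weval id w)).
    by have := fg _ S1w; rewrite modulus_le; apply: le_trans; exact: modulus_ge0.
  by apply: le_trans (small _ _ _ _ s1 nS1); exact: modulus_ge0.
have [S1w|nS1] := pselect (S1 (weval id w)).
  rewrite ((rel _ S1w).1 erefl) (@le_trans _ _ delta) ?lerDl//.
  by rewrite -modulus_le; exact: fg.
(* If the value were [phi sigma] with [sigma] in [S1], the relation would pull back to
   [weval id w = sigma]. *)
have nS2 : ~ S2 (weval phi w).
  move=> /surj[sigma Ss phis]; apply: nS1; rewrite ((rel _ Ss).2 _)//.
rewrite (le_trans (modulusB _ _))// lerD//.
  exact: small nS1.
exact: small nS2.
Qed.

End Transfer.

(** The coefficients of [chi] and of its preimage differ by at most [delta <= eta]. A kernel built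
    on the spectrum of [f] above [eta] therefore covers, through [phi], that of [g] above
    [eta + eta]. *)
Lemma large_spectrum_transfer (A B : compact_abelian_group R) (f : bfun A) (g : bfun B)
    (delta eta : R) S1 S2 (phi : dual R A -> dual R B) :
  eps_isomorphism delta (fourier f) (fourier g) S1 S2 phi -> 0 <= eta -> delta <= eta ->
  forall chi, eta + eta < modulus (fourier g chi) ->
  exists2 sigma, eta < modulus (fourier f sigma) & chi = phi sigma.
Proof.
move=> [[[_ _ surj] _] s1 s2 fg] eta0 de chi gchi.
have d0 : delta < modulus (fourier g chi).
  by apply: le_lt_trans gchi; rewrite (le_trans de)// lerDl.
have /surj[sigma Ss phis] : S2 chi by apply: s2; rewrite /supp/= normE ltcR.
exists sigma => //; have := fg _ Ss; rewrite modulus_le phis => fgs.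
have : modulus (fourier g chi) <= modulus (fourier f sigma) + delta.
  rewrite (_ : fourier g chi = fourier f sigma - (fourier f sigma - fourier g chi)); last by ring.
  by rewrite (le_trans (modulusB _ _))// lerD.
lra.
Qed.

End Comparison.

(** * Continuity of the density *)

Section Continuity.
Context (R : realType).

(** Complexity and the convolution algebra work with functions bounded everywhere; [f] is set to 0
    where the bound fails. *)
Lemma truncate (A : compact_abelian_group R) (a : R) (f : A -> R[i]) :
  0 <= a -> Linfty_ball a f ->
  exists h : bfun A, (forall x, modulus (h x) <= a) /\ {ae haar A, forall x, f x = h x}.
Proof.
move=> a0 [mf fa]; pose D : set (borel A) := [set x | modulus (f x) <= a].
have mD : measurable D.
  have mN : measurable_fun setT (fun x : borel A => complex.Re (f x) ^+ 2 + complex.Im (f x) ^+ 2).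
    by apply: measurable_funD; apply: measurable_funX; [exact: mf.1|exact: mf.2].
  have := mN measurableT _ (measurable_itv `]-oo, (a ^+ 2)]); rewrite setTI.
  congr measurable; apply/seteqP; split=> x /=; rewrite in_itv/= -sqr_modulus;
    by rewrite ler_pXn2r ?nnegrE ?modulus_ge0.
have bh : @bmeas R _ (borel A) (fun x => f x * cindic D x).
  split; first exact: (@cmeasM _ _ (borel A) _ _ mf (bmeas_cindic mD).1).
  exists a => x; rewrite modulusM /cindic modulus_real indicE.
  case: (boolP (x \in D)) => [|_]; last by rewrite normr0 mulr0.
  by rewrite inE normr1 mulr1.
exists (BFun bh); split=> [x|] /=.
  rewrite modulusM /cindic modulus_real indicE.
  case: (boolP (x \in D)) => [|_]; last by rewrite normr0 mulr0.
  by rewrite inE normr1 mulr1.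
move: fa => [N [mN N0 sub]]; exists N; split=> // x nfx; apply: sub => fx; apply: nfx => /=.
by rewrite /cindic indicE mem_set ?mulr1//; rewrite /D/= -modulus_le.
Qed.

Lemma ae_eq_fourier (A : compact_abelian_group R) (f g : A -> R[i]) :
  cmeasurable f -> cmeasurable g -> {ae haar A, forall x, f x = g x} ->
  fourier f = fourier g.
Proof.
move=> mf mg [N [mN N0 sub]]; apply/funext => chi.
have mc : @cmeas R _ (borel A) (fun x => (chi x)^*) by exact: cmeasJ (bmeas_character chi).1.
apply: ae_eq_cexp; [exact: cmeasM mf mc|exact: cmeasM mg mc|].
by exists N; split=> // x nfx; apply: sub => fx; apply: nfx; rewrite /= fx.
Qed.

Lemma fun_dist_lt (A B : compact_abelian_group R) (f : bfun A) (g : bfun B) (a delta : R) :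
  0 < a -> (forall x, modulus (f x) <= a) -> (forall x, modulus (g x) <= a) ->
  fun_dist f g < delta ->
  exists d, [/\ 0 < d, d < delta & exists S1 S2 phi,
    eps_isomorphism d (fourier f) (fourier g) S1 S2 phi].
Proof.
move=> a0 fa ga; rewrite /fun_dist /dist_hat; set S := (X in inf X) => fg.
have Sinf : has_inf S.
  split; last by exists 0 => e [/ltW].
  (* At [eps = a] both supports are empty, so the empty map qualifies. This makes the set nonempty,
     so that its infimum is approached by actual elements. *)
  exists a; split=> //; exists set0, set0, (fun=> 1%g); split.
  - split; first by split=> [x []|x y|x []]; rewrite ?inE.
    move=> h alpha hS _; case: `|_|%N h alpha hS => [|m] h alpha hS.
      by rewrite !big_ord0.
    by have := hS ord0.
  - by move=> chi; rewrite /supp/= normE ltcR ltNge (modulus_fourier _ fa).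
  - by move=> chi; rewrite /supp/= normE ltcR ltNge (modulus_fourier _ ga).
  - by [].
have d0 : 0 < delta - inf S by rewrite subr_gt0.
have [d [d_gt0 dS] d_lt] := inf_adherent d0 Sinf.
by exists d; split=> //; move: d_lt; rewrite addrC subrK.
Qed.

Section Approximation.
Context (A : compact_abelian_group R) (k n : nat) (L : 'M[int]_(k, n)).
Context (eps delta a : R) (a0 : 0 < a) (delta0 : 0 < delta).
Hypothesis complexity : forall f : 'I_k -> A -> R[i],
  (forall i, cmeasurable (f i)) -> (forall i x, `|f i x| <= 1) ->
  (exists j, U2norm (f j) <= delta) -> `|multi_density L f| <= eps%:C.

(** Divided by [a + a], the error is bounded by 1 and its coefficients by [delta ^+ 2], as
    [U2norm_le] requires; the factor 2 of [fourier_fapprox_diff] cancels against [a + a]. *)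
Lemma density_approximation (T : eqType) (u : T -> dual R A) (s : seq T) (M : nat)
    (f : bfun A) : (forall x, modulus (f x) <= a) -> (0 < M)%N -> M%:R^-1 <= delta ^+ 2 ->
  (forall chi, a * delta ^+ 2 < modulus (fourier f chi) -> exists2 t, t \in s & chi = u t) ->
  modulus (density L f - density L (fapprox u (fejer_words s (M ^ 2)) f)) <=
    k%:R * ((a + a) ^+ k * eps).
Proof.
move=> fa M0 Md spec; set h := fapprox u _ f.
have ha x : modulus (h x) <= a by apply: modulus_fapprox => //; rewrite expn_gt0 M0.
have aa0 : 0 < a + a by rewrite addr_gt0.
apply: (density_U2 complexity a0) => //; [exact: (bfunP f).1|exact: (bfunP h).1|].
pose H := bscale ((a + a)^-1)%:C (badd f (bscale (-1) h)).
rewrite (_ : (fun x => _) = H); last by apply/funext => x; rewrite /= mulN1r.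
have aV : modulus (((a + a)^-1)%:C : R[i]) = (a + a)^-1.
  by rewrite modulus_real ger0_norm// invr_ge0 ltW.
apply: U2norm_le => // [x|chi].
  have -> : H x = ((a + a)^-1)%:C * (f x - h x) by rewrite -mulN1r.
  rewrite modulusM aV ler_pdivrMl// mulr1; apply: le_trans (modulusB _ _) _.
  exact: lerD (fa x) (ha x).
rewrite fourierZ modulusM aV ler_pdivrMl//.
rewrite (le_trans (fourier_fapprox_diff M0 fa spec chi))//.
rewrite (_ : a + a = 2 * a); last by ring.
by rewrite -mulrA ler_pM2l// ge_max lexx ler_pM2l.
Qed.

End Approximation.

(** Both densities are sums over the same choices [q]. The relation indicators agree, and so do the
    normalizing counts; these are at least 1, so coefficients stay bounded by [a] and differ by at
    most [d + d]. Each choice then costs one telescoping. *)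
Lemma density_fapprox_close (A B : compact_abelian_group R) (k n : nat)
    (L : 'M[int]_(k, n)) (f : bfun A) (g : bfun B) (a d : R) (s : seq (dual R A))
    (N : nat) S1 S2 (phi : dual R A -> dual R B) (W := fejer_words s N) :
  (0 < N)%N -> 1 <= a -> (forall x, modulus (f x) <= a) -> (forall x, modulus (g x) <= a) ->
  0 < d -> eps_isomorphism d (fourier f) (fourier g) S1 S2 phi ->
  (forall chi, chi \in s -> S1 chi) ->
  (forall w, w \in W -> (size w < `|Num.ceil d^-1|)%N) ->
  (forall q j, (size (@form_word _ k n L W q j) <= `|Num.ceil d^-1|)%N) ->
  modulus (density L (fapprox id W f) - density L (fapprox phi W g)) <=
    #|{ffun 'I_k -> 'I_(size W)}|%:R * (k%:R * (a ^+ k * (d + d))).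
Proof.
move=> N0 a1 fa ga d0 iso sS Wlen formlen.
have a0 : 0 <= a by rewrite (le_trans _ a1).
have Wl w : w \in W -> forall c, c \in w -> c.1 \in s.
  by move=> wW c; exact: fejer_words_letters wW.
have relW : relations phi W = relations id W.
  apply: eq_in_count => w wW; rewrite -(transfer_relation iso sS (Wl w wW))//.
  exact: ltnW (Wlen w wW).
have r1 : 1 <= (relations id W)%:R :> R by rewrite ler1n relations_fejer_gt0.
have r0 : 0 < (relations id W)%:R :> R by rewrite (lt_le_trans _ r1).
have rV : modulus (((relations id W)%:R^-1)%:C : R[i]) = (relations id W)%:R^-1.
  by rewrite modulus_real ger0_norm// invr_ge0 ltW.
have pW (p : 'I_(size W)) : nth [::] W p \in W by exact: mem_nth.
have coef (D : compact_abelian_group R) (h : bfun D) (u : dual R A -> dual R D)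
      (p : 'I_(size W)) :
    relations u W = relations id W -> (forall x, modulus (h x) <= a) ->
    modulus (approx_coef u h p : R[i]) <= a.
  move=> ru ha; rewrite /approx_coef ru modulusM rV ler_pdivrMl//.
  by rewrite (le_trans (modulus_fourier _ ha))// ler_peMl.
have close (p : 'I_(size W)) : modulus (approx_coef id f p - approx_coef phi g p : R[i]) <= d + d.
  rewrite /approx_coef relW -mulrBr modulusM rV ler_pdivrMl//.
  rewrite (le_trans (transfer_fourier iso sS (Wl _ (pW p)) (Wlen _ (pW p))))//.
  by rewrite ler_peMl// addr_ge0// ltW.
rewrite !density_fapprox -sumrB.
have -> : #|{ffun 'I_k -> 'I_(size W)}|%:R * (k%:R * (a ^+ k * (d + d))) =
    \sum_(q : {ffun 'I_k -> 'I_(size W)}) k%:R * (a ^+ k * (d + d)).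
  by rewrite sumr_const mulr_natl.
elim/big_ind2: _ => [|x1 x2 y1 y2 h1 h2|q _].
- by rewrite modulus0.
- by rewrite (le_trans (modulusD _ _))// lerD.
have -> : \prod_(j < n) (weval phi (form_word L q j) == 1%g)%:R =
    \prod_(j < n) (weval id (form_word L q j) == 1%g)%:R :> R[i].
  apply: eq_bigr => j _; rewrite -(transfer_relation iso sS _ (formlen q j))//.
  move=> c /flattenP[w /mapP[i _ ->]].
  have powl z (v : seq (dual R A * bool)) : (forall c, c \in v -> c.1 \in s) ->
      c \in wpow v z -> c.1 \in s.
    move=> vs; case: z => m /flattenP[v']; rewrite mem_nseq => /andP[_ /eqP ->].
      exact: vs.
    by case/mapP => c' /vs c's ->.
  exact: powl (Wl _ (pW _)).
rewrite -mulrBl modulusM -[leRHS]mulr1; apply: ler_pM; rewrite ?modulus_ge0//.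
  have -> : k%:R * (a ^+ k * (d + d)) = (size (index_enum 'I_k))%:R *
      (a ^+ size (index_enum 'I_k) * (d + d)).
    by rewrite (_ : size _ = k)// -[RHS]card_ord cardT enumT.
  apply: prod_close => // [|i|i]; [|exact: coef|exact: coef].
  by rewrite addr_ge0// ltW.
elim/big_ind: _ => [|x y x1 y1|j _]; first by rewrite modulus1.
  by rewrite modulusM -[1]mul1r ler_pM ?modulus_ge0.
by case: (_ == _); rewrite ?modulus1 ?modulus0.
Qed.

Lemma density_continuous (k n : nat) (L : 'M[int]_(k, n))
    (F : compact_abelian_group R -> Prop) (a : R) (A : compact_abelian_group R)
    (f : bfun A) : true_complexity_at_most_1 L F -> 0 < a -> F A ->
  (forall x, modulus (f x) <= a) -> forall eps : R, 0 < eps ->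
  exists2 delta : R, 0 < delta & forall (B : compact_abelian_group R) (g : bfun B) d
      S1 S2 phi, F B -> (forall x, modulus (g x) <= a) -> 0 < d -> d < delta ->
    eps_isomorphism d (fourier f) (fourier g) S1 S2 phi ->
    modulus (density L f - density L g) < eps.
Proof.
move=> cL a0 FA fa eps eps0.
pose C : R := k%:R * (a + a) ^+ k.
have C0 : 0 <= C by rewrite mulr_ge0// exprn_ge0// addr_ge0// ltW.
(* Three errors of at most [eps / 4] will add up. The [+ 1] avoids dividing by zero when [k = 0]. *)
pose e := eps / 4 / (C + 1).
have e0 : 0 < e by rewrite !divr_gt0// ltr_wpDl.
have Ce : k%:R * ((a + a) ^+ k * e) <= eps / 4.
  rewrite mulrA -/C /e mulrA ler_pdivrMr ?ltr_wpDl// mulrC ler_wpM2l ?lerDl//.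
  by rewrite divr_ge0// ltW.
have [delta delta0 H] := cL e e0.
pose M := (Num.bound (delta ^- 2)).+1.
have Md : M%:R^-1 <= delta ^+ 2.
  rewrite -[leRHS]invrK lef_pV2 ?posrE ?invr_gt0 ?exprn_gt0// ltW//.
  rewrite (lt_le_trans (archi_boundP _)) ?invr_ge0 ?exprn_ge0 ?(ltW delta0)//.
  by rewrite ler_nat.
(* Half the threshold of [density_approximation], since the threshold halves on passing from [g]
   back to [f]. *)
pose eta := a * delta ^+ 2 / 2.
have eta0 : 0 < eta by rewrite divr_gt0// mulr_gt0// exprn_gt0.
have eta2 : a * delta ^+ 2 = eta + eta by rewrite [LHS]splitr.
have [s sE] := finite_spectrum f eta0.
pose W := fejer_words s (M ^ 2).
(* [prod_close] asks for a bound that is at least 1. *)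
pose b := Num.max 1 a.
have b1 : 1 <= b by rewrite le_max lexx.
have ab : a <= b by rewrite le_max lexx orbT.
pose Q : R := #|{ffun 'I_k -> 'I_(size W)}|%:R * (k%:R * b ^+ k).
have Q0 : 0 <= Q by rewrite !mulr_ge0// exprn_ge0// (le_trans _ b1).
(* Kernel words must be strictly shorter than the weight, hence the [.+1]; form words may reach
   it. *)
pose len := ((\max_(w <- W) size w).+1 +
  \max_(qj : {ffun 'I_k -> 'I_(size W)} * 'I_n) size (form_word L qj.1 qj.2))%N.
(* The three entries put the letters of the kernel into [S1], make the weight at least [len], and
   bound the comparison error [2 * Q * d] by [eps / 4]. *)
pose del := Num.min eta (Num.min (len.+1%:R^-1) (eps / 8 / (Q + 1))).
exists del.
  by rewrite !lt_min eta0 invr_gt0 ltr0n /= !divr_gt0// ltr_wpDl.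
move=> B g d S1 S2 phi FB ga d0; rewrite !lt_min => /and3P[d_eta d_len d_eps] iso.
have sS chi : chi \in s -> S1 chi.
  rewrite sE => lt; have [_ s1 _ _] := iso; apply: s1.
  by rewrite /supp/= normE ltcR (lt_trans d_eta).
have ceil_len : (len <= `|Num.ceil d^-1|)%N.
  have lt : len%:R < d^-1 :> R.
    apply: (@lt_trans _ _ len.+1%:R); first by rewrite ltr_nat.
    by rewrite -[ltLHS]invrK ltf_pV2 ?posrE ?invr_gt0 ?ltr0n.
  have : (len%:Z <= Num.ceil d^-1).
    by rewrite -(ler_int R) (le_trans (ltW lt))// Num.Theory.ceil_ge.
  by move=> le; rewrite -lez_nat (le_trans le)// lez_abs.
have fA : modulus (density L f - density L (fapprox id W f)) <= eps / 4.
  apply: le_trans Ce; apply: (density_approximation a0 delta0 (H A FA)) => // chi.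
  by rewrite eta2 => lt; exists chi => //; rewrite sE (le_lt_trans _ lt)// lerDl ltW.
have gB : modulus (density L g - density L (fapprox phi W g)) <= eps / 4.
  apply: le_trans Ce; apply: (density_approximation a0 delta0 (H B FB)) => // chi.
  rewrite eta2 => /(large_spectrum_transfer iso (ltW eta0) (ltW d_eta))[sigma ls ->].
  by exists sigma => //; rewrite sE.
have fg : modulus (density L (fapprox id W f) - density L (fapprox phi W g)) <= eps / 4.
  apply: (le_trans (density_fapprox_close _ b1 _ _ d0 iso sS _ _)).
  - by rewrite expn_gt0.
  - by move=> x; exact: le_trans (fa x) ab.
  - by move=> x; exact: le_trans (ga x) ab.
  - move=> w wW; apply: leq_trans ceil_len; rewrite /len addSn ltnS.
    by apply: leq_trans (leq_addr _ _); exact: leq_bigmax_seq.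
  - move=> q j; apply: leq_trans ceil_len; apply: leq_trans (leq_addl _ _).
    exact: (@leq_bigmax _
      (fun qj : {ffun 'I_k -> 'I_(size W)} * 'I_n => size (form_word L qj.1 qj.2)) (q, j)).
  - rewrite (_ : _ * _ = (Q * d) * 2); last by rewrite /Q; ring.
    have : Q * d <= eps / 8.
      rewrite (@le_trans _ _ ((Q + 1) * (eps / 8 / (Q + 1))))//.
        by apply: ler_pM => //; rewrite ?lerDl ?ltW.
      by rewrite mulrC divfK// lt0r_neq0// ltr_wpDl.
    by clear; lra.
rewrite (_ : _ - _ = (density L f - density L (fapprox id W f)) +
  (density L (fapprox id W f) - density L (fapprox phi W g)) -
  (density L g - density L (fapprox phi W g))); last by ring.
apply: (le_lt_trans (modulusB _ _)); apply: (@le_lt_trans _ _ (eps / 4 + eps / 4 + eps / 4)).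
  by rewrite lerD// (le_trans (modulusD _ _))// lerD.
by move: eps0; clear; lra.
Qed.

End Continuity.

(** The first conjunct makes the density well defined on isomorphism classes. The second is
    continuity at [f]; its [delta] may depend on [f] through the large spectrum. *)
Theorem theorem4p2 (R : realType) (a : R) (a_gt0 : 0 < a)
    (k n : nat) (L : 'M[int]_(k, n)) (F : compact_abelian_group R -> Prop)
    (L_complexity : true_complexity_at_most_1 L F) :
  (forall (A B : compact_abelian_group R) (f : A -> R[i]) (g : B -> R[i]),
     F A -> F B -> Linfty_ball a f -> Linfty_ball a g ->
     isomorphic f g -> density L f = density L g) /\
  (forall (A : compact_abelian_group R) (f : A -> R[i]),
     F A -> Linfty_ball a f ->
     forall eps : R, 0 < eps -> exists2 delta : R, 0 < delta &
       forall (B : compact_abelian_group R) (g : B -> R[i]),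
         F B -> Linfty_ball a g ->
         fun_dist f g < delta -> `|density L f - density L g| < eps%:C).
Proof.
split=> [A B f g FA FB [mf _] [mg _]|A f FA fa eps eps0].
  exact: isomorphic_density L_complexity FA FB mf mg.
have [f' [f'a ff']] := truncate (ltW a_gt0) fa.
have [delta delta0 H] := density_continuous L_complexity a_gt0 FA f'a eps0.
exists delta => // B g FB ga; have [g' [g'a gg']] := truncate (ltW a_gt0) ga.
rewrite (density_ae L_complexity FA fa.1 (bfunP f').1 ff').
rewrite (density_ae L_complexity FB ga.1 (bfunP g').1 gg').
rewrite /fun_dist (ae_eq_fourier fa.1 (bfunP f').1 ff').
rewrite (ae_eq_fourier ga.1 (bfunP g').1 gg') -/(fun_dist f' g') => fg.
have [d [d0 d_lt [S1 [S2 [phi iso]]]]] := fun_dist_lt a_gt0 f'a g'a fg.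
by rewrite normE ltcR; exact: (H B g' d S1 S2 phi).
Qed.
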